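(* Let $R$ be a root system. The toric variety $X(R)$ associated with $R$, together with the universal $R$-data on $X(R)$, represents the contravariant functor $F_R\colon(\mathrm{schemes})\to(\mathrm{sets})$ of $R$-data. That is, the morphism of functors $\mathrm{Mor}(\,\cdot\,,X(R))\to F_R$ sending $h\colon Y\to X(R)$ to the pull-back along $h$ of the universal $R$-data is an isomorphism.
   Context: A root system $R$ is a reduced crystallographic root system in (and spanning) a Euclidean space $E$. $M(R)\subset E$ is the lattice generated by the roots, $N(R)$ is the dual lattice. For a set of simple roots $S$ of $R$ put $\sigma_S=\{v\in N(R)_{\mathbb Q}:\langle u,v\rangle\ge 0\text{ for all }u\in S\}$ (closed Weyl chamber). The fan $\Sigma(R)$ in $N(R)$ consists of all the cones $\sigma_S$ and their faces, and $X(R)$ is the toric variety (as a scheme over $\mathbb Z$) of $\Sigma(R)$; it is covered by the open subschemes $U_S=\mathrm{Spec}\,\mathbb Z[\sigma_S^\vee\cap M(R)]$, where $\sigma_S^\vee\cap M(R)=\langle S\rangle$ is the submonoid of $M(R)$ generated by $S$. Each $u\in M(R)$ gives a character $x^u$ of the dense torus, i.e. a rational function on $X(R)$. $R$-data on a scheme $Y$: a family $(U_\alpha,f_\alpha)_{\alpha\in R}$ of open sets $U_\alpha\subseteq Y$ and regular functions $f_\alpha\in\mathcal O_Y(U_\alpha)$ such that (i) for all $\alpha\in R$: $Y=U_\alpha\cup U_{-\alpha}$, $\{f_\alpha\ne 0\}=U_\alpha\cap U_{-\alpha}$ and $f_\alpha f_{-\alpha}=1$ on $U_\alpha\cap U_{-\alpha}$;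 (ii) for all $\alpha,\beta,\gamma\in R$: if $\gamma=\alpha+\beta$, then $U_\alpha\cap U_\beta\subseteq U_\gamma$ and $f_\alpha f_\beta=f_\gamma$ on $U_\alpha\cap U_\beta$. (Equivalently: a family $(\mathscr L_{\{\pm\alpha\}},\{t_\alpha,t_{-\alpha}\})_{\{\pm\alpha\}\subseteq R}$ of line bundles on $Y$ with two generating sections, up to isomorphism of line bundles with a pair of sections, such that $t_\alpha t_\beta t_{-\gamma}=t_{-\alpha}t_{-\beta}t_\gamma$ whenever $\gamma=\alpha+\beta$ in $R$; the translation is $U_\alpha=\{t_{-\alpha}\neq0\}$, $f_\alpha=t_\alpha/t_{-\alpha}$.) $F_R$ sends $Y$ to the set of $R$-data on $Y$ and a morphism $h\colon Y'\to Y$ to pull-back of open sets and functions (or line bundles with sections). Universal $R$-data on $X(R)$: for $\alpha\in R$, $U_\alpha$ is the open subset of $X(R)$ where the rational function $x^\alpha$ is regular and $f_\alpha=x^\alpha|_{U_\alpha}$. *)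

(* Defs.v *)
From HB Require Import structures.
From mathcomp Require Import all_boot all_order all_algebra finmap ring.
From mathcomp Require Import sesquilinear generic_quotient.
From mathcomp Require Import boolp classical_sets reals topology.
From mathcomp Require monalg.
Import (canonicals) monalg.
From Stdlib Require Import Relations.

Set Implicit Arguments.
Unset Strict Implicit.
Unset Printing Implicit Defensive.

Import Order.TTheory GRing.Theory Num.Theory.
Local Open Scope classical_set_scope.
Local Open Scope ring_scope.
Local Open Scope quotient_scope.

(* Zero rings must be allowed (e.g. sections over the empty set), hence
   comPzRingType rather than comNzRingType. *)
Definition dprod (I : Type) (R : I -> comPzRingType) : Type := forall i, R i.

Section DependentProduct.
Context (I : Type) (R : I -> comPzRingType).
Local Notation P := (dprod R).

HB.instance Definition _ := gen_eqMixin P.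
HB.instance Definition _ := gen_choiceMixin P.

Let zero : P := fun=> 0.
Let one : P := fun=> 1.
Let opp (f : P) : P := fun i => - f i.
Let add (f g : P) : P := fun i => f i + g i.
Let mul (f g : P) : P := fun i => f i * g i.

Let addA : associative add.
Proof. by move=> f g h; apply: functional_extensionality_dep => i; exact: addrA. Qed.
Let addC : commutative add.
Proof. by move=> f g; apply: functional_extensionality_dep => i; exact: addrC. Qed.
Let add0 : left_id zero add.
Proof. by move=> f; apply: functional_extensionality_dep => i; exact: add0r. Qed.
Let addN : left_inverse zero opp add.
Proof. by move=> f; apply: functional_extensionality_dep => i; exact: addNr. Qed.
Let mulA : associative mul.
Proof. by move=> f g h; apply: functional_extensionality_dep => i; exact: mulrA. Qed.
Let mulC : commutative mul.
Proof. by move=> f g; apply: functional_extensionality_dep => i; exact: mulrC. Qed.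
Let mul1 : left_id one mul.
Proof. by move=> f; apply: functional_extensionality_dep => i; exact: mul1r. Qed.
Let mulD : left_distributive mul add.
Proof. by move=> f g h; apply: functional_extensionality_dep => i; exact: mulrDl. Qed.

HB.instance Definition _ := GRing.isZmodule.Build P addA addC add0 addN.
HB.instance Definition _ :=
  GRing.Zmodule_isComPzRing.Build P mulA mulC mul1 mulD.

Lemma dprodB (f g : P) i : (f - g) i = f i - g i. Proof. by []. Qed.
Lemma dprodM (f g : P) i : (f * g) i = f i * g i. Proof. by []. Qed.
Lemma dprod1 i : (1 : P) i = 1. Proof. by []. Qed.
End DependentProduct.

Definition is_subring (A : comPzRingType) (S : set A) : Prop :=
  [/\ S 1, forall a b, S a -> S b -> S (a - b) &
      forall a b, S a -> S b -> S (a * b)].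

Definition subring_pred (A : comPzRingType) (S : set A) (_ : is_subring S) :
  {pred A} := fun a => `[< S a >].

Section Subring.
Context (A : comPzRingType) (S : set A) (hS : is_subring S).

Let closed : subring_closed (subring_pred hS).
Proof.
case: hS => S1 SB SM; split; first exact/asboolP.
- by move=> a b /asboolP Sa /asboolP Sb; apply/asboolP; exact: SB.
- by move=> a b /asboolP Sa /asboolP Sb; apply/asboolP; exact: SM.
Qed.
HB.instance Definition _ :=
  GRing.isSubringClosed.Build A (subring_pred hS) closed.

Record subring := Subring {
  subring_val :> A;
  subring_valP : subring_val \in subring_pred hS
}.
HB.instance Definition _ := [isSub for subring_val].
HB.instance Definition _ := [Choice of subring by <:].
HB.instance Definition _ :=
  GRing.SubChoice_isSubComPzRing.Build _ _ subring (subringClosedP _).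

Definition subring_incl : {rmorphism subring -> A} := val.
End Subring.

Section SubringWiden.
Context (A : comPzRingType) (S S' : set A).
Context (hS : is_subring S) (hS' : is_subring S') (SS' : S `<=` S').

Let widen_in (a : subring hS) : subring_pred hS' a.
Proof. by apply/asboolP/SS'; have /asboolP := subring_valP a. Qed.

Definition subring_widen_fun (a : subring hS) : subring hS' :=
  Subring (widen_in a).

Let widenB : zmod_morphism subring_widen_fun.
Proof. by move=> a b; apply: val_inj; exact: (rmorphB (subring_incl hS)). Qed.
Let widenM : monoid_morphism subring_widen_fun.
Proof.
split=> [|a b]; apply: val_inj.
- exact: (rmorph1 (subring_incl hS)).
- exact: (rmorphM (subring_incl hS)).
Qed.

HB.instance Definition _ :=
  GRing.isZmodMorphism.Build _ _ subring_widen_fun widenB.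
HB.instance Definition _ :=
  GRing.isMonoidMorphism.Build _ _ subring_widen_fun widenM.

Definition subring_widen : {rmorphism subring hS -> subring hS'} :=
  subring_widen_fun.
End SubringWiden.

Record opens (T : topologicalType) := Opens {
  open_set :> set T;
  openP : open open_set
}.

Definition opens_setI (T : topologicalType) (U V : opens T) : opens T :=
  Opens (openI (openP U) (openP V)).

Definition opens_bigcup (T : topologicalType) (I : Type) (U : I -> opens T) :
    opens T :=
  Opens (bigcup_open (fun i (_ : [set: I] i) => openP (U i))).

Lemma opens_setIl (T : topologicalType) (U V : opens T) :
  opens_setI U V `<=` U.
Proof. by move=> x []. Qed.

Lemma opens_setIr (T : topologicalType) (U V : opens T) :
  opens_setI U V `<=` V.
Proof. by move=> x []. Qed.

Lemma opens_bigcup_sup (T : topologicalType) (I : Type) (U : I -> opens T) i :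
  U i `<=` opens_bigcup U.
Proof. by move=> x Ux; exists i. Qed.

(* A topological space with a presheaf of commutative rings; the sheaf axiom
   is the separate predicate [is_sheaf] and is part of [is_scheme]. *)
Record ringed_space := RingedSpace {
  rs_carrier :> topologicalType;
  rs_sections : opens rs_carrier -> comPzRingType;
  rs_res : forall U V : opens rs_carrier,
    V `<=` U -> {rmorphism rs_sections U -> rs_sections V};
  rs_res_id : forall (U : opens rs_carrier) (s : rs_sections U)
    (UU : U `<=` U), rs_res UU s = s;
  rs_res_comp : forall (U V W : opens rs_carrier) (s : rs_sections U)
    (VU : V `<=` U) (WV : W `<=` V) (WU : W `<=` U),
    rs_res WV (rs_res VU s) = rs_res WU s
}.

Notation "''O_' X ( U )" := (@rs_sections X U)
  (at level 8, X at level 2, format "''O_' X ( U )") : type_scope.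

Arguments rs_res {X U V} VU : rename.

Definition is_sheaf (X : ringed_space) : Prop :=
  forall (I : Type) (U : I -> opens X) (s : forall i, 'O_X (U i)),
    (forall i j, rs_res (@opens_setIl X (U i) (U j)) (s i) =
                 rs_res (@opens_setIr X (U i) (U j)) (s j)) ->
    exists! t : 'O_X (opens_bigcup U),
      forall i, rs_res (@opens_bigcup_sup X I U i) t = s i.

(* The germ of [s] at [x] is a unit of the stalk.  When the stalk is local
   this says that the value of [s] in the residue field at [x] is nonzero. *)
Definition germ_unit (X : ringed_space) (U : opens X) (s : 'O_X (U)) (x : X) :
    Prop :=
  exists (V : opens X) (VU : V `<=` U) (t : 'O_X (V)),
    open_set V x /\ rs_res VU s * t = 1.

Definition nonvanishing (X : ringed_space) (U : opens X) (s : 'O_X (U)) :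
    set X :=
  [set x | open_set U x /\ germ_unit s x].

Section Morphisms.

Section Preimage.
Context (S T : topologicalType) (f : S -> T).
Hypothesis f_cont : forall V : set T, open V -> open (f @^-1` V).
Definition opens_preimage (V : opens T) : opens S :=
  Opens (f_cont (openP V)).
End Preimage.

Record rs_mor (X Y : ringed_space) := RsMor {
  mor_fun :> X -> Y;
  mor_cont : forall V : set Y, open V -> open (mor_fun @^-1` V);
  mor_sec : forall V : opens Y,
    {rmorphism 'O_Y (V) -> 'O_X (opens_preimage mor_cont V)};
  mor_sec_res : forall (V W : opens Y) (WV : W `<=` V)
    (WV' : opens_preimage mor_cont W `<=` opens_preimage mor_cont V)
    (s : 'O_Y (V)),
    mor_sec W (rs_res WV s) = rs_res WV' (mor_sec V s)
}.

Definition mor_pre (X Y : ringed_space) (h : rs_mor X Y) (V : opens Y) :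
    opens X :=
  opens_preimage (@mor_cont _ _ h) V.

Lemma mor_sec_res_res (X Y : ringed_space) (h : rs_mor X Y) (V W : opens Y)
    (W' : opens X) (WV : W `<=` V) (W'W : W' `<=` mor_pre h W)
    (W'V : W' `<=` mor_pre h V) (s : 'O_Y (V)) :
  rs_res W'W (mor_sec h W (rs_res WV s)) = rs_res W'V (mor_sec h V s).
Proof.
have WV' : mor_pre h W `<=` mor_pre h V by move=> x; exact: WV.
by rewrite (mor_sec_res WV WV'); exact: rs_res_comp.
Qed.

(* The stalk maps O_(Y, h x) -> O_(X, x) are local homomorphisms. *)
Definition is_local (X Y : ringed_space) (h : rs_mor X Y) : Prop :=
  forall (V : opens Y) (s : 'O_Y (V)) (x : X),
    open_set V (h x) -> germ_unit (mor_sec h V s) x -> germ_unit s (h x).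

Record scheme_mor (X Y : ringed_space) := SchemeMor {
  scheme_mor_mor :> rs_mor X Y;
  scheme_mor_local : is_local scheme_mor_mor
}.

Section Composition.
Context (X Y Z : ringed_space) (g : rs_mor X Y) (h : rs_mor Y Z).

Let comp_cont (V : set Z) (oV : open V) : open ((h \o g) @^-1` V) :=
  mor_cont g (mor_cont h oV).

Let comp_sec (V : opens Z) :
    {rmorphism 'O_Z (V) -> 'O_X (opens_preimage comp_cont V)} :=
  (mor_sec g (mor_pre h V) \o mor_sec h V : {rmorphism _ -> _}).

Let comp_sec_res (V W : opens Z) (WV : W `<=` V)
    (WV' : opens_preimage comp_cont W `<=` opens_preimage comp_cont V)
    (s : 'O_Z (V)) :
  comp_sec W (rs_res WV s) = rs_res WV' (comp_sec V s).
Proof.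
have WV1 : mor_pre h W `<=` mor_pre h V by move=> y; exact: WV.
rewrite /comp_sec /= (mor_sec_res WV WV1).
exact: (@mor_sec_res _ _ g (mor_pre h V) (mor_pre h W)).
Qed.

Definition rs_comp : rs_mor X Z := RsMor comp_sec_res.

Lemma rs_comp_local : is_local g -> is_local h -> is_local rs_comp.
Proof.
by move=> gl hl V s x Vx /(gl (mor_pre h V) _ _ Vx); exact: hl.
Qed.
End Composition.

Definition scheme_comp (X Y Z : ringed_space)
    (g : scheme_mor X Y) (h : scheme_mor Y Z) : scheme_mor X Z :=
  SchemeMor (rs_comp_local (@scheme_mor_local _ _ g) (@scheme_mor_local _ _ h)).

Definition open_immersion (X Y : ringed_space) (j : rs_mor X Y) : Prop :=
  [/\ injective j,
      forall U : set X, open U -> open (j @` U) &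
      forall V : opens Y, V `<=` range j -> bijective (mor_sec j V)].

End Morphisms.

Record prime_ideal (A : comPzRingType) := PrimeIdeal {
  prime_set :> set A;
  prime0 : prime_set 0;
  primeD : forall a b, prime_set a -> prime_set b -> prime_set (a + b);
  primeMl : forall a b, prime_set b -> prime_set (a * b);
  prime1 : ~ prime_set 1;
  primeM : forall a b, prime_set (a * b) -> prime_set a \/ prime_set b
}.

HB.instance Definition _ A := gen_eqMixin (prime_ideal A).
HB.instance Definition _ A := gen_choiceMixin (prime_ideal A).

Lemma prime_outM (A : comPzRingType) (p : prime_ideal A) (a b : A) :
  ~ prime_set p a -> ~ prime_set p b -> ~ prime_set p (a * b).
Proof. by move=> pa pb /primeM[]. Qed.

Record fraction (A : comPzRingType) (p : prime_ideal A) := Fraction {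
  frac_num : A;
  frac_den : A;
  frac_out : ~ prime_set p frac_den
}.

HB.instance Definition _ A p := gen_eqMixin (@fraction A p).
HB.instance Definition _ A p := gen_choiceMixin (@fraction A p).

Section Localization.
Context (A : comPzRingType) (p : prime_ideal A).
Local Notation F := (fraction p).
Implicit Types x y z : F.

Definition frac_eq x y : bool :=
  `[< exists u : A, ~ prime_set p u /\
      u * (frac_num x * frac_den y) = u * (frac_num y * frac_den x) >].

Lemma frac_eq_equiv : equiv_class_of frac_eq.
Proof.
split.
- by move=> x; apply/asboolP; exists 1; split; first exact: prime1.
- by move=> x y; apply/asboolP/asboolP => -[u [pu e]]; exists u; split.
- move=> y x z /asboolP[u [pu e]] /asboolP[v [pv f]]; apply/asboolP.
  exists (u * v * frac_den y); split.
    by apply: prime_outM; [exact: prime_outM|exact: frac_out].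
  transitivity (v * frac_den z * (u * (frac_num x * frac_den y))); first ring.
  rewrite e.
  transitivity (u * frac_den x * (v * (frac_num y * frac_den z))); first ring.
  by rewrite f; ring.
Qed.

Canonical frac_equiv := EquivRelPack frac_eq_equiv.

Definition local_ring : Type := {eq_quot frac_equiv}.
HB.instance Definition _ := EqQuotient.on local_ring.
HB.instance Definition _ := Choice.on local_ring.

Definition to_local x : local_ring := \pi x.

Lemma to_localP x y :
  to_local x = to_local y <->
  exists u : A, ~ prime_set p u /\
    u * (frac_num x * frac_den y) = u * (frac_num y * frac_den x).
Proof.
by split=> [/eqP|e]; [|apply/eqP]; rewrite /to_local piE => *; exact/asboolP.
Qed.

Lemma to_local_repr (a : local_ring) : to_local (repr a) = a.
Proof. exact: reprK. Qed.

Lemma to_local_ind (P : local_ring -> Prop) :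
  (forall x, P (to_local x)) -> forall a, P a.
Proof. by move=> h a; rewrite -(to_local_repr a); exact: h. Qed.

Implicit Types a b : local_ring.

Let f0 : F := Fraction 0 (@prime1 A p).
Let f1 : F := Fraction 1 (@prime1 A p).
Let fN x : F := Fraction (- frac_num x) (@frac_out _ _ x).
Let fD x y : F :=
  Fraction (frac_num x * frac_den y + frac_num y * frac_den x)
           (prime_outM (@frac_out _ _ x) (@frac_out _ _ y)).
Let fM x y : F :=
  Fraction (frac_num x * frac_num y)
           (prime_outM (@frac_out _ _ x) (@frac_out _ _ y)).

Definition local_zero := to_local f0.
Definition local_one := to_local f1.
Definition local_opp a := to_local (fN (repr a)).
Definition local_add a b := to_local (fD (repr a) (repr b)).
Definition local_mul a b := to_local (fM (repr a) (repr b)).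

Let oppE x : local_opp (to_local x) = to_local (fN x).
Proof.
apply/to_localP => /=; have /to_localP[u [pu e]] := to_local_repr (to_local x).
exists u; split=> //.
transitivity (- (u * (frac_num (repr (to_local x)) * frac_den x))); first ring.
by rewrite e; ring.
Qed.

Let addE x y : local_add (to_local x) (to_local y) = to_local (fD x y).
Proof.
apply/to_localP => /=.
have /to_localP[u [pu e]] := to_local_repr (to_local x).
have /to_localP[v [pv f]] := to_local_repr (to_local y).
move: (repr _) e (repr _) f => x' e y' f.
exists (u * v); split; first exact: prime_outM.
transitivity (u * (frac_num x' * frac_den x) * (v * frac_den y' * frac_den y)
  + v * (frac_num y' * frac_den y) * (u * frac_den x' * frac_den x)); first ring.
by rewrite e f; ring.
Qed.

Let mulE x y : local_mul (to_local x) (to_local y) = to_local (fM x y).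
Proof.
apply/to_localP => /=.
have /to_localP[u [pu e]] := to_local_repr (to_local x).
have /to_localP[v [pv f]] := to_local_repr (to_local y).
move: (repr _) e (repr _) f => x' e y' f.
exists (u * v); split; first exact: prime_outM.
transitivity (u * (frac_num x' * frac_den x) * (v * (frac_num y' * frac_den y)));
  first ring.
by rewrite e f; ring.
Qed.

Ltac local_axiom :=
  repeat (let x := fresh "x" in elim/to_local_ind => x);
  rewrite /local_zero /local_one ?(oppE, addE, mulE);
  apply/to_localP => /=; exists 1; split; [exact: prime1|ring].

Let addA : associative local_add. Proof. local_axiom. Qed.
Let addC : commutative local_add. Proof. local_axiom. Qed.
Let add0 : left_id local_zero local_add. Proof. local_axiom. Qed.
Let addN : left_inverse local_zero local_opp local_add. Proof. local_axiom. Qed.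
Let mulA : associative local_mul. Proof. local_axiom. Qed.
Let mulC : commutative local_mul. Proof. local_axiom. Qed.
Let mul1 : left_id local_one local_mul. Proof. local_axiom. Qed.
Let mulD : left_distributive local_mul local_add. Proof. local_axiom. Qed.

HB.instance Definition _ := GRing.isZmodule.Build local_ring addA addC add0 addN.
HB.instance Definition _ :=
  GRing.Zmodule_isComPzRing.Build local_ring mulA mulC mul1 mulD.

Lemma to_localN x : - to_local x = to_local (fN x). Proof. exact: oppE. Qed.
Lemma to_localD x y : to_local x + to_local y = to_local (fD x y).
Proof. exact: addE. Qed.
Lemma to_localM x y : to_local x * to_local y = to_local (fM x y).
Proof. exact: mulE. Qed.
Lemma to_local0 : (0 : local_ring) = to_local f0. Proof. by []. Qed.
Lemma to_local1 : (1 : local_ring) = to_local f1. Proof. by []. Qed.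

End Localization.

Section SpecTopology.
Context (A : comPzRingType).

(* The complement of V(I), for an arbitrary subset I of A. *)
Definition zariski_open (U : set (prime_ideal A)) : Prop :=
  exists I : set A, U = [set p | exists2 a, I a & ~ prime_set p a].

Let zariskiT : zariski_open setT.
Proof.
by exists [set 1]; apply/seteqP; split=> // p _; exists 1 => //; exact: prime1.
Qed.

Let zariskiI : setI_closed zariski_open.
Proof.
move=> _ _ [I ->] [J ->].
exists [set c | exists a b, [/\ I a, J b & c = a * b]].
apply/seteqP; split=> p /=.
- move=> [[a Ia pa] [b Jb pb]]; exists (a * b); first by exists a, b.
  exact: prime_outM.
- move=> [_ [a [b [Ia Jb ->]]] pab]; split.
  + by exists a => // pa; apply: pab; rewrite mulrC; exact: primeMl.
  + by exists b => // pb; apply: pab; exact: primeMl.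
Qed.

Let zariski_bigcup (I : Type) (U : I -> set (prime_ideal A)) :
  (forall i, zariski_open (U i)) -> zariski_open (\bigcup_i U i).
Proof.
move=> /choice[J UE]; exists (\bigcup_i J i); apply/seteqP; split=> p /=.
- by move=> [i _]; rewrite UE => -[a Ja pa]; exists a => //; exists i.
- by move=> [a [i _ Ja] pa]; exists i => //; rewrite UE; exists a.
Qed.

HB.instance Definition _ := isOpenTopological.Build (prime_ideal A)
  zariskiT zariskiI zariski_bigcup.

Lemma zariski_openE (U : set (prime_ideal A)) : open U = zariski_open U.
Proof. by []. Qed.
End SpecTopology.

Section Spec.
Context (A : comPzRingType).
Implicit Types U V W : opens (prime_ideal A).

Definition spec_stalks U : comPzRingType :=
  dprod (fun p : {p : prime_ideal A | open_set U p} => local_ring (sval p)).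

Definition locally_fraction U : set (spec_stalks U) :=
  [set s | forall p : {p : prime_ideal A | open_set U p},
    exists V (a b : A), open_set V (sval p) /\
      forall q : {q : prime_ideal A | open_set U q}, open_set V (sval q) ->
        exists qb : ~ prime_set (sval q) b, s q = to_local (Fraction a qb)].

Lemma locally_fraction_subring U : is_subring (@locally_fraction U).
Proof.
split.
- move=> p; exists U, 1, 1; split=> [|q _]; first exact: (svalP p).
  by exists (@prime1 _ _).
- move=> s t hs ht p.
  have [V [a [b [Vp sE]]]] := hs p; have [W [c [d [Wp tE]]]] := ht p.
  exists (opens_setI V W), (a * d - c * b), (b * d); split=> // q [Vq Wq].
  have [qb e] := sE q Vq; have [qd f] := tE q Wq.
  exists (prime_outM qb qd).
  rewrite dprodB e f to_localN to_localD /=.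
  by apply/to_localP => /=; exists 1; split; [exact: prime1|ring].
- move=> s t hs ht p.
  have [V [a [b [Vp sE]]]] := hs p; have [W [c [d [Wp tE]]]] := ht p.
  exists (opens_setI V W), (a * c), (b * d); split=> // q [Vq Wq].
  have [qb e] := sE q Vq; have [qd f] := tE q Wq.
  exists (prime_outM qb qd).
  rewrite dprodM e f to_localM /=.
  by apply/to_localP => /=; exists 1; split; [exact: prime1|ring].
Qed.

Definition spec_sections U : comPzRingType :=
  subring (locally_fraction_subring U).

Section Restriction.
Context (U V : opens (prime_ideal A)) (VU : V `<=` U).

Let res_fun (s : spec_stalks U) : spec_stalks V :=
  fun p => s (exist _ (sval p) (VU (svalP p))).

Let res_fun_local (s : spec_sections U) :
  subring_pred (locally_fraction_subring V) (res_fun s).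
Proof.
apply/asboolP => p; have /asboolP hs := subring_valP s.
have [W [a [b [Wp sE]]]] := hs (exist _ (sval p) (VU (svalP p))).
exists W, a, b; split=> // q Wq.
exact: (sE (exist _ (sval q) (VU (svalP q)))).
Qed.

Definition spec_res_fun (s : spec_sections U) : spec_sections V :=
  Subring (res_fun_local s).

Let spec_resB : zmod_morphism spec_res_fun.
Proof. by move=> s t; apply: val_inj. Qed.
Let spec_resM : monoid_morphism spec_res_fun.
Proof. by split=> [|s t]; apply: val_inj. Qed.

HB.instance Definition _ :=
  GRing.isZmodMorphism.Build _ _ spec_res_fun spec_resB.
HB.instance Definition _ :=
  GRing.isMonoidMorphism.Build _ _ spec_res_fun spec_resM.

Definition spec_res : {rmorphism spec_sections U -> spec_sections V} :=
  spec_res_fun.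
End Restriction.

Lemma spec_res_id U (s : spec_sections U) (UU : U `<=` U) : spec_res UU s = s.
Proof.
apply: val_inj; apply: functional_extensionality_dep => -[p Up] /=.
by congr (subring_val s (exist _ _ _)); exact: Prop_irrelevance.
Qed.

Lemma spec_res_comp U V W (s : spec_sections U)
  (VU : V `<=` U) (WV : W `<=` V) (WU : W `<=` U) :
  spec_res WV (spec_res VU s) = spec_res WU s.
Proof.
apply: val_inj; apply: functional_extensionality_dep => -[p Wp] /=.
by congr (subring_val s (exist _ _ _)); exact: Prop_irrelevance.
Qed.

Definition Spec : ringed_space := RingedSpace spec_res_id spec_res_comp.

Section Structure.
Context (U : opens (prime_ideal A)).

Let const_fun (a : A) : spec_stalks U :=
  fun p => to_local (Fraction a (@prime1 _ (sval p))).

Let const_fun_local (a : A) :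
  subring_pred (locally_fraction_subring U) (const_fun a).
Proof.
apply/asboolP => p; exists U, a, 1; split=> [|q _]; first exact: (svalP p).
by exists (@prime1 _ _).
Qed.

Definition spec_const (a : A) : 'O_Spec (U) := Subring (const_fun_local a).
End Structure.
End Spec.

Definition is_scheme (X : ringed_space) : Prop :=
  is_sheaf X /\
  forall x : X, exists (A : comPzRingType) (j : rs_mor (Spec A) X),
    open_immersion j /\ range j x.

Section SpecMap.
Context (A B : comPzRingType) (f : {rmorphism A -> B}).

Definition prime_preimage (q : prime_ideal B) : prime_ideal A.
Proof.
refine (@PrimeIdeal A (f @^-1` q) _ _ _ _ _) => /=.
- by rewrite rmorph0; exact: prime0.
- by move=> a b qa qb; rewrite rmorphD; exact: primeD.
- by move=> a b qb; rewrite rmorphM; exact: primeMl.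
- by rewrite rmorph1; exact: prime1.
- by move=> a b; rewrite rmorphM; exact: primeM.
Defined.

Lemma prime_preimage_cont (V : set (prime_ideal A)) :
  open V -> open (prime_preimage @^-1` V).
Proof.
rewrite !zariski_openE => -[I ->]; exists (f @` I).
apply/seteqP; split=> q /=.
- by move=> [a Ia qa]; exists (f a) => //; exists a.
- by move=> [_ [a Ia <-] qa]; exists a.
Qed.

(* a/b |-> f(a)/f(b) on the localizations at f^{-1}(q) and q. *)
Section LocalMap.
Context (q : prime_ideal B).

Let frac_map (x : fraction (prime_preimage q)) : fraction q :=
  @Fraction B q (f (frac_num x)) (f (frac_den x)) (@frac_out _ _ x).

Definition local_map (a : local_ring (prime_preimage q)) : local_ring q :=
  to_local (frac_map (repr a)).

Lemma local_mapE (x : fraction (prime_preimage q)) :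
  local_map (to_local x) = to_local (frac_map x).
Proof.
apply/to_localP => /=; have /to_localP[u [pu e]] := to_local_repr (to_local x).
by exists (f u); split=> //; rewrite -!rmorphM e.
Qed.

Lemma local_map1 : local_map 1 = 1.
Proof.
rewrite !to_local1 local_mapE; apply/to_localP => /=.
by exists 1; split; [exact: prime1|rewrite !rmorph1].
Qed.

Lemma local_mapB a b : local_map (a - b) = local_map a - local_map b.
Proof.
elim/to_local_ind: a => x; elim/to_local_ind: b => y.
rewrite to_localN to_localD !local_mapE to_localN to_localD; apply/to_localP => /=.
exists 1; split; first exact: prime1.
by rewrite !(rmorphM, rmorphD, rmorphN).
Qed.

Lemma local_mapM a b : local_map (a * b) = local_map a * local_map b.
Proof.
elim/to_local_ind: a => x; elim/to_local_ind: b => y.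
rewrite to_localM !local_mapE to_localM; apply/to_localP => /=.
exists 1; split; first exact: prime1.
by rewrite !rmorphM.
Qed.
End LocalMap.

Section Sections.
Context (V : opens (Spec A)).
Let V' : opens (Spec B) := opens_preimage prime_preimage_cont V.

Let pull_fun (s : spec_stalks V) : spec_stalks V' :=
  fun q => local_map (s (exist _ (prime_preimage (sval q)) (svalP q))).

Let pull_fun_local (s : 'O_(Spec A) (V)) :
  subring_pred (locally_fraction_subring V') (pull_fun s).
Proof.
apply/asboolP => q; have /asboolP hs := subring_valP s.
have [W [a [b [Wp sE]]]] := hs (exist _ (prime_preimage (sval q)) (svalP q)).
exists (opens_preimage prime_preimage_cont W), (f a), (f b); split=> // r Wr.
have [rb e] := sE (exist _ (prime_preimage (sval r)) (svalP r)) Wr.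
by exists rb; rewrite /pull_fun e local_mapE.
Qed.

Definition spec_pull_fun (s : 'O_(Spec A) (V)) : 'O_(Spec B) (V') :=
  Subring (pull_fun_local s).

Let spec_pullB : zmod_morphism spec_pull_fun.
Proof.
move=> s t; apply: val_inj; apply: functional_extensionality_dep => q.
exact: local_mapB.
Qed.
Let spec_pullM : monoid_morphism spec_pull_fun.
Proof.
split=> [|s t]; apply: val_inj; apply: functional_extensionality_dep => q.
- exact: local_map1.
- exact: local_mapM.
Qed.

HB.instance Definition _ :=
  GRing.isZmodMorphism.Build _ _ spec_pull_fun spec_pullB.
HB.instance Definition _ :=
  GRing.isMonoidMorphism.Build _ _ spec_pull_fun spec_pullM.

Definition spec_pull : {rmorphism 'O_(Spec A) (V) -> 'O_(Spec B) (V')} :=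
  spec_pull_fun.
End Sections.

Lemma spec_pull_res (V W : opens (Spec A)) (WV : W `<=` V)
    (WV' : opens_preimage prime_preimage_cont W `<=`
           opens_preimage prime_preimage_cont V) (s : 'O_(Spec A) (V)) :
  spec_pull W (@rs_res (Spec A) _ _ WV s) =
  @rs_res (Spec B) _ _ WV' (spec_pull V s).
Proof.
apply: val_inj; apply: functional_extensionality_dep => -[q Wq] /=.
congr (local_map (subring_val s (exist _ _ _))); exact: Prop_irrelevance.
Qed.

Definition spec_map : rs_mor (Spec B) (Spec A) := 
  @RsMor (Spec B) (Spec A) prime_preimage prime_preimage_cont spec_pull
    spec_pull_res.
End SpecMap.

(* The coequalizer, in ringed spaces, of the two maps
   coprod_(i,j) V_ij => coprod_i U_i: its points are the classes of the
   equivalence relation generated by l(v) ~ r(v), it carries the quotient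
   topology, and a section over W is a family of sections s_i over the
   preimages of W in the U_i that agree on all V_ij. *)
Section Gluing.
Context (I : choiceType) (U : I -> ringed_space) (V : I -> I -> ringed_space)
  (l : forall i j, rs_mor (V i j) (U i)) (r : forall i j, rs_mor (V i j) (U j)).

Let Ucar (i : I) : topologicalType := U i.
Local Notation total := {i : I & Ucar i}.

Definition glue_step (x y : total) : Prop :=
  exists i j (v : V i j), x = existT Ucar i (l i j v) /\
                          y = existT Ucar j (r i j v).

Definition glue_rel (x y : total) : bool :=
  `[< clos_refl_sym_trans total glue_step x y >].

Lemma glue_rel_equiv : equiv_class_of glue_rel.
Proof.
split.
- by move=> x; apply/asboolP; exact: rst_refl.
- by move=> x y; apply/asboolP/asboolP; exact: rst_sym.
- by move=> y x z /asboolP xy /asboolP yz; apply/asboolP; exact: rst_trans yz.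
Qed.

Canonical glue_equiv := EquivRelPack glue_rel_equiv.

Definition glue_quot : quotType total := {eq_quot glue_equiv}.
Definition glue_space : topologicalType := quotient_topology glue_quot.

Definition glue_point (i : I) (x : U i) : glue_space :=
  \pi_(quotient_topology glue_quot) (existT Ucar i x).

Lemma glue_point_cont (i : I) (W : set glue_space) :
  open W -> open (glue_point (i := i) @^-1` W).
Proof. by move=> oW; exact: (sigT_openP _).1 oW i. Qed.

Lemma glue_pointE i j (v : V i j) :
  glue_point (r i j v) = glue_point (l i j v).
Proof.
apply: (@eqmodP _ glue_equiv _ _ _); apply/asboolP; apply: rst_sym.
by apply: rst_step; exists i, j, v.
Qed.

Section Sections.
Context (W : opens glue_space).

Definition glue_pre (i : I) : opens (U i) :=
  opens_preimage (@glue_point_cont i) W.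

Lemma glue_pre_sub i j :
  mor_pre (r i j) (glue_pre j) `<=` mor_pre (l i j) (glue_pre i).
Proof. by move=> v; rewrite /= glue_pointE. Qed.

Definition compatible : set (dprod (fun i => 'O_(U i) (glue_pre i))) :=
  [set s | forall i j,
    rs_res (@glue_pre_sub i j) (mor_sec (l i j) (glue_pre i) (s i)) =
    mor_sec (r i j) (glue_pre j) (s j)].

Lemma compatible_subring : is_subring compatible.
Proof.
split.
- by move=> i j; rewrite !dprod1 !rmorph1.
- by move=> s t hs ht i j; rewrite !dprodB !rmorphB hs ht.
- by move=> s t hs ht i j; rewrite !dprodM !rmorphM hs ht.
Qed.

Definition glue_sections : comPzRingType := subring compatible_subring.
End Sections.

Section Restriction.
Context (W W' : opens glue_space) (sub : W' `<=` W).

Let pre_sub i : glue_pre W' i `<=` glue_pre W i.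
Proof. by move=> x; exact: sub. Qed.

Let res_fun (s : glue_sections W) :
    dprod (fun i => 'O_(U i) (glue_pre W' i)) :=
  fun i => rs_res (@pre_sub i) (subring_val s i).

Let res_fun_compatible (s : glue_sections W) :
  subring_pred (compatible_subring W') (res_fun s).
Proof.
apply/asboolP => i j; have /asboolP hs := subring_valP s.
have lsub : mor_pre (l i j) (glue_pre W' i) `<=` mor_pre (l i j) (glue_pre W i).
  by move=> v; exact: sub.
have rsub : mor_pre (r i j) (glue_pre W' j) `<=` mor_pre (r i j) (glue_pre W j).
  by move=> v; exact: sub.
have sub' : mor_pre (r i j) (glue_pre W' j) `<=` mor_pre (l i j) (glue_pre W i).
  by move=> v /rsub; exact: glue_pre_sub.
rewrite /res_fun (mor_sec_res _ lsub) (mor_sec_res _ rsub) -hs.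
by rewrite (rs_res_comp _ _ _ sub') (rs_res_comp _ _ _ sub').
Qed.

Definition glue_res_fun (s : glue_sections W) : glue_sections W' :=
  Subring (res_fun_compatible s).

Let glue_resB : zmod_morphism glue_res_fun.
Proof.
move=> s t; apply: val_inj; apply: functional_extensionality_dep => i.
exact: (rmorphB (rs_res (@pre_sub i))).
Qed.
Let glue_resM : monoid_morphism glue_res_fun.
Proof.
split=> [|s t]; apply: val_inj; apply: functional_extensionality_dep => i.
- exact: (rmorph1 (rs_res (@pre_sub i))).
- exact: (rmorphM (rs_res (@pre_sub i))).
Qed.

HB.instance Definition _ :=
  GRing.isZmodMorphism.Build _ _ glue_res_fun glue_resB.
HB.instance Definition _ :=
  GRing.isMonoidMorphism.Build _ _ glue_res_fun glue_resM.

Definition glue_res : {rmorphism glue_sections W -> glue_sections W'} :=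
  glue_res_fun.
End Restriction.

Lemma glue_res_id (W : opens glue_space) (s : glue_sections W)
    (WW : W `<=` W) :
  glue_res WW s = s.
Proof.
apply: val_inj; apply: functional_extensionality_dep => i; exact: rs_res_id.
Qed.

Lemma glue_res_comp (W W' W'' : opens glue_space) (s : glue_sections W)
    (sub : W' `<=` W) (sub' : W'' `<=` W') (sub'' : W'' `<=` W) :
  glue_res sub' (glue_res sub s) = glue_res sub'' s.
Proof.
apply: val_inj; apply: functional_extensionality_dep => i; exact: rs_res_comp.
Qed.

Definition glue : ringed_space := RingedSpace glue_res_id glue_res_comp.

Section Chart.
Context (i : I).

Definition glue_proj_fun (W : opens glue) (s : 'O_glue (W)) :
    'O_(U i) (opens_preimage (@glue_point_cont i) W) :=
  subring_val s i.

Let glue_projB W : zmod_morphism (@glue_proj_fun W).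
Proof. by []. Qed.
Let glue_projM W : monoid_morphism (@glue_proj_fun W).
Proof. by []. Qed.

HB.instance Definition _ W :=
  GRing.isZmodMorphism.Build _ _ (@glue_proj_fun W) (@glue_projB W).
HB.instance Definition _ W :=
  GRing.isMonoidMorphism.Build _ _ (@glue_proj_fun W) (@glue_projM W).

Definition glue_proj (W : opens glue) :
    {rmorphism 'O_glue (W) -> 'O_(U i) (opens_preimage (@glue_point_cont i) W)} :=
  @glue_proj_fun W.

Lemma glue_proj_res (W W' : opens glue) (sub : W' `<=` W)
    (sub' : opens_preimage (@glue_point_cont i) W' `<=`
            opens_preimage (@glue_point_cont i) W) (s : 'O_glue (W)) :
  glue_proj W' (rs_res sub s) = @rs_res (U i) _ _ sub' (glue_proj W s).
Proof.
by rewrite /= /glue_proj_fun /=; congr (rs_res _ _); exact: Prop_irrelevance.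
Qed.

Definition glue_chart : rs_mor (U i) glue :=
  @RsMor (U i) glue (@glue_point i) (@glue_point_cont i) glue_proj
    glue_proj_res.
End Chart.

End Gluing.

(* Finitely supported functions G -> Z, multiplied by convolution. *)
Definition group_ring (G : zmodType) : Type := monalg.malg G int.

Section GroupRing.
Context (G : zmodType).
Local Notation ZG := (group_ring G).
Implicit Types (g : ZG) (k : G) (c : int).

HB.instance Definition _ := GRing.Zmodule.on ZG.

Local Notation supp := (@monalg.msupp G int).
Local Notation "g @_ k" := (@monalg.mcoeff G int k g) (at level 3, k at level 2).
Definition monomial c k : ZG := @monalg.mkmalgU G int k c.

Definition gr_mul g1 g2 : ZG :=
  \sum_(k1 <- supp g1) \sum_(k2 <- supp g2)
    monomial (g1 @_ k1 * g2 @_ k2) (k1 + k2).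
Definition gr_one : ZG := monomial 1 0.

Let mulw (d1 d2 : {fset G}) g1 g2 :
  (supp g1 `<=` d1)%fset -> (supp g2 `<=` d2)%fset ->
  gr_mul g1 g2 = \sum_(k1 <- d1) \sum_(k2 <- d2)
    monomial (g1 @_ k1 * g2 @_ k2) (k1 + k2).
Proof.
move=> le1 le2; rewrite /gr_mul (big_fset_incl _ le1) /=.
  apply/eq_bigr=> k1 _; apply/big_fset_incl => // k _ /monalg.mcoeff_outdom ->.
  by rewrite mulr0 /monomial monalg.monalgU0.
move=> k _ /monalg.mcoeff_outdom g1k.
by rewrite big1 => // k' _; rewrite g1k mul0r /monomial monalg.monalgU0.
Qed.

Let gr_mulC : commutative gr_mul.
Proof.
move=> g1 g2; rewrite /gr_mul exchange_big /=.
by apply/eq_bigr=> k1 _; apply/eq_bigr=> k2 _; rewrite mulrC addrC.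
Qed.

Let mulUU c1 c2 k1 k2 :
  gr_mul (monomial c1 k1) (monomial c2 k2) = monomial (c1 * c2) (k1 + k2).
Proof.
rewrite (mulw monalg.msuppU_le monalg.msuppU_le) !big_seq_fset1.
by rewrite /monomial !monalg.mcoeffUU.
Qed.

Let mul0 g : gr_mul 0 g = 0.
Proof. by rewrite /gr_mul monalg.msupp0 big_seq_fset0. Qed.

Let mulD : left_distributive gr_mul +%R.
Proof.
move=> g1 g2 g.
rewrite [gr_mul g1 g](mulw (fsubsetUl _ (supp g2)) (fsubset_refl _)).
rewrite [gr_mul g2 g](mulw (fsubsetUr (supp g1) _) (fsubset_refl _)).
have le12 : (supp (g1 + g2) `<=` supp g1 `|` supp g2)%fset.
  exact: monalg.msuppD_le.
have coefD k : (g1 + g2) @_ k = g1 @_ k + g2 @_ k by exact: monalg.mcoeffD.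
have monoD c c' k : monomial (c + c') k = monomial c k + monomial c' k.
  exact: monalg.monalgUD.
rewrite (mulw le12 (fsubset_refl _)) -big_split /=; apply/eq_bigr=> k1 _.
rewrite -big_split /=; apply/eq_bigr=> k2 _.
by rewrite coefD mulrDl monoD.
Qed.

Let mul0r g : gr_mul g 0 = 0. Proof. by rewrite gr_mulC mul0. Qed.
Let mulDr : right_distributive gr_mul +%R.
Proof. by move=> g g1 g2; rewrite gr_mulC mulD gr_mulC [gr_mul g g2]gr_mulC. Qed.

Let expand g : g = \sum_(k <- supp g) monomial (g @_ k) k.
Proof. exact: monalg.monalgE. Qed.

Let mul_suml (s : seq G) (F : G -> ZG) g :
  gr_mul (\sum_(k <- s) F k) g = \sum_(k <- s) gr_mul (F k) g.
Proof. exact: (big_morph (gr_mul^~ g) (fun x y => mulD x y g) (mul0 g)). Qed.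
Let mul_sumr (s : seq G) (F : G -> ZG) g :
  gr_mul g (\sum_(k <- s) F k) = \sum_(k <- s) gr_mul g (F k).
Proof. exact: (big_morph (gr_mul g) (mulDr g) (mul0r g)). Qed.

Let mulA : associative gr_mul.
Proof.
move: mul_suml mul_sumr mulUU; move: gr_mul => m suml sumr UU g1 g2 g3.
rewrite [g1]expand [g2]expand [g3]expand.
rewrite !suml; apply: eq_bigr => k1 _.
rewrite [X in _ = m X _]sumr suml [LHS]sumr; apply: eq_bigr => k2 _.
rewrite !(suml, sumr); apply: eq_bigr => k3 _.
by rewrite !UU mulrA addrA.
Qed.

Let mul1 : left_id gr_one gr_mul.
Proof.
move: mul_sumr mulUU; move: gr_mul => m sumr UU g.
rewrite [g in LHS]expand sumr [RHS]expand.
by apply: eq_bigr => k _; rewrite UU mul1r add0r.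
Qed.

HB.instance Definition _ :=
  GRing.Zmodule_isComPzRing.Build ZG mulA gr_mulC mul1 mulD.

Definition character (u : G) : ZG := monomial 1 u.

Definition supported_in (P : set G) : set ZG :=
  [set g | forall k, k \in supp g -> P k].

Lemma supported_in_subring (P : set G) :
  P 0 -> (forall a b, P a -> P b -> P (a + b)) ->
  is_subring (supported_in P).
Proof.
move=> P0 PD.
have PU c k : P k -> supported_in P (monomial c k).
  by move=> Pk k' /(fsubsetP (monalg.msuppU_le)); rewrite inE => /eqP ->.
have Padd g h : supported_in P g -> supported_in P h -> supported_in P (g + h).
  move=> hg hh k /(fsubsetP (monalg.msuppD_le _ _)); rewrite inE => /orP[].
  - exact: hg.
  - exact: hh.
have Psum (s : seq G) (F : G -> ZG) :
    (forall k, k \in s -> supported_in P (F k)) ->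
    supported_in P (\sum_(k <- s) F k).
  elim: s => [|k s IH] h.
    by rewrite big_nil => k; rewrite monalg.msupp0 inE.
  rewrite big_cons; apply: (Padd); first by apply: h; rewrite inE eqxx.
  by apply: IH => k' k's; apply: h; rewrite inE k's orbT.
split.
- exact: PU.
- move=> g h hg hh; apply: (Padd) => // k; rewrite monalg.msuppN; exact: hh.
- move=> g h hg hh; apply: (Psum) => k1 k1g; apply: (Psum) => k2 k2h.
  by apply: (PU); apply: (PD); [exact: hg|exact: hh].
Qed.
End GroupRing.

Section RootSystem.
Context (K : realType) (E : vectType K).

Definition reflection (ip : {dot E for idfun}) (a b : E) : E :=
  b - (2 * ip b a / ip a a) *: a.

Definition is_root_system (ip : {dot E for idfun}) (R : {fset E}) : Prop :=
  [/\ <<R>>%VS = fullv,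
      0 \notin R,
      forall a b, a \in R -> b \in R -> reflection ip a b \in R,
      forall a b, a \in R -> b \in R -> 2 * ip b a / ip a a \is a Num.int &
      forall a (c : K), a \in R -> c *: a \in R -> c = 1 \/ c = -1].

Definition is_simple_roots (R S : {fset E}) : Prop :=
  [/\ (S `<=` R)%fset,
      basis_of fullv S &
      forall a, a \in R -> exists c : E -> nat,
        a = \sum_(s <- S) s *+ c s \/ a = - \sum_(s <- S) s *+ c s].

Definition in_root_lattice (R : {fset E}) : {pred E} :=
  fun u => `[< exists c : E -> int, u = \sum_(a <- R) a *~ c a >].

Section Lattice.
Context (R : {fset E}).

Let closed : zmod_closed (in_root_lattice R).
Proof.
split.
  by apply/asboolP; exists (fun=> 0); rewrite big1.
move=> _ _ /asboolP[c ->] /asboolP[d ->]; apply/asboolP.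
exists (fun a => c a - d a); rewrite -sumrB; apply: eq_bigr => a _.
by rewrite mulrzBr.
Qed.
HB.instance Definition _ :=
  GRing.isZmodClosed.Build E (in_root_lattice R) closed.

Lemma root_in_lattice a : a \in R -> a \in in_root_lattice R.
Proof.
move=> aR; apply/asboolP; exists (fun b => (b == a)%:Z).
rewrite (big_fsetD1 a) //= eqxx mulr1z big1_fset ?addr0 // => b.
by rewrite !inE => /andP[/negPf-> _] _; rewrite mulr0z.
Qed.

Record root_lattice := RootLattice {
  lattice_val :> E;
  lattice_valP : lattice_val \in in_root_lattice R
}.
HB.instance Definition _ := [isSub for lattice_val].
HB.instance Definition _ := [Choice of root_lattice by <:].
HB.instance Definition _ := [SubChoice_isSubZmodule of root_lattice by <:].

Definition root_elt (a : R) : root_lattice :=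
  RootLattice (root_in_lattice (valP a)).

(* N(R) (x) Q, where N(R) = Hom(M(R), Z) and M(R) is free of finite rank. *)
Definition coweight_space := {additive root_lattice -> rat}.

Implicit Types (sigma tau : set coweight_space).

Definition dual_points sigma : set root_lattice :=
  [set u | forall v, sigma v -> 0 <= v u].

Definition weyl_chamber (S : {fset E}) : set coweight_space :=
  [set v | forall u : root_lattice, lattice_val u \in S -> 0 <= v u].

Definition is_face tau sigma : Prop :=
  exists2 u, dual_points sigma u & tau = [set v | sigma v /\ v u = 0].

Record fan_cone := FanCone {
  cone_set :> set coweight_space;
  cone_setP : exists2 S, is_simple_roots R S & is_face cone_set (weyl_chamber S)
}.
HB.instance Definition _ := gen_eqMixin fan_cone.
HB.instance Definition _ := gen_choiceMixin fan_cone.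

Lemma cone_ring_subring sigma : is_subring (supported_in (dual_points sigma)).
Proof.
apply: supported_in_subring => [v _|a b ha hb v sv]; first by rewrite raddf0.
by rewrite raddfD addr_ge0 ?ha ?hb.
Qed.

Definition cone_ring sigma : comPzRingType := subring (cone_ring_subring sigma).

Lemma cone_ring_sub sigma tau : tau `<=` sigma ->
  supported_in (dual_points sigma) `<=` supported_in (dual_points tau).
Proof. by move=> ts g hg u /hg hu v /ts; exact: hu. Qed.

Definition face_map sigma tau (ts : tau `<=` sigma) :
    rs_mor (Spec (cone_ring tau)) (Spec (cone_ring sigma)) :=
  spec_map (subring_widen (cone_ring_subring sigma) (cone_ring_subring tau)
              (cone_ring_sub ts)).

(* The charts U_sigma = Spec Z[sigma^vee :&: M(R)], sigma in Sigma(R), are glued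
   along the U_(sigma :&: tau). *)
Definition toric_variety : ringed_space :=
  @glue fan_cone (fun sigma : fan_cone => Spec (cone_ring sigma))
    (fun sigma tau : fan_cone => Spec (cone_ring (sigma `&` tau)))
    (fun sigma tau : fan_cone =>
       face_map (@subIsetl _ sigma tau))
    (fun sigma tau : fan_cone =>
       face_map (@subIsetr _ sigma tau)).

Definition toric_chart (sigma : fan_cone) :
    rs_mor (Spec (cone_ring sigma)) toric_variety :=
  glue_chart (U := fun sigma : fan_cone => Spec (cone_ring sigma)) _ _ sigma.

Definition dense_torus : ringed_space := Spec (group_ring root_lattice).

Definition torus_map (sigma : fan_cone) : rs_mor dense_torus toric_variety :=
  rs_comp (spec_map (subring_incl (cone_ring_subring sigma)))
          (toric_chart sigma).

(* [s] is the restriction to [W] of the rational function x^u: the two agree on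
   the dense torus Spec Z[M(R)], which is contained in every chart. *)
Definition equals_character (W : opens toric_variety)
    (s : 'O_toric_variety (W)) (u : root_lattice) : Prop :=
  forall sigma : fan_cone,
    mor_sec (torus_map sigma) W s =
    spec_const (mor_pre (torus_map sigma) W) (character u).

Definition regular_at (x : toric_variety) (u : root_lattice) : Prop :=
  exists (W : opens toric_variety) (s : 'O_toric_variety (W)),
    open_set W x /\ equals_character s u.
End Lattice.
End RootSystem.

Section RootData.
Context (K : realType) (E : vectType K) (R : {fset E}).

Record root_data (Y : ringed_space) := RootData {
  data_open : R -> opens Y;
  data_fun : forall a, 'O_Y (data_open a);
  data_cover : forall a b : R, val b = - val a ->
    data_open a `|` data_open b = [set: Y];
  data_nonvanishing : forall a b : R, val b = - val a ->
    nonvanishing (data_fun a) = data_open a `&` data_open b;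
  data_inverse : forall a b : R, val b = - val a ->
    rs_res (@opens_setIl _ (data_open a) (data_open b)) (data_fun a) *
    rs_res (@opens_setIr _ (data_open a) (data_open b)) (data_fun b) = 1;
  data_add_sub : forall a b c : R, val c = val a + val b ->
    opens_setI (data_open a) (data_open b) `<=` data_open c;
  data_add : forall (a b c : R) (abc : val c = val a + val b),
    rs_res (@opens_setIl _ (data_open a) (data_open b)) (data_fun a) *
    rs_res (@opens_setIr _ (data_open a) (data_open b)) (data_fun b) =
    rs_res (data_add_sub abc) (data_fun c)
}.

Section Pullback.
Context (Y' Y : ringed_space) (h : scheme_mor Y' Y) (D : root_data Y).

Let pb_open (a : R) : opens Y' := mor_pre h (data_open D a).
Let pb_fun (a : R) : 'O_Y' (pb_open a) := mor_sec h (data_open D a) (data_fun D a).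

Let pb_cover (a b : R) : val b = - val a ->
  pb_open a `|` pb_open b = [set: Y'].
Proof.
move=> ab; apply/seteqP; split=> // y _.
by have : [set: Y] (h y) by []; rewrite -(data_cover D ab).
Qed.

Let pb_nonvanishing (a b : R) : val b = - val a ->
  nonvanishing (pb_fun a) = pb_open a `&` pb_open b.
Proof.
move=> ab; have e := data_nonvanishing D ab.
apply/seteqP; split=> y /=.
- move=> [ya ua]; have : nonvanishing (data_fun D a) (h y).
    by split=> //; exact: (@scheme_mor_local _ _ h) ua.
  by rewrite e.
- move=> [ya yb]; split=> //.
  have : nonvanishing (data_fun D a) (h y) by rewrite e.
  move=> [_ [V [Va [t [Vy st]]]]].
  have Va' : mor_pre h V `<=` pb_open a by move=> z; exact: Va.
  exists (mor_pre h V), Va', (mor_sec h V t); split=> //.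
  by rewrite -(mor_sec_res Va) -rmorphM st rmorph1.
Qed.

Let pb_inverse (a b : R) : val b = - val a ->
  rs_res (@opens_setIl _ (pb_open a) (pb_open b)) (pb_fun a) *
  rs_res (@opens_setIr _ (pb_open a) (pb_open b)) (pb_fun b) = 1.
Proof.
move=> ab; pose W := opens_setI (data_open D a) (data_open D b).
have sub : opens_setI (pb_open a) (pb_open b) `<=` mor_pre h W by [].
have := congr1 (rs_res sub \o mor_sec h W) (data_inverse D ab).
rewrite /= !rmorphM !rmorph1 => e; refine (etrans _ e).
by congr (_ * _); symmetry; exact: mor_sec_res_res.
Qed.

Let pb_add_sub (a b c : R) : val c = val a + val b ->
  opens_setI (pb_open a) (pb_open b) `<=` pb_open c.
Proof. by move=> abc y; exact: (data_add_sub abc). Qed.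

Let pb_add (a b c : R) (abc : val c = val a + val b) :
  rs_res (@opens_setIl _ (pb_open a) (pb_open b)) (pb_fun a) *
  rs_res (@opens_setIr _ (pb_open a) (pb_open b)) (pb_fun b) =
  rs_res (pb_add_sub abc) (pb_fun c).
Proof.
pose W := opens_setI (data_open D a) (data_open D b).
have sub : opens_setI (pb_open a) (pb_open b) `<=` mor_pre h W by [].
have := congr1 (rs_res sub \o mor_sec h W) (data_add D abc).
rewrite /= !rmorphM => e.
refine (etrans _ (etrans e _)); last exact: mor_sec_res_res.
by congr (_ * _); symmetry; exact: mor_sec_res_res.
Qed.

Definition pullback : root_data Y' :=
  RootData pb_cover pb_nonvanishing pb_inverse pb_add.
End Pullback.

(* [h |-> pullback h u] is an isomorphism from Mor(-, X) to the functor of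
   R-data on schemes: it is natural and bijective on every scheme. *)
Definition represents_root_data (X : ringed_space) (u : root_data X) : Prop :=
  (forall (Y' Y : ringed_space) (g : scheme_mor Y' Y) (h : scheme_mor Y X),
     is_scheme Y' -> is_scheme Y ->
     pullback (scheme_comp g h) u = pullback g (pullback h u)) /\
  (forall Y : ringed_space, is_scheme Y ->
     bijective (fun h : scheme_mor Y X => pullback h u)).

Definition is_universal (u : root_data (toric_variety R)) : Prop :=
  forall a : R,
    data_open u a = [set x | regular_at x (root_elt a)] :> set _ /\
    equals_character (data_fun u a) (root_elt a).
End RootData.

(* Main.v *)
Require Import Defs.
From HB Require Import structures.
From mathcomp Require Import all_boot all_order all_algebra finmap ring lra.
From mathcomp Require Import sesquilinear.
From mathcomp Require Import boolp classical_sets reals topology.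
From mathcomp Require monalg.
Import (canonicals) monalg.
From Stdlib Require Import Relations.

(* Let M be the root lattice and F the fraction field of the domain Z[M].  A
   point x of X(R) is determined by its local ring inside F, a section over a
   nonempty open set W is an element of F lying in the local rings of all
   points of W, and x lies in the chart of a cone sigma exactly when its local
   ring contains the coordinate ring of sigma.

   Given R-data on Y and a point y, the set P of roots a with y in U_a contains
   R^+ for some positive system R^+ (Bourbaki's argument), so the values f_a in
   O_{Y,y}, a in P, extend to a ring homomorphism psi on the subring of Z[M]
   spanned by the monoid generated by P.  The local ring at the image of y must
   consist of the fractions a/b with psi(b) invertible, and a section with value
   a/b must pull back to psi(a)/psi(b) near y; these prescriptions are
   independent of choices and local on Y, hence glue to the unique morphism. *)

Set Implicit Arguments.
Unset Strict Implicit.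
Unset Printing Implicit Defensive.

Import Order.TTheory GRing.Theory Num.Theory.
Local Open Scope classical_set_scope.
Local Open Scope ring_scope.

(** * Group rings *)

(** The glued space is a quotient by a generated equivalence relation and its sections are
    compatible families, so equality of points or of sections cannot be read off directly. Working
    with subsets and elements of the single ring [F] removes this difficulty. It is possible because
    any two cones are separated by a lattice point [u], so that the overlap of two charts is the
    localization of either one at a character.

    The conditions on R-data only mention relations between two or three roots, whereas [psi]
    requires every additive relation among the roots in [P] to hold for their values. For positive
    roots this follows by induction on the height, adding one simple root at a time; a negative root
    in [P] has an inverse value, which reduces the general case to monomials in the simple roots,
    where freeness of the base decides.

    The local rings of [Y] need not be domains, so nothing on that side embeds in a field. Values in
    [F] and germs on [Y] are therefore linked by a relation between fractions whose denominators
    become units. *)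

Section GroupRingTheory.
Context (G : zmodType).
Local Notation ZG := (group_ring G).
Implicit Types (g h : ZG) (k : G) (c : int).
Local Notation supp := (@monalg.msupp G int).
Local Notation "g @_ k" := (@monalg.mcoeff G int k g) (at level 3, k at level 2).

Lemma gr_expand g : g = \sum_(k <- supp g) monomial (g @_ k) k.
Proof. exact: monalg.monalgE. Qed.

Lemma gr_mulE g h : g * h =
  \sum_(k1 <- supp g) \sum_(k2 <- supp h)
    monomial (g @_ k1 * h @_ k2) (k1 + k2).
Proof. by []. Qed.

Lemma monomialM c c' k k' :
  monomial c k * monomial c' k' = monomial (c * c') (k + k').
Proof.
have nz x y : (x == 0) = false -> supp (monomial x y) = [fset y]%fset.
  by move=> x0; rewrite [supp _]monalg.msuppU x0.
have m0 y : monomial 0 y = 0 :> ZG by exact: monalg.monalgU0.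
have [->|/negPf c0] := eqVneq c 0; first by rewrite mul0r !m0 mul0r.
have [->|/negPf c'0] := eqVneq c' 0; first by rewrite mulr0 !m0 mulr0.
by rewrite gr_mulE !nz // !big_seq_fset1 /monomial !monalg.mcoeffUU.
Qed.

Lemma characterD k k' : character (k + k') = character k * character k' :> ZG.
Proof. by rewrite monomialM mulr1. Qed.

Lemma character0 : character (0 : G) = 1 :> ZG. Proof. by []. Qed.

Lemma monomial_supp (P : set G) c k : P k -> supported_in P (monomial c k).
Proof. by move=> Pk j /(fsubsetP monalg.msuppU_le); rewrite inE => /eqP ->. Qed.

Lemma monomial0 k : monomial 0 k = 0 :> ZG.
Proof. exact: monalg.monalgU0. Qed.

Lemma supported_ind (P : set G) (T : ZG -> Prop) :
  T 0 -> (forall a b, T a -> T b -> T (a + b)) ->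
  (forall c k, P k -> T (monomial c k)) ->
  forall g, supported_in P g -> T g.
Proof.
move=> T0 TD TU g Pg; rewrite [g]gr_expand.
have : forall k, k \in (supp g : seq G) -> P k by exact: Pg.
elim: (supp g : seq G) => [|k s IH] hs; first by rewrite big_nil.
rewrite big_cons; apply: TD; first by apply/TU/hs; rewrite inE eqxx.
by apply: IH => j js; apply: hs; rewrite inE js orbT.
Qed.

Lemma monomial_int c k : monomial c k = c%:~R * character k :> ZG.
Proof.
have nat n : monomial n%:Z k = n%:~R * character k :> ZG.
  elim: n => [|n IH]; first by rewrite mul0r monomial0.
  rewrite intS rmorphD mulrDl mul1r -IH; exact: monalg.monalgUD.
case: c => n; rewrite // NegzE rmorphN mulNr -nat; exact: monalg.monalgUN.
Qed.

Section Extension.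
Context (L : comPzRingType) (mu : G -> L).

(** [mu] is an arbitrary function, so the extension is additive everywhere but multiplicative only
    over a set [Q] on which [mu] turns sums into products ([gr_extM]). In the application this is
    known only on the monoid generated by the roots in [P]. *)
Definition gr_ext g : L := \sum_(k <- supp g) (g @_ k)%:~R * mu k.

Lemma gr_extw g (d : {fset G}) : (supp g `<=` d)%fset ->
  gr_ext g = \sum_(k <- d) (g @_ k)%:~R * mu k.
Proof.
move=> gd; rewrite /gr_ext (big_fset_incl _ gd) //= => k _.
by move=> /monalg.mcoeff_outdom ->; rewrite mul0r.
Qed.

Lemma gr_ext_monomial c k : gr_ext (monomial c k) = c%:~R * mu k.
Proof.
by rewrite (gr_extw monalg.msuppU_le) big_seq_fset1 /monomial monalg.mcoeffUU.
Qed.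

Lemma gr_ext0 : gr_ext 0 = 0.
Proof. by rewrite /gr_ext monalg.msupp0 big_seq_fset0. Qed.

Lemma gr_extD g h : gr_ext (g + h) = gr_ext g + gr_ext h.
Proof.
rewrite (gr_extw (fsubsetUl (supp g) (supp h))).
rewrite (gr_extw (fsubsetUr (supp g) (supp h))).
rewrite (gr_extw (monalg.msuppD_le g h)) -big_split /=; apply: eq_bigr => k _.
rewrite -mulrDl -intrD; congr (_%:~R * _); exact: monalg.mcoeffD.
Qed.

Lemma gr_extM (Q : set G) :
  (forall a b, Q a -> Q b -> mu (a + b) = mu a * mu b) ->
  forall g h, supported_in Q g -> supported_in Q h ->
  gr_ext (g * h) = gr_ext g * gr_ext h.
Proof.
move=> muD g h Qg Qh; elim/supported_ind: Qg => [|a b IHa IHb|c k Qk].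
- by rewrite !(mul0r, gr_ext0).
- by rewrite mulrDl !gr_extD IHa IHb mulrDl.
elim/supported_ind: Qh => [|a b IHa IHb|c' k' Qk'].
- by rewrite !(mulr0, gr_ext0).
- by rewrite mulrDr !gr_extD IHa IHb mulrDr.
by rewrite monomialM !gr_ext_monomial muD // intrM; ring.
Qed.
End Extension.

Lemma fset_argmax (K : realDomainType) (lam : G -> K) (d : {fset G}) :
  d != fset0 -> exists2 k, k \in d & forall j, j \in d -> lam j <= lam k.
Proof.
move=> /fset0Pn[k0 k0d].
have : (d : seq G) != [::].
  by apply: contraTneq k0d => e; rewrite -[_ \in _]/(_ \in (d : seq G)) e.
suff H (s : seq G) : s != [::] ->
    exists2 k, k \in s & forall j, j \in s -> lam j <= lam k by exact: H.
elim: s => // x s IH _; have [->|/IH[k ks kmax]] := eqVneq s [::].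
  by exists x => [|j]; rewrite !inE // => /eqP->.
have [xk|/ltW kx] := leP (lam x) (lam k).
  by exists k => [|j]; rewrite inE ?ks ?orbT // => /orP[/eqP->|/kmax].
exists x => [|j]; rewrite inE ?eqxx // => /orP[/eqP->|/kmax] //.
by move=> /le_trans; exact.
Qed.

Lemma gr_eq0 g : (g == 0) = (supp g == fset0).
Proof.
apply/eqP/eqP => [->|g0]; first exact: monalg.msupp0.
by rewrite [g]gr_expand g0 big_seq_fset0.
Qed.

(* Leading terms multiply: a functional that is injective on the two supports
   singles out a monomial of the product with nonzero coefficient. *)
Lemma gr_domain (K : realDomainType) :
  (forall s : seq G, 0 \notin s -> exists lam : G -> K,
     {morph lam : x y / x + y} /\ forall x, x \in s -> lam x != 0) ->
  forall g h, g * h = 0 -> g = 0 \/ h = 0.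
Proof.
move=> sep g h gh0.
have [/eqP|g0] := boolP (g == 0); [by left|right; apply/eqP].
apply: contraT => h0; rewrite !gr_eq0 in g0 h0.
(* Nonzero differences within each support: a functional that vanishes on none of them is injective
   on both supports. *)
pose s := [seq x <- [seq x - y | x <- supp g, y <- supp g] ++
                    [seq x - y | x <- supp h, y <- supp h] | x != 0].
have [|lam [lamD lam0]] := sep s; first by rewrite mem_filter eqxx.
have lam_0 : lam 0 = 0 by apply: (addrI (lam 0)); rewrite -lamD !addr0.
have lamB x y : lam (x - y) = lam x - lam y.
  by apply: (addIr (lam y)); rewrite -lamD !subrK.
have inj (d : {fset G}) (x y : G) : d = supp g \/ d = supp h ->
    x \in d -> y \in d -> lam x = lam y -> x = y.
  move=> hd xd yd exy; apply/eqP; rewrite -subr_eq0; apply: contraT => xy0.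
  have : x - y \in s.
    rewrite mem_filter xy0 mem_cat; apply/orP.
    by case: hd xd yd => -> xd yd; [left|right]; apply/allpairsP; exists (x, y).
  by move=> /lam0; rewrite lamB exy subrr eqxx.
have [k1 k1g max1] := fset_argmax lam g0.
have [k2 k2h max2] := fset_argmax lam h0.
have : (g * h) @_ (k1 + k2) = g @_ k1 * h @_ k2.
  rewrite gr_mulE raddf_sum /= (big_fsetD1 k1) //= raddf_sum /=.
  rewrite (big_fsetD1 k2) //= monalg.mcoeffUU.
  rewrite big1_fset ?addr0 => [|j]; last first.
    rewrite !inE => /andP[/eqP jk2 _] _; rewrite monalg.mcoeffU.
    by case: eqP => // /addrI.
  rewrite big1_fset ?addr0 // => i; rewrite !inE => /andP[/eqP ik1 ig] _.
  rewrite raddf_sum /= big1_fset // => j jh _; rewrite monalg.mcoeffU.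
  case: eqP => // e; case: ik1; apply: (inj (supp g)); [by left|by []|by []|].
  have := congr1 lam e; rewrite !lamD => el.
  have := max1 _ ig; have := max2 _ jh; lra.
rewrite gh0 (_ : 0 @_ _ = 0); last exact: monalg.mcoeff0.
move=> /esym/eqP; rewrite mulf_eq0 -!monalg.mcoeff_neq0 in k1g k2h *.
by rewrite (negPf k1g) (negPf k2h).
Qed.

End GroupRingTheory.

(** * Root systems *)

Section FsetFree.
Context (K : fieldType) (E : vectType K).

Lemma fset_freeP (S : {fset E}) :
  free S <-> (forall c : E -> K, \sum_(s <- S) c s *: s = 0 ->
              forall s, s \in S -> c s = 0).
Proof.
have big (c : E -> K) :
    \sum_(s <- S) c s *: s = \sum_(i < size S) c (in_tuple S)`_i *: (in_tuple S)`_i.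
  by rewrite (big_nth 0) big_mkord.
rewrite -[free _]/(free (in_tuple (S : seq E))); split=> [/freeP h c|h].
  rewrite big => /h c0 s sS; have si : (index s S < size S)%N by rewrite index_mem.
  by have := c0 (Ordinal si); rewrite /= nth_index.
apply/freeP => k k0 i.
pose c x := if insub (index x (S : seq E)) is Some j then k j else 0.
have cE (j : 'I_(size S)) : c (in_tuple S)`_j = k j.
  rewrite /c /= index_uniq ?fset_uniq // ?ltn_ord //.
  by rewrite insubT //= => lt_j; congr k; apply: val_inj.
rewrite -cE; apply: h; last by rewrite mem_nth.
by rewrite big -[RHS]k0; apply: eq_bigr => j _; rewrite cE.
Qed.
End FsetFree.

Section InnerProduct.
Context (K : realType) (E : vectType K) (ip : {dot E for idfun}).

Lemma ipC a b : ip a b = ip b a.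
Proof. by rewrite hermC expr0 mul1r. Qed.
Lemma ipDl a b c : ip (a + b) c = ip a c + ip b c. Proof. exact: linearDl. Qed.
Lemma ipBl a b c : ip (a - b) c = ip a c - ip b c. Proof. exact: linearBl. Qed.
Lemma ipNl a c : ip (- a) c = - ip a c. Proof. exact: linearNl. Qed.
Lemma ipZl (k : K) a b : ip (k *: a) b = k * ip a b.
Proof. exact: linearZl_LR. Qed.
Lemma ip0l b : ip 0 b = 0. Proof. exact: linear0l. Qed.
Lemma ipMnl a n b : ip (a *+ n) b = ip a b *+ n. Proof. exact: linearMnl. Qed.
Lemma ip_gt0 a : a != 0 -> 0 < ip a a. Proof. exact: neq0_dnorm_gt0. Qed.
Lemma ip_suml (I : Type) (s : seq I) (P : pred I) (F : I -> E) b :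
  ip (\sum_(i <- s | P i) F i) b = \sum_(i <- s | P i) ip (F i) b.
Proof. exact: linear_sumlz. Qed.
Lemma ip_sumr (I : Type) (s : seq I) (P : pred I) (F : I -> E) b :
  ip b (\sum_(i <- s | P i) F i) = \sum_(i <- s | P i) ip b (F i).
Proof. by rewrite ipC ip_suml; apply: eq_bigr => i _; rewrite ipC. Qed.

(** If the vector [v] found so far is orthogonal to the new [x], it is moved to [v + c *: x]. A
    value of [c] that is bad for an older [y] is minus the ratio of [ip y v] to [ip y x], and [c]
    exceeds all these ratios in absolute value. *)
Lemma generic_vector (s : seq E) : 0 \notin s ->
  exists v, forall x, x \in s -> ip x v != 0.
Proof.
elim: s => [_|x s IH]; first by exists 0.
rewrite inE negb_or => /andP[x0 /IH[v hv]].
have xx : 0 < ip x x by rewrite ip_gt0 // eq_sym.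
have [xv|xv] := eqVneq (ip x v) 0; last first.
  by exists v => y; rewrite inE => /orP[/eqP->|/hv].
pose c := 1 + \sum_(y <- s) `|ip y v / ip y x|.
have c_gt y : y \in s -> `|ip y v / ip y x| < c.
  move=> ys; rewrite /c (big_rem y) //= addrCA ltrDl.
  by apply: (lt_le_trans ltr01); rewrite lerDl sumr_ge0.
have c_gt0 : 0 < c by rewrite (lt_le_trans ltr01) // lerDl sumr_ge0.
exists (v + c *: x) => y; rewrite ipC ipDl ipZl ![ip _ y]ipC.
rewrite inE => /orP[/eqP->|ys]; first by rewrite xv add0r mulf_neq0 // gt_eqF.
have [->|yx] := eqVneq (ip y x) 0; first by rewrite mulr0 addr0 hv.
apply/eqP => e; have := c_gt _ ys.
have -> : ip y v / ip y x = - c.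
  by apply: (mulIf yx); rewrite mulfVK // mulNr; apply/eqP; rewrite -addr_eq0 e.
by rewrite normrN (gtr0_norm c_gt0) ltxx.
Qed.
End InnerProduct.

Section RootSystemTheory.
Context (K : realType) (E : vectType K) (ip : {dot E for idfun}).
Context (R : {fset E}) (hR : is_root_system ip R).
Implicit Types (a b x y : E) (S : {fset E}).

Lemma root_neq0 a : a \in R -> a != 0.
Proof. by case: hR => _ R0 _ _ _; apply: contraTneq => ->. Qed.

Lemma reflection_self a : a != 0 -> reflection ip a a = - a.
Proof.
move=> a0; rewrite /reflection mulfK ?gt_eqF ?ip_gt0 //.
by rewrite scaler_nat mulr2n opprD addrA subrr add0r.
Qed.

Lemma root_opp a : a \in R -> - a \in R.
Proof.
move=> aR; rewrite -reflection_self ?root_neq0 //.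
by case: hR => _ _ h _ _; exact: h.
Qed.

(** By strict Cauchy-Schwarz the two Cartan integers of [a] and [b] have product below 4. Both are
    positive, so one of them is 1, and the corresponding reflection produces [a - b] up to sign. *)
Lemma root_sub a b : a \in R -> b \in R -> 0 < ip a b -> a != b -> a - b \in R.
Proof.
move=> aR bR ab_gt0 ab.
have [_ _ hrefl hint hred] := hR.
have aa : 0 < ip a a by rewrite ip_gt0 ?root_neq0.
have bb : 0 < ip b b by rewrite ip_gt0 ?root_neq0.
(* Up to the factor [ip a a], this is the component of [b] orthogonal to [a]. It is nonzero because
   the only positive multiple of [a] in [R] is [a]; its squared length gives the strict
   inequality. *)
pose d := ip a a *: b - ip a b *: a.
have d0 : d != 0.
  rewrite subr_eq0; apply/eqP => e.
  have bE : b = (ip a b / ip a a) *: a.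
    by rewrite mulrC -scalerA -e scalerA mulVf ?scale1r // gt_eqF.
  have : (ip a b / ip a a) *: a \in R by rewrite -bE.
  move=> /(hred _ _ aR)[c1|c1].
    by move: ab; rewrite bE c1 scale1r eqxx.
  have : 0 < ip a b / ip a a by rewrite divr_gt0.
  by rewrite c1 oppr_gt0 ltr10.
have CS : ip a b ^+ 2 < ip a a * ip b b.
  have := ip_gt0 ip d0.
  rewrite [ip d d]ipBl !ipZl ![ip _ d]ipC !ipBl !ipZl [ip b a]ipC => h.
  have {}h : 0 < ip a a * (ip a a * ip b b - ip a b ^+ 2).
    by apply: (lt_le_trans h); rewrite le_eqVlt; apply/orP; left; apply/eqP; ring.
  by move: h; rewrite pmulr_rgt0 // subr_gt0.
have := hint _ _ aR bR; have := hint _ _ bR aR.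
rewrite [ip b a]ipC; set n1 := 2 * _ / ip b b; set n2 := 2 * _ / ip a a.
move=> /intrP[z1 n1E] /intrP[z2 n2E].
have n1_gt0 : 0 < n1 by rewrite divr_gt0 // mulr_gt0.
have n2_gt0 : 0 < n2 by rewrite divr_gt0 // mulr_gt0.
have n12 : n1 * n2 < 4.
  rewrite /n1 /n2 mulrACA -invfM ltr_pdivrMr ?mulr_gt0 //.
  have -> : 2 * ip a b * (2 * ip a b) = 4 * ip a b ^+ 2 by ring.
  by rewrite ltr_pM2l // mulrC.
have [n1_1|n1_1] := eqVneq n1 1.
  have := hrefl _ _ bR aR.
  by rewrite /reflection -/n1 n1_1 scale1r.
have [n2_1|n2_1] := eqVneq n2 1.
  have := hrefl _ _ aR bR.
  by rewrite /reflection [ip b a]ipC -/n2 n2_1 scale1r => /root_opp; rewrite opprB.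
have ge2 z (n : K) : n = z%:~R -> 0 < n -> n != 1 -> 2 <= n.
  move=> ->; rewrite ltr0z -[1]/(1%:~R) -[2]/(2%:~R) ler_int eqr_int.
  by case: z => [[|[|m]]|m].
have := ge2 _ _ n1E n1_gt0 n1_1; have := ge2 _ _ n2E n2_gt0 n2_1.
nra.
Qed.

Definition nonneg_comb S a := exists c : E -> nat, a = \sum_(s <- S) s *+ c s.

Lemma nonneg_combD S a b :
  nonneg_comb S a -> nonneg_comb S b -> nonneg_comb S (a + b).
Proof.
move=> [c ->] [d ->]; exists (fun x => c x + d x)%N.
by rewrite -big_split /=; apply: eq_bigr => s _; rewrite mulrnDr.
Qed.

Lemma nonneg_comb_mem S a : a \in S -> nonneg_comb S a.
Proof.
move=> aS; exists (fun x => nat_of_bool (x == a)); rewrite (big_fsetD1 a) //= eqxx.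
rewrite big1_fset ?addr0 // => i; rewrite !inE => /andP[/negPf-> _] _.
by rewrite mulr0n.
Qed.

Lemma base_free S : is_simple_roots R S -> free S.
Proof. by move=> [_ /andP[_]]. Qed.

Lemma base_sub S : is_simple_roots R S -> {subset S <= R}.
Proof. by move=> [/fsubsetP]. Qed.

Lemma base_coef_eq S (c d : E -> nat) : is_simple_roots R S ->
  \sum_(s <- S) s *+ c s = \sum_(s <- S) s *+ d s ->
  forall s, s \in S -> c s = d s.
Proof.
move=> /base_free/fset_freeP hS e s sS.
have := hS (fun x => (c x)%:R - (d x)%:R).
rewrite (eq_bigr (fun s => s *+ c s - s *+ d s)) => [|x _]; last first.
  by rewrite scalerBl !scaler_nat.
rewrite sumrB e subrr => /(_ erefl _ sS) /eqP.
by rewrite subr_eq0 eqr_nat => /eqP.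
Qed.

Lemma base_posN S a : is_simple_roots R S -> a != 0 ->
  nonneg_comb S a -> ~ nonneg_comb S (- a).
Proof.
move=> hS a0 [c ac] [d ad].
have e : \sum_(s <- S) s *+ (c s + d s)%N = \sum_(s <- S) s *+ 0%N.
  rewrite [RHS]big1 // (eq_bigr (fun s => s *+ c s + s *+ d s)) => [|s _].
    by rewrite big_split /= -ac -ad subrr.
  by rewrite mulrnDr.
move/eqP: a0; apply; rewrite ac big_seq big1 // => s sS.
have /eqP := base_coef_eq hS e sS.
by rewrite addn_eq0 => /andP[/eqP-> _]; rewrite mulr0n.
Qed.

(* A positive root that is not simple has positive inner product with some
   simple root occurring in it, and subtracting that root lowers the height. *)
Lemma pos_root_ind S (Q : E -> Prop) : is_simple_roots R S ->
  (forall s, s \in S -> Q s) ->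
  (forall b s, b \in R -> nonneg_comb S b -> s \in S -> b + s \in R ->
     Q b -> Q (b + s)) ->
  forall a, a \in R -> nonneg_comb S a -> Q a.
Proof.
move=> hS Qs Qadd a aR [c ac].
have [n] := ubnP (\sum_(s <- S) c s); elim: n a aR c ac => // n IH a aR c ac hn.
have [/Qs //|aS] := boolP (a \in S).
have [s [sS cs as_gt0]] : exists s, [/\ s \in S, (0 < c s)%N & 0 < ip a s].
  apply: contrapT => hno.
  have : 0 < ip a a by rewrite ip_gt0 ?root_neq0.
  rewrite {2}ac ip_sumr ltNge => /negP; apply.
  rewrite big_seq; apply: sumr_le0 => s sS; rewrite (ipC ip) ipMnl.
  have [->|cs] := posnP (c s); first by rewrite mulr0n.
  rewrite pmulrn_lle0 // (ipC ip) leNgt; apply/negP => as_gt0.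
  by apply: hno; exists s.
have asR : a - s \in R.
  by apply: root_sub => //; [exact: base_sub sS|apply: contraNneq aS => ->].
pose d x := if x == s then (c s).-1 else c x.
have ad : a - s = \sum_(x <- S) x *+ d x.
  rewrite ac (big_fsetD1 s) //= [RHS](big_fsetD1 s) //= {1}/d eqxx.
  rewrite -{1}(prednK cs) mulrS -addrA [LHS]addrC addKr; congr (_ + _).
  apply: eq_fbigr => x; rewrite !inE => /andP[xs _] _.
  by rewrite /d (negPf xs).
rewrite -(subrK s a); apply: Qadd => //; first by exists d.
  by rewrite subrK.
apply: (IH _ asR d ad).
move: hn; rewrite (big_fsetD1 s) //= [X in _ -> (X < _)%N](big_fsetD1 s) //=.
rewrite {1}/d eqxx -{1}(prednK cs) addSn ltnS; apply: leq_trans.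
rewrite ltnS leq_add2l eq_leq //.
by apply: eq_fbigr => x; rewrite !inE => /andP[xs _] _; rewrite /d (negPf xs).
Qed.

(** A generic [v] splits [R] into positive and negative roots, and [S] consists of the positive
    roots that are not sums of two positive ones. Indecomposability gives obtuse angles through
    [root_sub]; obtuse angles inside an open half space give freeness. *)
Lemma simple_roots_exist : exists S, is_simple_roots R S.
Proof.
have [Rspan R0 hrefl hint hred] := hR.
have [v hv] := generic_vector ip R0.
pose pos a := (a \in R) && (0 < ip a v).
pose S := [fset a in R | pos a &&
  ~~ has (fun b => pos b && pos (a - b)) (R : seq E)]%fset.
have SR : (S `<=` R)%fset by apply/fsubsetP => a; rewrite !inE => /andP[].
have Spos s : s \in S -> pos s by rewrite !inE => /andP[_ /andP[]].
have posP a : a \in R -> pos a \/ pos (- a).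
  move=> aR; rewrite /pos aR root_opp // ipNl oppr_gt0 /=.
  by case: ltgtP (hv _ aR) => // h _; auto.
have comb a : pos a -> nonneg_comb S a.
  (* The values [ip a v] are elements of the real field, so the induction runs on the number of
     positive roots with a smaller value. *)
  pose h a := #|` [fset b in R | pos b && (ip b v < ip a v)]%fset|.
  have hlt x y : pos x -> ip x v < ip y v -> (h x < h y)%N.
    move=> px xy; have xR : x \in R by case/andP: px.
    apply: fproper_ltn_card; rewrite fproperE; apply/andP; split.
      by apply/fsubsetP => z; rewrite !inE => /andP[-> /andP[-> /lt_trans->]].
    by apply/fsubsetPn; exists x; rewrite !inE ?xR ?px ?xy // ltxx !andbF.
  have [n] := ubnP (h a); elim: n a => // n IH a hn pa.
  have [aS|] := boolP (a \in S); first exact: nonneg_comb_mem.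
  have aR : a \in R by case/andP: pa.
  rewrite !inE aR pa /= negbK => /hasP[b bR /andP[pb pab]].
  have ab : ip a v = ip b v + ip (a - b) v by rewrite -ipDl addrC subrK.
  have hb : (h b < n)%N.
    apply: leq_trans (hlt _ a pb _) hn.
    by rewrite ab ltrDl; case/andP: pab.
  have hab : (h (a - b)%R < n)%N.
    apply: leq_trans (hlt _ a pab _) hn.
    by rewrite ab ltrDr; case/andP: pb.
  by rewrite -(subrK b a); apply: nonneg_combD; apply: IH.
have obtuse s t : s \in S -> t \in S -> s != t -> ip s t <= 0.
  move=> sS tS st; rewrite leNgt; apply/negP => st_gt0.
  have /andP[sR _] := Spos _ sS; have /andP[tR _] := Spos _ tS.
  have stR := root_sub sR tR st_gt0 st.
  have [pst|pts] := posP _ stR.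
    move: sS; rewrite !inE => /andP[_ /andP[_ /hasPn/(_ _ tR)]].
    by rewrite Spos // pst.
  move: tS; rewrite !inE => /andP[_ /andP[_ /hasPn/(_ _ sR)]].
  by rewrite Spos // -(opprB s t) pts.
have Sfree : free S.
  apply/fset_freeP => c c0.
  (* Separating the signs of the coefficients writes one vector [x] as two nonnegative combinations
     with disjoint supports. Obtuseness gives [ip x x <= 0], and pairing with [v] then kills every
     coefficient. *)
  pose p s : K := if 0 <= c s then c s else 0.
  pose q s : K := if 0 <= c s then 0 else - c s.
  have cE s : c s = p s - q s by rewrite /p /q; case: ifP; rewrite ?subr0 ?sub0r ?opprK.
  have pq s : p s * q s = 0 by rewrite /p /q; case: ifP; rewrite ?mul0r ?mulr0.
  have p0 s : 0 <= p s by rewrite /p; case: ifP.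
  have q0 s : 0 <= q s.
    by rewrite /q; case: ifPn => //; rewrite -ltNge oppr_ge0 => /ltW.
  pose x := \sum_(s <- S) p s *: s.
  have xq : x = \sum_(s <- S) q s *: s.
    apply/eqP; rewrite -subr_eq0 -sumrB -[X in _ == X]c0; apply/eqP.
    by apply: eq_bigr => s _; rewrite cE scalerBl.
  have x0 : x = 0.
    apply/eqP; apply: contraT => /(ip_gt0 ip); rewrite {2}xq ltNge => /negP[].
    rewrite ip_suml big_seq; apply: sumr_le0 => s sS.
    rewrite ip_sumr big_seq; apply: sumr_le0 => t tS.
    rewrite ipZl [ip s _]ipC ipZl [ip t s]ipC mulrA.
    have [<-|st] := eqVneq s t; first by rewrite pq mul0r.
    by rewrite mulr_ge0_le0 ?mulr_ge0 ?obtuse.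
  have zero (f : E -> K) : (forall s, 0 <= f s) -> \sum_(s <- S) f s *: s = 0 ->
      forall s, s \in S -> f s = 0.
    move=> f0 fs s sS.
    have : \sum_(s <- S) f s * ip s v = 0.
      rewrite (eq_bigr (fun s => ip (f s *: s) v)) => [|t _]; last by rewrite ipZl.
      by rewrite -ip_suml fs ip0l.
    rewrite big_seq => /eqP; rewrite psumr_eq0 => [/allP/(_ _ sS)|t tS].
      rewrite sS /= mulf_eq0 => /orP[/eqP //|].
      by have /andP[_ /gt_eqF->] := Spos _ sS.
    by rewrite mulr_ge0 // ltW //; case/andP: (Spos _ tS).
  by move=> s sS; rewrite cE (zero p) // ?(zero q) ?subrr // -xq.
exists S; split=> //.
  rewrite basisEfree Sfree subvf /=.
  suff : (fullv <= <<S>>)%VS by move/dimvS; rewrite (eqP Sfree).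
  rewrite -Rspan; apply/span_subvP => a aR.
  have span_comb b : nonneg_comb S b -> b \in <<S>>%VS.
    move=> [c ->]; rewrite big_seq; apply: rpred_sum => s sS.
    by rewrite rpredMn // memv_span.
  by case: (posP _ aR) => /comb/span_comb //; rewrite rpredN.
move=> a aR; case: (posP _ aR) => /comb[c hc]; exists c; first by left.
by right; rewrite -hc opprK.
Qed.

End RootSystemTheory.

(** * Reflected bases, and bases inside a given set of roots *)

Section ParabolicSets.
Context (K : realType) (E : vectType K) (ip : {dot E for idfun}).
Context (R : {fset E}) (hR : is_root_system ip R).
Implicit Types (a b x y : E) (S : {fset E}).
Local Notation refl := (reflection ip).

Lemma reflectionD a : {morph refl a : x y / x + y}.
Proof.
move=> x y; rewrite /reflection ipDl mulrDr mulrDl scalerDl.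
by rewrite opprD addrACA.
Qed.

Lemma reflectionZ a (k : K) x : refl a (k *: x) = k *: refl a x.
Proof. by rewrite /reflection ipZl scalerBr scalerA; congr (_ - _ *: _); ring. Qed.

Lemma reflection0 a : refl a 0 = 0.
Proof. by rewrite -(scale0r 0) reflectionZ !scale0r. Qed.

Lemma reflection_sum a (I : Type) (s : seq I) (F : I -> E) :
  refl a (\sum_(i <- s) F i) = \sum_(i <- s) refl a (F i).
Proof. exact: (big_morph (refl a) (reflectionD a) (reflection0 a)). Qed.

Lemma reflectionK a : a != 0 -> involutive (refl a).
Proof.
move=> a0 x; rewrite {2}/reflection -scaleNr reflectionD reflectionZ.
by rewrite reflection_self // /reflection scaleNr scalerN opprK subrK.
Qed.

Lemma reflection_base S s : is_simple_roots R S -> s \in S ->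
  is_simple_roots R [fset refl s x | x in S]%fset /\
  forall a, nonneg_comb S a -> nonneg_comb [fset refl s x | x in S]%fset (refl s a).
Proof.
move=> hS sS; have [SR bS hcomb] := hS; have [_ _ hrefl _ _] := hR.
have sR := base_sub hS sS; have s0 := root_neq0 hR sR.
have rK := reflectionK s0; have rinj := inv_inj rK.
set S' := [fset _ | _ in _]%fset.
have sumS' (V : nmodType) (F : E -> V) :
    \sum_(t <- S') F t = \sum_(x <- S) F (refl s x).
  by rewrite big_imfset //= => x y _ _; exact: rinj.
have combS' a : nonneg_comb S a -> nonneg_comb S' (refl s a).
  move=> [c ->]; exists (c \o refl s); rewrite reflection_sum sumS'.
  by apply: eq_bigr => x _; rewrite /= rK -scaler_nat reflectionZ scaler_nat.
split=> //; split.
- apply/fsubsetP => _ /imfsetP[x /= xS ->].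
  by apply: hrefl => //; exact: base_sub xS.
- rewrite basisEfree subvf /=; apply/andP; split; last first.
    rewrite card_imfset //=; move: bS; rewrite basisEfree => /and3P[_ _].
    by [].
  apply/fset_freeP => c; rewrite sumS' => c0 _ /imfsetP[x /= xS ->].
  have /fset_freeP/(_ (c \o refl s)) := base_free hS; apply=> //.
  rewrite -[LHS]rK reflection_sum (eq_bigr _ (fun x _ => reflectionZ _ _ _)).
  by rewrite /= c0 reflection0.
- move=> a aR; have [c cE] := hcomb _ (hrefl _ _ sR aR).
  have [d dE] : nonneg_comb S' (refl s (\sum_(x <- S) x *+ c x)).
    by apply: combS'; exists c.
  exists d; case: cE => e; [left|right]; rewrite -dE -?e ?rK //.
  by rewrite -[LHS]rK e -scaleN1r reflectionZ scaleN1r.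
Qed.

(** Reflecting in [s] changes only the coefficient at [s]. If the result were negative, all other
    coefficients of [b] would vanish, and a positive multiple of [s] in a reduced system is [s]
    itself. *)
Lemma reflection_pos S s b : is_simple_roots R S -> s \in S -> b \in R ->
  nonneg_comb S b -> b != s -> nonneg_comb S (refl s b).
Proof.
move=> hS sS bR [c bc] bs; have [_ _ hrefl _ hred] := hR.
have [_ _ /(_ _ (hrefl _ _ (base_sub hS sS) bR))[d [dE|dE]]] := hS.
  by exists d.
case/eqP: bs; pose n := 2 * ip b s / ip s s.
have coef x : x \in S -> x != s -> c x = 0%N.
  move=> xS xs; have /fset_freeP := base_free hS.
  move=> /(_ (fun x => (c x + d x)%:R - (if x == s then n else 0))) h.
  have /h/(_ x xS) : \sum_(x <- S) ((c x + d x)%:R - (if x == s then n else 0)) *: x = 0.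
    rewrite (eq_bigr (fun x => x *+ c x + x *+ d x -
        (if x == s then n else 0) *: x)) => [|y _]; last first.
      by rewrite scalerBl scaler_nat mulrnDr.
    have nE : \sum_(x <- S) (if x == s then n else 0) *: x = n *: s.
      rewrite (big_fsetD1 s) //= eqxx big1_fset ?addr0 // => y.
      by rewrite !inE => /andP[/negPf-> _] _; rewrite scale0r.
    rewrite sumrB big_split /= nE -bc.
    have -> : \sum_(x <- S) x *+ d x = n *: s - b.
      by rewrite -[LHS]opprK -dE opprB.
    by rewrite addrC subrK subrr.
  rewrite (negPf xs) subr0 => /eqP.
  by rewrite pnatr_eq0 addn_eq0 => /andP[/eqP].
have bE : b = (c s)%:R *: s.
  rewrite {1}bc (big_fsetD1 s) //= big1_fset ?addr0 ?scaler_nat // => x.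
  by rewrite !inE => /andP[xs xS] _; rewrite coef // mulr0n.
have : (c s)%:R *: s \in R by rewrite -bE.
case/(hred _ _ (base_sub hS sS)) => c1; first by rewrite bE c1 scale1r.
by have := ler0n K (c s); rewrite c1 oppr_ge0 ler10.
Qed.

(* Bourbaki's argument: among all bases, one with the fewest positive roots
   outside [P] has none of its simple roots outside [P], since otherwise the
   reflection in such a simple root would do better. *)
Lemma parabolic_base (P : E -> Prop) :
  (forall a, a \in R -> P a \/ P (- a)) ->
  exists2 S, is_simple_roots R S & forall s, s \in S -> P s.
Proof.
move=> Ptot; have [S0 hS0] := simple_roots_exist hR.
pose bad S := [fset a in R | `[< nonneg_comb S a >] && `[< ~ P a >]]%fset.
have [n] := ubnP #|` bad S0|; elim: n S0 hS0 => // n IH S hS hn.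
have [hP|/existsNP[s /not_implyP[sS Ps]]] :=
  pselect (forall s, s \in S -> P s); first by exists S.
have [hS' comb'] := reflection_base hS sS.
apply: (IH _ hS'); rewrite ltnS in hn; apply: leq_trans _ hn.
have sR := base_sub hS sS; have s0 := root_neq0 hR sR.
apply: fproper_ltn_card; rewrite fproperE; apply/andP; split; last first.
  apply/fsubsetPn; exists s; rewrite !inE sR /=.
    by apply/andP; split; apply/asboolP => //; exact: nonneg_comb_mem.
  apply/negP => /andP[/asboolP h _].
  have [hS'' comb''] := reflection_base hS' (in_imfset _ (refl s) sS).
  have := base_posN hS' s0 h; apply.
  by rewrite -(reflection_self ip s0); apply/comb'/nonneg_comb_mem.
apply/fsubsetP => a; rewrite !inE => /andP[aR /andP[/asboolP[c aE] aP]].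
rewrite aR aP andbT /=; apply/asboolP.
pose b := refl s a.
have [_ _ hrefl _ _] := hR.
have bR : b \in R by exact: hrefl.
have rK := reflectionK s0.
have bpos : nonneg_comb S b.
  exists (c \o refl s); rewrite /b aE reflection_sum big_imfset /=; last first.
    by move=> x y _ _; exact: (inv_inj rK).
  by apply: eq_bigr => x _; rewrite -scaler_nat reflectionZ rK scaler_nat.
(* In the first case [a = - s], which totality places in [P] since [s] is outside, contrary to the
   choice of [a]. *)
have [bs|bs] := eqVneq b s.
  move/asboolP: aP => []; have -> : a = - s.
    by rewrite -(rK a) -/b bs reflection_self.
  by case: (Ptot _ sR).
by rewrite -(rK a); exact: reflection_pos.
Qed.

End ParabolicSets.

(** * The fan of Weyl chambers *)

Section RootLattice.
Context (K : realType) (E : vectType K) (R : {fset E}).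
Local Notation M := (root_lattice R).
Implicit Types (a : E) (u v w : M).

(* Junk value [0] when [a] is not in the lattice. *)
Definition rootl a : M := insubd 0 a.

Lemma lattice_val_inj : injective (@lattice_val K E R).
Proof. exact: val_inj. Qed.

Lemma rootlK a : a \in R -> lattice_val (rootl a) = a.
Proof. by move=> aR; apply: insubdK; exact: root_in_lattice. Qed.

Lemma root_eltE (a : R) : root_elt a = rootl (val a).
Proof. by apply: lattice_val_inj; rewrite rootlK ?(valP a). Qed.

Lemma lattice_valD u v : lattice_val (u + v) = lattice_val u + lattice_val v.
Proof. exact: (raddfD val). Qed.

Lemma lattice_valN u : lattice_val (- u) = - lattice_val u.
Proof. exact: (raddfN val). Qed.

Lemma lattice_val_sum (I : Type) (s : seq I) (F : I -> M) :
  lattice_val (\sum_(i <- s) F i) = \sum_(i <- s) lattice_val (F i).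
Proof. exact: (raddf_sum val). Qed.

Lemma lattice_valMz u z : lattice_val (u *~ z) = lattice_val u *~ z.
Proof. exact: (raddfMz val). Qed.

Lemma rootlN a : a \in R -> - a \in R -> rootl (- a) = - rootl a.
Proof.
by move=> aR naR; apply: lattice_val_inj; rewrite lattice_valN !rootlK.
Qed.

Section Coordinates.
Context (S : {fset E}) (hS : is_simple_roots R S).

Lemma base_coord_exist w : exists d : E -> int,
  lattice_val w = \sum_(s <- S) s *~ d s.
Proof.
have hsum a b : (exists d : E -> int, a = \sum_(s <- S) s *~ d s) ->
    (exists d : E -> int, b = \sum_(s <- S) s *~ d s) ->
    exists d : E -> int, a + b = \sum_(s <- S) s *~ d s.
  move=> [d ->] [e ->]; exists (fun x => d x + e x); rewrite -big_split /=.
  by apply: eq_bigr => s _; rewrite mulrzDr.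
have /asboolP[c ->] := lattice_valP w; rewrite big_seq.
elim/big_ind: _ => [||a aR]; first by exists (fun=> 0); rewrite big1.
  exact: hsum.
have [_ _ /(_ _ aR)[d dE]] := hS.
have {dE} [z dE] : exists z : int, a = \sum_(s <- S) s *~ (z * (d s : int)).
  case: dE => dE; [exists 1|exists (-1)]; rewrite {1}dE.
    by apply: eq_bigr => s _; rewrite mul1r.
  by rewrite -sumrN; apply: eq_bigr => s _; rewrite mulN1r mulrNz.
exists (fun x => (z * (d x : int)) * c a); rewrite {1}dE.
by rewrite mulrz_suml; apply: eq_bigr => s _; rewrite -mulrzA.
Qed.

Definition base_coord w (s : E) : int :=
  if s \in S then sval (cid (base_coord_exist w)) s else 0.

Lemma base_coordE w : lattice_val w = \sum_(s <- S) s *~ base_coord w s.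
Proof.
rewrite {1}(svalP (cid (base_coord_exist w))) big_seq [RHS]big_seq.
by apply: eq_bigr => s sS; rewrite /base_coord sS.
Qed.

Lemma base_coord_uniq w (d : E -> int) :
  lattice_val w = \sum_(s <- S) s *~ d s ->
  forall s, s \in S -> base_coord w s = d s.
Proof.
rewrite base_coordE => e s sS; have /fset_freeP := base_free hS.
move=> /(_ (fun x => (base_coord w x)%:~R - (d x)%:~R)).
rewrite (eq_bigr (fun s => s *~ base_coord w s - s *~ d s)) => [|x _]; last first.
  by rewrite scalerBl !scaler_int.
rewrite sumrB e subrr => /(_ erefl _ sS) /eqP.
by rewrite subr_eq0 eqr_int => /eqP.
Qed.

Lemma base_coordD u v s : base_coord (u + v) s = base_coord u s + base_coord v s.
Proof.
have [sS|/negPf sS] := boolP (s \in S); last by rewrite /base_coord sS addr0.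
apply: (base_coord_uniq (d := fun s => base_coord u s + base_coord v s)) => //.
rewrite lattice_valD !base_coordE -big_split /=.
by apply: eq_bigr => x _; rewrite mulrzDr.
Qed.

Lemma base_coord_simple s t : s \in S ->
  base_coord (rootl t) s = (s == t)%:Z \/ t \notin S.
Proof.
move=> sS; have [tS|] := boolP (t \in S); [left|by right].
apply: (base_coord_uniq (d := fun s => (s == t)%:Z)) => //.
rewrite rootlK ?(base_sub hS) // (big_fsetD1 t) //= eqxx mulr1z.
rewrite big1_fset ?addr0 // => x; rewrite !inE => /andP[/negPf-> _] _.
by rewrite mulr0z.
Qed.

(** The fundamental coweight dual to [s] (zero for [s] outside [S]). These are the test vectors that
    turn membership in a dual cone into inequalities on coordinates. *)
Definition coweight (s : E) (w : M) : rat := (base_coord w s)%:~R.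

Fact coweight_additive s : zmod_morphism (coweight s).
Proof.
move=> u v; apply: (addIr (coweight s v)); rewrite subrK /coweight -intrD.
by rewrite -base_coordD subrK.
Qed.
HB.instance Definition _ s :=
  GRing.isZmodMorphism.Build M rat (coweight s) (coweight_additive s).

Lemma lattice_expand w : w = \sum_(s <- S) rootl s *~ base_coord w s.
Proof.
apply: lattice_val_inj; rewrite lattice_val_sum [LHS]base_coordE big_seq [RHS]big_seq.
by apply: eq_bigr => s sS; rewrite lattice_valMz rootlK // (base_sub hS).
Qed.

Lemma base_coord_comb w : (forall s, s \in S -> 0 <= base_coord w s) ->
  nonneg_comb S (lattice_val w).
Proof.
move=> h; exists (fun s => `|base_coord w s|%N); rewrite base_coordE.
rewrite big_seq [RHS]big_seq; apply: eq_bigr => s /h w0.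
by rewrite -{1}(gez0_abs w0).
Qed.

Lemma coweight_chamber s : weyl_chamber S (coweight s).
Proof.
move=> t tS; rewrite /= /coweight ler0z.
have [sS|/negPf sS] := boolP (s \in S); last by rewrite /base_coord sS.
have := base_coord_simple (lattice_val t) sS.
have -> : rootl (lattice_val t) = t.
  by apply: lattice_val_inj; rewrite rootlK // (base_sub hS).
by case=> [->|/negP//]; case: eqP.
Qed.

Lemma chamber_comb (v : coweight_space R) a : weyl_chamber S v ->
  a \in R -> nonneg_comb S a -> 0 <= v (rootl a).
Proof.
move=> cv aR [c ac].
have -> : rootl a = \sum_(s <- S) rootl s *~ (c s : int).
  apply: lattice_val_inj; rewrite rootlK // lattice_val_sum {1}ac big_seq [RHS]big_seq.
  by apply: eq_bigr => s sS; rewrite lattice_valMz rootlK // (base_sub hS).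
rewrite raddf_sum big_seq; apply: sumr_ge0 => s sS.
by rewrite raddfMz mulrz_ge0 // cv // rootlK // (base_sub hS).
Qed.

Section Face.
Context (tau : set (coweight_space R)) (u : M).
Context (hu : dual_points (weyl_chamber S) u).
Context (tauE : tau = [set v | weyl_chamber S v /\ v u = 0]).

Lemma face_coord_ge0 s : 0 <= base_coord u s.
Proof. by rewrite -(ler0z rat); apply: (hu (@coweight_chamber s)). Qed.

Lemma face_simple_eq0 (v : coweight_space R) s : tau v -> s \in S ->
  base_coord u s != 0 -> v (rootl s) = 0.
Proof.
rewrite tauE => -[cv vu] sS us.
have term t : t \in S -> 0 <= v (rootl t) *~ base_coord u t.
  move=> tS; rewrite mulrz_ge0 ?face_coord_ge0 //.
  by apply: cv; rewrite rootlK // (base_sub hS).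
move: vu; rewrite {1}(lattice_expand u) raddf_sum /= big_seq.
rewrite (eq_bigr (fun t => v (rootl t) *~ base_coord u t)) => [|t _]; last first.
  by rewrite raddfMz.
move/eqP; rewrite psumr_eq0 // => /allP/(_ _ sS); rewrite sS /=.
by rewrite mulrz_eq0 (negPf us) => /eqP.
Qed.

(** The simple roots at which [u] has a nonzero coordinate vanish on [tau], so their coordinates in
    [w] are unrestricted. The other coordinates are tested on the corresponding fundamental
    coweights, which lie in [tau]. *)
Lemma face_dualP w : dual_points tau w <->
  forall s, s \in S -> base_coord u s = 0 -> 0 <= base_coord w s.
Proof.
split=> [hw s sS us|h v tv].
  rewrite -(ler0z rat); apply: (hw (coweight s)); rewrite tauE; split.
    exact: coweight_chamber.
  by rewrite /= /coweight us.
rewrite (lattice_expand w) raddf_sum big_seq; apply: sumr_ge0 => s sS.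
rewrite raddfMz; have [us|us] := eqVneq (base_coord u s) 0.
  rewrite mulrz_ge0 // ?h //.
  by move: tv; rewrite tauE => -[cv _]; apply: cv; rewrite rootlK // (base_sub hS).
by rewrite (face_simple_eq0 tv sS us) mul0rz.
Qed.

Lemma face_dual_simple s : s \in S -> dual_points tau (rootl s).
Proof.
move=> sS v; rewrite tauE => -[cv _]; apply: cv.
by rewrite rootlK // (base_sub hS).
Qed.

Lemma face_dual_oppsimple s : s \in S -> base_coord u s != 0 ->
  dual_points tau (- rootl s).
Proof. by move=> sS us v tv; rewrite raddfN (face_simple_eq0 tv sS us) oppr0. Qed.
End Face.
End Coordinates.
End RootLattice.

(** * Dual monoids and separation of cones *)

Section FanCones.
Context (K : realType) (E : vectType K) (ip : {dot E for idfun}).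
Context (R : {fset E}) (hR : is_root_system ip R).
Local Notation M := (root_lattice R).
Implicit Types (a : E) (u v w : M) (sigma tau : fan_cone R).

Lemma rootN_l a : a \in R -> rootl R (- a) = - rootl R a.
Proof. by move=> aR; rewrite rootlN // (root_opp hR). Qed.

Lemma chamber_is_cone S : is_simple_roots R S ->
  exists2 S', is_simple_roots R S' & is_face (weyl_chamber (R := R) S) (weyl_chamber S').
Proof.
move=> hS; exists S => //; exists 0; first by move=> v _; rewrite raddf0.
by apply/seteqP; split=> [v cv|v []] //; split=> //; rewrite raddf0.
Qed.

Definition chamber_cone S (hS : is_simple_roots R S) : fan_cone R :=
  FanCone (chamber_is_cone hS).

Lemma chamber_dual_root S (hS : is_simple_roots R S) a : a \in R ->
  dual_points (chamber_cone hS) (rootl R a) -> nonneg_comb S a.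
Proof.
move=> aR h; rewrite -(rootlK aR); apply: (base_coord_comb (hS := hS)) => s sS.
by rewrite -(ler0z rat); apply: (h (coweight hS s)); exact: coweight_chamber.
Qed.

(** No root changes sign on a Weyl chamber, hence on none of its faces. This is why the domains of
    the characters of [a] and [- a] cover the toric variety. *)
Lemma cone_dual_total tau a : a \in R ->
  dual_points tau (rootl R a) \/ dual_points tau (- rootl R a).
Proof.
move=> aR; case: tau => tau [S hS [u hu tauE]] /=.
have [_ _ /(_ _ aR)[c cE]] := hS.
have pos b : b \in R -> nonneg_comb S b -> dual_points tau (rootl R b).
  move=> bR hb v; rewrite tauE => -[cv _]; exact: (chamber_comb hS).
case: cE => cE; [left|right]; first by apply: pos => //; exists c.
rewrite -rootN_l //; apply: pos; first exact: (root_opp hR).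
by exists c; rewrite cE opprK.
Qed.

(* The monoid of lattice points of a dual cone is generated by its roots. *)
Lemma cone_dual_ind tau (T : M -> Prop) :
  T 0 -> (forall u v, T u -> T v -> T (u + v)) ->
  (forall a, a \in R -> dual_points tau (rootl R a) -> T (rootl R a)) ->
  forall w, dual_points tau w -> T w.
Proof.
move=> T0 TD Troot w.
move: Troot; case: tau => tau [S hS [u hu tauE]] /= Troot.
move/(face_dualP hS hu tauE) => hw.
rewrite (lattice_expand hS w) big_seq; elim/big_ind: _ => // s sS.
have TMn (x : M) n : T x -> T (x *+ n).
  by move=> Tx; elim: n => [|n IH]; rewrite ?mulr0n // mulrS; exact: TD.
have sR := base_sub hS sS.
have Ts : T (rootl R s) by apply: Troot => //; exact: (face_dual_simple hS tauE).
have [us|us] := eqVneq (base_coord hS u s) 0.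
  by rewrite -(gez0_abs (hw s sS us)); exact: TMn.
have Tns : T (- rootl R s).
  rewrite -rootN_l //; apply: Troot; first exact: (root_opp hR).
  by rewrite rootN_l //; exact: (face_dual_oppsimple hu tauE).
case: (base_coord hS w s) => n; first exact: TMn.
by rewrite NegzE mulrNz -mulNrz; exact: TMn.
Qed.

Lemma dual_points0 (sigma : set (coweight_space R)) : dual_points sigma 0.
Proof. by move=> v _; rewrite raddf0. Qed.

Lemma dual_pointsD (sigma : set (coweight_space R)) u w :
  dual_points sigma u -> dual_points sigma w -> dual_points sigma (u + w).
Proof. by move=> hu hw v sv; rewrite raddfD addr_ge0 ?hu ?hw. Qed.

Lemma dual_pointsMn (sigma : set (coweight_space R)) u n :
  dual_points sigma u -> dual_points sigma (u *+ n).
Proof. by move=> hu v sv; rewrite raddfMn mulrn_wge0 ?hu. Qed.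

(** Biduality, tested on roots only: the simple roots place [v] in the chamber, and the negatives of
    the simple roots occurring in [u], which also lie in the dual, force [v u = 0]. *)
Lemma cone_memP tau (v : coweight_space R) :
  (forall a, a \in R -> dual_points tau (rootl R a) -> 0 <= v (rootl R a)) ->
  cone_set tau v.
Proof.
case: tau => tau [S hS [u hu tauE]] /= h; rewrite tauE.
have vs s : s \in S -> 0 <= v (rootl R s).
  move=> sS; apply: h (base_sub hS sS) _; exact: (face_dual_simple hS tauE).
split.
  move=> w ws; have <- : rootl R (lattice_val w) = w.
    by apply: lattice_val_inj; rewrite rootlK // (base_sub hS).
  exact: vs.
rewrite (lattice_expand hS u) raddf_sum big_seq big1 // => s sS /=.
rewrite raddfMz; have [->|us] := eqVneq (base_coord hS u s) 0; first by [].
have sR := base_sub hS sS.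
have : 0 <= v (rootl R (- s)).
  apply: h; first exact: (root_opp hR).
  by rewrite rootN_l //; exact: (face_dual_oppsimple hu tauE).
rewrite rootN_l // raddfN oppr_ge0 => vs'.
by have -> : v (rootl R s) = 0; [apply/le_anti; rewrite vs' vs|rewrite mul0rz].
Qed.

(* [u] is minus the sum of the roots that are nonnegative on [tau] and
   nonpositive on [sigma]; it cuts out [sigma `&` tau] as a face of [sigma]. *)
Lemma cone_separation sigma tau : exists u,
  [/\ dual_points sigma u, dual_points tau (- u) &
      forall w, dual_points (sigma `&` tau) w ->
        exists n, dual_points sigma (w + u *+ n)].
Proof.
pose A := [fset a in R | `[< dual_points tau (rootl R a) >] &&
                         `[< dual_points sigma (- rootl R a) >]]%fset.
have AP a : a \in A -> [/\ a \in R, dual_points tau (rootl R a) &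
    dual_points sigma (- rootl R a)].
  by rewrite !inE => /andP[aR /andP[/asboolP ? /asboolP ?]].
pose u := - \sum_(a <- A) rootl R a.
have su : dual_points sigma u.
  rewrite /u -sumrN big_seq; elim/big_ind: _ => [||a /AP[]] //.
    exact: dual_points0.
  exact: dual_pointsD.
have tu : dual_points tau (- u).
  rewrite /u opprK big_seq; elim/big_ind: _ => [||a /AP[]] //.
    exact: dual_points0.
  exact: dual_pointsD.
(* On [sigma] every summand of [u] is nonnegative, so [v u = 0] kills each root of [A]; the other
   roots that are nonnegative on [tau] are nonnegative on [sigma] as well. *)
have sub (v : coweight_space R) : cone_set sigma v -> v u = 0 -> cone_set tau v.
  move=> sv vu; apply: cone_memP => a aR ta.
  have [sa|sa] := cone_dual_total sigma aR; first exact: sa.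
  have aA : a \in A by rewrite !inE aR /=; apply/andP; split; exact/asboolP.
  have term b : b \in A -> 0 <= v (- rootl R b) by move=> /AP[_ _]; exact.
  move: vu; rewrite /u -sumrN raddf_sum big_seq => /eqP; rewrite psumr_eq0 //.
  move=> /allP/(_ _ aA); rewrite aA /= raddfN oppr_eq0 => /eqP->.
  by [].
exists u; split=> // w hw.
have [S hS [us hus sE]] := cone_setP sigma.
have dP := face_dualP hS hus sE.
(* One exponent for all coordinates: where [u] has a positive coordinate, [n] copies of it outweigh
   that of [w]; where it is zero, the coweight lies in both cones, so the coordinate of [w] is
   already nonnegative. *)
pose n := (\sum_(s <- S) `|base_coord hS w s|)%N.
exists n; apply/dP => s sS uss0.
have coordMn m : base_coord hS (u *+ m) s = base_coord hS u s *+ m.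
  elim: m => [|m IH]; last by rewrite !mulrS base_coordD IH.
  rewrite !mulr0n; apply: (addIr (base_coord hS 0 s)).
  by rewrite -base_coordD addr0 add0r.
have us_ge0 : 0 <= base_coord hS u s by have /dP/(_ s sS uss0) := su.
rewrite base_coordD coordMn.
have [us0|us0] := eqVneq (base_coord hS u s) 0.
  rewrite us0 mul0rn addr0 -(ler0z rat); apply: (hw (coweight hS s)).
  have sc : cone_set sigma (coweight hS s).
    rewrite sE; split; first exact: coweight_chamber.
    by rewrite /= /coweight uss0.
  by split=> //; apply: sub => //; rewrite /= /coweight us0.
have us1 : 1 <= base_coord hS u s by rewrite -gtz0_ge1 lt_def us0.
have wn : `|base_coord hS w s| <= n%:Z.
  by rewrite /n (big_fsetD1 s) //= PoszD lerDl.
have un : n%:Z <= base_coord hS u s *+ n.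
  by rewrite -[n%:Z]natz ler_wMn2r.
by move: wn; rewrite ler_norml => /andP[+ _]; lra.
Qed.

Lemma parabolic_cone (P : E -> Prop) : (forall a, a \in R -> P a \/ P (- a)) ->
  exists S (hS : is_simple_roots R S), forall s, s \in S -> P s.
Proof. by move=> /(parabolic_base hR)[S hS hP]; exists S, hS. Qed.

End FanCones.

(** * Affine schemes, gluing and stalks *)

Section PrimeIdeals.
Context (A : comPzRingType).

Lemma prime_ideal_ext (p q : prime_ideal A) :
  (forall a, prime_set p a <-> prime_set q a) -> p = q.
Proof.
case: p => p p0 pD pM p1 pP; case: q => q q0 qD qM q1 qP /= h.
have e : p = q by apply/seteqP; split=> a /h.
by subst q; congr PrimeIdeal; exact: Prop_irrelevance.
Qed.

Context (U : A -> Prop) (U1 : U 1) (U0 : ~ U 0).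
Context (UM : forall a b, U (a * b) <-> U a /\ U b).
Context (UD : forall a b, U (a + b) -> U a \/ U b).

(** Points are constructed by naming the elements that are invertible at them. For a homomorphism to
    a local ring, [U] is the preimage of the units and [UD] expresses locality. *)
Definition nonunit_prime : prime_ideal A.
Proof.
refine (@PrimeIdeal A [set a | ~ U a] _ _ _ _ _) => //=.
- by move=> a b na nb /UD[].
- by move=> a b nb /UM[].
- by move=> a b; rewrite UM => /not_andP.
Defined.

End PrimeIdeals.

Section SubringValues.
Context (A : comPzRingType) (S : set A) (hS : is_subring S).
Implicit Types (a b : subring hS).

Lemma subring_valM a b : subring_val (a * b) = subring_val a * subring_val b.
Proof. exact: (rmorphM (subring_incl hS)). Qed.
Lemma subring_valB a b : subring_val (a - b) = subring_val a - subring_val b.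
Proof. exact: (rmorphB (subring_incl hS)). Qed.
Lemma subring_valD a b : subring_val (a + b) = subring_val a + subring_val b.
Proof. exact: (rmorphD (subring_incl hS)). Qed.
Lemma subring_val1 : subring_val (1 : subring hS) = 1.
Proof. exact: (rmorph1 (subring_incl hS)). Qed.
Lemma subring_val0 : subring_val (0 : subring hS) = 0.
Proof. exact: (rmorph0 (subring_incl hS)). Qed.
End SubringValues.

Definition spec_at (A : comPzRingType) (U : opens (Spec A)) (s : 'O_(Spec A) (U))
  p (Up : open_set U p) : local_ring p := subring_val s (exist _ p Up).

Section SpecValues.
Context (A : comPzRingType) (U : opens (Spec A)).
Implicit Types (s t : 'O_(Spec A) (U)).

Lemma spec_ext s t :
  (forall p (Up : open_set U p), spec_at s Up = spec_at t Up) -> s = t.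
Proof.
by move=> e; apply: val_inj; apply: functional_extensionality_dep => -[p Up]; exact: e.
Qed.

Lemma spec_atM s t p (Up : open_set U p) :
  spec_at (s * t) Up = spec_at s Up * spec_at t Up.
Proof. by rewrite /spec_at (subring_valM s t). Qed.

Lemma spec_atB s t p (Up : open_set U p) :
  spec_at (s - t) Up = spec_at s Up - spec_at t Up.
Proof. by rewrite /spec_at (subring_valB s t). Qed.

Lemma spec_at1 p (Up : open_set U p) : spec_at (1 : 'O_(Spec A) (U)) Up = 1.
Proof. by rewrite /spec_at (subring_val1 (locally_fraction_subring U)). Qed.

Lemma spec_at_frac s p (Up : open_set U p) : exists (V : opens (Spec A)) (a b : A),
  open_set V p /\ forall q (Uq : open_set U q), open_set V q ->
    exists qb : ~ prime_set q b, spec_at s Uq = to_local (Fraction a qb).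
Proof.
have /asboolP/(_ (exist _ p Up))[V [a [b [Vp h]]]] := subring_valP s.
by exists V, a, b; split=> // q Uq Vq; exact: (h (exist _ q Uq)).
Qed.

Lemma spec_section (f : forall p, open_set U p -> local_ring p) :
  (forall p, open_set U p -> exists (V : opens (Spec A)) (a b : A),
     open_set V p /\ forall q (Uq : open_set U q), open_set V q ->
     exists qb : ~ prime_set q b, f q Uq = to_local (Fraction a qb)) ->
  exists s, forall p (Up : open_set U p), spec_at s Up = f p Up.
Proof.
move=> h.
have loc : subring_pred (locally_fraction_subring U) (fun q => f (sval q) (svalP q)).
  apply/asboolP => q; have [V [a [b [Vq hV]]]] := h _ (svalP q).
  by exists V, a, b; split=> // q'; exact: hV.
exists (Subring loc) => p Up; rewrite /spec_at /=; congr f; exact: Prop_irrelevance.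
Qed.
End SpecValues.

Lemma spec_at_res (A : comPzRingType) (U V : opens (Spec A)) (VU : V `<=` U)
    (s : 'O_(Spec A) (U)) p (Vp : open_set V p) (Up : open_set U p) :
  spec_at (rs_res VU s : 'O_(Spec A) (V)) Vp = spec_at s Up.
Proof. by congr (subring_val s (exist _ _ _)); exact: Prop_irrelevance. Qed.

Lemma spec_at_map (A B : comPzRingType) (f : {rmorphism A -> B})
    (V : opens (Spec A)) (s : 'O_(Spec A) (V)) q
    (Vq : open_set (mor_pre (spec_map f) V) q)
    (Vp : open_set V (prime_preimage f q)) :
  spec_at (mor_sec (spec_map f) V s : 'O_(Spec B) (mor_pre (spec_map f) V)) Vq =
  local_map (spec_at s Vp).
Proof.
by congr (local_map (subring_val s (exist _ _ _))); exact: Prop_irrelevance.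
Qed.

Lemma opens_ext (T : topologicalType) (U V : opens T) :
  open_set U = open_set V -> U = V.
Proof.
case: U V => U oU [V oV] /= e; subst V; congr Opens; exact: Prop_irrelevance.
Qed.

Lemma zariski_nbhd (A : comPzRingType) (U : set (prime_ideal A)) :
  (forall p, U p -> exists2 c, ~ prime_set p c &
     forall q, ~ prime_set q c -> U q) -> open U.
Proof.
move=> h; rewrite zariski_openE.
exists [set c | forall q, ~ prime_set q c -> U q].
by apply/seteqP; split=> [p /h[c pc cU]|p /= [c cU /cU]] //; exists c.
Qed.

Lemma zariski_basis (A : comPzRingType) (U : set (prime_ideal A)) p :
  open U -> U p -> exists2 c, ~ prime_set p c & forall q, ~ prime_set q c -> U q.
Proof.
rewrite zariski_openE => -[I ->] [c Ic pc]; exists c => // q qc.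
by exists c.
Qed.

Definition basic_open (A : comPzRingType) (c : A) : opens (Spec A).
Proof.
apply: (@Opens (Spec A) [set p | ~ prime_set p c]).
by apply: zariski_nbhd => p pc; exists c.
Defined.

Lemma open_local (T : topologicalType) (U : set T) :
  (forall x, U x -> exists V, [/\ open V, V x & V `<=` U]) -> open U.
Proof.
move=> h; have -> : U = \bigcup_(V in [set V | open V /\ V `<=` U]) V.
  apply/seteqP; split=> [x /h[V [oV Vx VU]]|x [V [_ VU] /VU]] //.
  by exists V.
by apply: bigcup_open => V [].
Qed.

Lemma cancel_units (A : comPzRingType) (c c' b b' a a' i i' : A) :
  b * i = 1 -> b' * i' = 1 -> c * b = a -> c' * b' = a' -> a * b' = a' * b -> c = c'.
Proof.
move=> ib ib' cE cE' h.
transitivity ((c * b) * b' * (i * i')).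
  by transitivity (c * (b * i) * (b' * i')); [rewrite ib ib'|]; ring.
rewrite cE h -cE'.
by transitivity (c' * (b * i) * (b' * i')); [|rewrite ib ib']; ring.
Qed.

Lemma cross_mul (A : comPzRingType) (r r' a a' b b' : A) :
  r * b = a -> r' * b' = a' -> (r * r') * (b * b') = a * a'.
Proof. by move=> <- <-; ring. Qed.

Lemma cross_sub (A : comPzRingType) (r r' a a' b b' : A) :
  r * b = a -> r' * b' = a' -> (r - r') * (b * b') = a * b' - a' * b.
Proof. by move=> <- <-; ring. Qed.

Lemma inverse_uniq (A : comPzRingType) (a b c : A) : a * c = 1 -> b * c = 1 -> a = b.
Proof. by move=> ac bc; rewrite -[a]mulr1 -bc mulrCA ac mulr1. Qed.

Definition unit_in (A : comPzRingType) (a : A) : Prop := exists c, a * c = 1.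

Lemma unit_inM (A : comPzRingType) (a b : A) : unit_in (a * b) <-> unit_in a /\ unit_in b.
Proof.
split=> [[c abc]|[[c ac] [d bd]]].
  by split; [exists (b * c)|exists (a * c)]; rewrite -abc; ring.
by exists (c * d); rewrite mulrACA ac bd mulr1.
Qed.

Lemma unit_in1 (A : comPzRingType) : unit_in (1 : A).
Proof. by exists 1; rewrite mulr1. Qed.

Section LocalRing.
Context (A : comPzRingType) (p : prime_ideal A).

Lemma local_unitP a b (pb : ~ prime_set p b) :
  unit_in (to_local (Fraction a pb)) <-> ~ prime_set p a.
Proof.
split=> [[c]|pa].
  elim/to_local_ind: c => -[e f pf]; rewrite to_localM to_local1.
  move=> /to_localP[w [pw /=]]; rewrite mulr1 mul1r => h pa.
  have : prime_set p (w * (b * f)).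
    have -> : w * (b * f) = (w * e) * a by rewrite -h; ring.
    exact: primeMl.
  by apply: (prime_outM pw); exact: prime_outM.
exists (to_local (Fraction b pa)); rewrite to_localM to_local1.
apply/to_localP; exists 1; split; first exact: prime1.
by rewrite /=; ring.
Qed.

Lemma local_unitD (x y : local_ring p) : unit_in (x + y) -> unit_in x \/ unit_in y.
Proof.
elim/to_local_ind: x => -[a b pb]; elim/to_local_ind: y => -[c d pd].
rewrite to_localD !local_unitP /= => h.
apply: contrapT => /not_orP[/contrapT pa /contrapT pc]; apply: h.
by apply: primeD; rewrite mulrC; exact: primeMl.
Qed.

Lemma local_unit0 : ~ unit_in (0 : local_ring p).
Proof. by rewrite to_local0 local_unitP; apply; exact: prime0. Qed.
End LocalRing.

(** * Germs, stalks, and sections determined by germs *)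

Section SpecGerm.
Context (A : comPzRingType) (U : opens (Spec A)) (p : prime_ideal A).
Context (Up : open_set U p).

Definition spec_germ_fun (s : 'O_(Spec A) (U)) : local_ring p := spec_at s Up.

Fact spec_germB : zmod_morphism spec_germ_fun.
Proof. by move=> s t; exact: spec_atB. Qed.
Fact spec_germM : monoid_morphism spec_germ_fun.
Proof. by split=> [|s t]; [exact: spec_at1|exact: spec_atM]. Qed.

HB.instance Definition _ :=
  GRing.isZmodMorphism.Build _ _ spec_germ_fun spec_germB.
HB.instance Definition _ :=
  GRing.isMonoidMorphism.Build _ _ spec_germ_fun spec_germM.

Definition spec_germ : {rmorphism 'O_(Spec A) (U) -> local_ring p} := spec_germ_fun.

Lemma spec_germ_eq s t : spec_germ s = spec_germ t ->
  exists V : opens (Spec A), open_set V p /\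
    forall q (Uq : open_set U q), open_set V q -> spec_at s Uq = spec_at t Uq.
Proof.
have [V [a [b [Vp sE]]]] := spec_at_frac s Up.
have [W [c [d [Wp tE]]]] := spec_at_frac t Up.
have [pb spE] := sE p Up Vp; have [pd tpE] := tE p Up Wp.
rewrite [spec_germ s]spE [spec_germ t]tpE => /to_localP[w [pw /= e]].
exists (opens_setI (opens_setI V W) (basic_open w)); split=> // q Uq [[Vq Wq] qw].
have [qb ->] := sE q Uq Vq; have [qd ->] := tE q Uq Wq.
by apply/to_localP; exists w.
Qed.

(** The inverse is offered on every smaller [W], because the transport to a scheme needs it on a
    preimage under the chart and not on an open set chosen here. *)
Lemma spec_germ_unit s : unit_in (spec_germ s) ->
  exists V : opens (Spec A), open_set V p /\
    forall W : opens (Spec A), W `<=` V -> W `<=` U ->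
    exists t : 'O_(Spec A) (W), forall q (Wq : open_set W q) (Uq : open_set U q),
      spec_at s Uq * spec_at t Wq = 1.
Proof.
have [V [a [b [Vp sE]]]] := spec_at_frac s Up.
have [pb spE] := sE p Up Vp; rewrite [spec_germ s]spE => /local_unitP pa.
exists (opens_setI V (basic_open a)); split=> // W WV WU.
have WV' q : open_set W q -> ~ prime_set q a by move=> /WV[].
have [q Wq|t tE] := @spec_section _ W (fun q Wq => to_local (Fraction b (WV' q Wq))).
  exists W, b, a; split=> // q' Wq' _; exists (WV' q' Wq').
  by [].
exists t => q Wq Uq; rewrite tE; have [qb ->] := sE q Uq (WV _ Wq).1.
rewrite to_localM to_local1; apply/to_localP; exists 1; split; first exact: prime1.
by rewrite /=; ring.
Qed.
End SpecGerm.

(** A characterization in place of a colimit over neighbourhoods: a local ring whose germ maps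
    detect local equality and local invertibility. The localization of an affine chart at the
    corresponding prime has these properties. *)
Record stalk (Y : ringed_space) (y : Y) := Stalk {
  stalk_ring : comPzRingType;
  germ : forall U : opens Y, open_set U y -> {rmorphism 'O_Y (U) -> stalk_ring};
  germ_res : forall (U V : opens Y) (VU : V `<=` U) (s : 'O_Y (U))
    (Uy : open_set U y) (Vy : open_set V y), germ Vy (rs_res VU s) = germ Uy s;
  germ_eq : forall (U : opens Y) (Uy : open_set U y) (s t : 'O_Y (U)),
    germ Uy s = germ Uy t ->
    exists (V : opens Y) (VU : V `<=` U), open_set V y /\ rs_res VU s = rs_res VU t;
  germ_unitP : forall (U : opens Y) (Uy : open_set U y) (s : 'O_Y (U)),
    germ_unit s y <-> unit_in (germ Uy s);
  stalk_unitD : forall a b : stalk_ring, unit_in (a + b) -> unit_in a \/ unit_in b;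
  stalk_unit0 : ~ unit_in (0 : stalk_ring)
}.

Lemma immersion_stalk (A : comPzRingType) (Y : ringed_space) (j : rs_mor (Spec A) Y)
  (p : prime_ideal A) : open_immersion j -> stalk (j p).
Proof.
move=> [j_inj j_open j_bij].
pose img (V : opens (Spec A)) : opens Y := Opens (j_open _ (openP V)).
have img_range V : img V `<=` range j by move=> _ [q _ <-]; exists q.
have imgP V q : open_set (img V) (j q) -> open_set V q by move=> [q' Vq' /j_inj <-].
have img_mem (V : opens (Spec A)) (q : Spec A) : open_set V q -> open_set (img V) (j q).
  by exists q.
pose g (U : opens Y) (Up : open_set U (j p)) : {rmorphism 'O_Y (U) -> local_ring p} :=
  (@spec_germ A (mor_pre j U) p Up \o mor_sec j U : {rmorphism _ -> _}).
have res_at (U V : opens Y) (VU : V `<=` U) (s : 'O_Y (U)) q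
    (Uq : open_set (mor_pre j U) q) (Vq : open_set (mor_pre j V) q) :
    spec_at (mor_sec j V (rs_res VU s)) Vq = spec_at (mor_sec j U s) Uq.
  have VU' : mor_pre j V `<=` mor_pre j U by move=> x; exact: VU.
  by rewrite (mor_sec_res _ VU') (spec_at_res _ _ _ Uq).
apply: (@Stalk Y (j p) (local_ring p) g).
- by move=> U V VU s Uy Vy; exact: res_at.
- move=> U Uy s t /spec_germ_eq[V [Vp h]].
  (* Only over open sets inside the range of [j] do sections of [Y] correspond bijectively to
     sections of the chart. *)
  pose V' := opens_setI U (img V).
  exists V', (@opens_setIl _ _ _); split; first by split=> //; exact: img_mem.
  have V'r : V' `<=` range j by move=> x [_ /img_range].
  apply: (bij_inj (j_bij V' V'r)); apply: spec_ext => q V'q.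
  rewrite !(res_at _ _ _ _ _ V'q.1); apply: h; exact: imgP V'q.2.
- move=> U Uy s; split=> [[V [VU [t [Vp st]]]]|/spec_germ_unit[V [Vp h]]].
    exists (g V Vp t); have := congr1 (g V Vp) st; rewrite rmorphM rmorph1 => <-.
    by congr (_ * _); symmetry; exact: res_at.
  pose V' := opens_setI U (img V).
  have V'r : V' `<=` range j by move=> x [_ /img_range].
  have [q [_ /imgP]|q []|t tE] := h (mor_pre j V'); [by []|by []|].
  have [k kK Kk] := j_bij V' V'r.
  exists V', (@opens_setIl _ _ _), (k t).
  split; first by split=> //; exact: img_mem.
  apply: (bij_inj (j_bij V' V'r)); apply: spec_ext => q V'q.
  by rewrite rmorphM Kk rmorph1 spec_atM spec_at1 (res_at _ _ _ _ _ V'q.1) tE.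
- exact: local_unitD.
- exact: local_unit0.
Defined.

Section SchemeStalks.
Context (Y : ringed_space) (hY : is_scheme Y).

Definition scheme_stalk (y : Y) : stalk y.
Proof.
have [A /cid[j [jo /cid2[p _ <-]]]] := cid (hY.2 y); exact: immersion_stalk.
Defined.
End SchemeStalks.

Lemma rmorphism_ext (A B : comPzRingType) (f g : {rmorphism A -> B}) : f =1 g -> f = g.
Proof.
move=> fg; have {fg} : (f : A -> B) = g by apply: functional_extensionality_dep.
case: f g => f cf [g cg] /= e; subst g; congr GRing.RMorphism.Pack.
case: cf cg => [[m1] [m2]] [[n1] [n2]].
by rewrite (Prop_irrelevance m1 n1) (Prop_irrelevance m2 n2).
Qed.

(** The pulled back sections live over two preimages that are only propositionally equal; comparing
    restrictions to a common [V] avoids a transport between their types. *)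
Lemma scheme_mor_ext (Y Z : ringed_space) (h h' : scheme_mor Y Z) :
  (forall y, h y = h' y) ->
  (forall (W : opens Z) (s : 'O_Z (W)) (V : opens Y)
     (Vh : V `<=` mor_pre h W) (Vh' : V `<=` mor_pre h' W),
     rs_res Vh (mor_sec h W s) = rs_res Vh' (mor_sec h' W s)) ->
  h = h'.
Proof.
case: h h' => [[f c m r] l] [[f' c' m' r'] l'] /= ef em.
have e : f = f' by exact: functional_extensionality_dep.
subst f'; have ? := Prop_irrelevance c c'; subst c'.
have e : m = m'.
  apply: functional_extensionality_dep => W; apply: rmorphism_ext => s.
  have := em W s (opens_preimage c W) (@subset_refl _ _) (@subset_refl _ _).
  by rewrite !rs_res_id.
subst m'; have ? := Prop_irrelevance r r'; subst r'.
by have -> : l = l' by exact: Prop_irrelevance.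
Qed.

Section SheafGerms.
Context (Y : ringed_space) (hY : is_scheme Y).
Local Notation st := (scheme_stalk hY).

Lemma section_germ_eq (U : opens Y) (s t : 'O_Y (U)) :
  (forall y (Uy : open_set U y), germ (st y) Uy s = germ (st y) Uy t) -> s = t.
Proof.
move=> h.
have ex (i : {y | open_set U y}) : exists V : opens Y,
    open_set V (sval i) /\ exists VU : V `<=` U, rs_res VU s = rs_res VU t.
  have [V [VU [Vy e]]] := germ_eq (h _ (svalP i)).
  by exists V; split=> //; exists VU.
have [V VP] := choice ex.
have VU i : V i `<=` U by have [_ []] := VP i.
have Ve i : rs_res (VU i) s = rs_res (VU i) t.
  by have [_ [VU' e]] := VP i; rewrite (Prop_irrelevance (VU i) VU').
have BU : opens_bigcup V `<=` U by move=> y [i _ /VU].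
have UB : U `<=` opens_bigcup V.
  by move=> y Uy; exists (exist _ y Uy) => //; exact: (VP (exist _ y Uy)).1.
have comp i j : rs_res (@opens_setIl _ (V i) (V j)) (rs_res (VU i) s) =
    rs_res (@opens_setIr _ (V i) (V j)) (rs_res (VU j) s).
  have WU : opens_setI (V i) (V j) `<=` U by move=> y [/VU].
  by rewrite !(rs_res_comp _ _ _ WU).
have [t0 [_ t0U]] := hY.1 _ V _ comp.
have es : t0 = rs_res BU s by apply: t0U => i; exact: rs_res_comp.
have et : t0 = rs_res BU t by apply: t0U => i; rewrite Ve; exact: rs_res_comp.
have := congr1 (rs_res UB) (etrans (esym es) et).
by rewrite !(rs_res_comp _ _ _ (@subset_refl _ U)) !rs_res_id.
Qed.

(** [G] prescribes the germ at each point. Being functional, it forces local realizations to have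
    equal germs on overlaps, so they glue. *)
Lemma section_of_germs (V : opens Y) (G : forall y, stalk_ring (st y) -> Prop) :
  (forall y c c', G y c -> G y c' -> c = c') ->
  (forall y, open_set V y -> exists (W : opens Y) (t : 'O_Y (W)),
     open_set W y /\ forall y' (Wy : open_set W y'),
       open_set V y' -> G y' (germ (st y') Wy t)) ->
  exists t : 'O_Y (V), forall y (Vy : open_set V y), G y (germ (st y) Vy t).
Proof.
move=> Gfun Gloc.
have ex (i : {y | open_set V y}) : exists Wt : {W : opens Y & 'O_Y (W)},
    open_set (projT1 Wt) (sval i) /\
    forall y' (Wy : open_set (projT1 Wt) y'),
      open_set V y' -> G y' (germ (st y') Wy (projT2 Wt)).
  by have [W [t [Wy h]]] := Gloc _ (svalP i); exists (existT _ W t).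
have [Wt WtP] := choice ex.
pose W i := opens_setI V (projT1 (Wt i)).
pose s i : 'O_Y (W i) := rs_res (@opens_setIr _ V _) (projT2 (Wt i)).
have sG i y (Wy : open_set (W i) y) : G y (germ (st y) Wy (s i)).
  by rewrite (germ_res _ _ _ Wy.2); apply: (WtP i).2; exact: Wy.1.
have comp i j : rs_res (@opens_setIl _ (W i) (W j)) (s i) =
    rs_res (@opens_setIr _ (W i) (W j)) (s j).
  apply: section_germ_eq => y Wy; rewrite (germ_res _ _ _ Wy.1) (germ_res _ _ _ Wy.2).
  exact: (Gfun y _ _ (sG i y Wy.1) (sG j y Wy.2)).
have [t0 [t0s _]] := hY.1 _ W s comp.
have VB : V `<=` opens_bigcup W.
  move=> y Vy; exists (exist _ y Vy) => //; split=> //.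
  exact: (WtP (exist _ y Vy)).1.
exists (rs_res VB t0) => y Vy; rewrite (germ_res _ _ _ (VB _ Vy)).
have Wy : open_set (W (exist _ y Vy)) y by split=> //; exact: (WtP (exist _ y Vy)).1.
by rewrite -(germ_res _ (@opens_bigcup_sup _ _ W (exist _ y Vy)) _ _ Wy) t0s; exact: sG.
Qed.
End SheafGerms.

Section RootDataTheory.
Context (K : realType) (E : vectType K) (R : {fset E}).

Lemma root_data_ext (Y : ringed_space) (D D' : root_data R Y) :
  (forall a, data_open D a = data_open D' a :> set _) ->
  (forall a (V : opens Y) (VD : V `<=` data_open D a) (VD' : V `<=` data_open D' a),
     rs_res VD (data_fun D a) = rs_res VD' (data_fun D' a)) ->
  D = D'.
Proof.
case: D D' => o f c n i s d [o' f' c' n' i' s' d'] /= eo ef.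
have e : o = o' by apply: functional_extensionality_dep => a; exact: opens_ext.
subst o'; have {}e : f = f'.
  apply: functional_extensionality_dep => a.
  by have := ef a (o a) (@subset_refl _ _) (@subset_refl _ _); rewrite !rs_res_id.
subst f'; have ? := Prop_irrelevance s s'; subst s'.
by rewrite (Prop_irrelevance c c') (Prop_irrelevance n n') (Prop_irrelevance i i')
  (Prop_irrelevance d d').
Qed.

Lemma pullback_comp (Y' Y Z : ringed_space) (g : scheme_mor Y' Y) (h : scheme_mor Y Z)
  (D : root_data R Z) : pullback (scheme_comp g h) D = pullback g (pullback h D).
Proof. by apply: root_data_ext => // a V VD VD'; rewrite (Prop_irrelevance VD VD'). Qed.
End RootDataTheory.

(** * The toric variety *)

Section FractionField.
Context (G : zmodType).
Local Notation ZG := (group_ring G).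
Context (dom : forall g h : ZG, g * h = 0 -> g = 0 \/ h = 0).

Lemma gr_one_neq0 : (1 : ZG) <> 0.
Proof.
move=> /(congr1 (@monalg.mcoeff G int 0)); rewrite monalg.mcoeff0.
by rewrite -[1]/(@monalg.mkmalgU G int 0 1) monalg.mcoeffUU.
Qed.

Definition zero_prime : prime_ideal ZG.
Proof.
refine (@PrimeIdeal ZG [set 0] _ _ _ _ _) => //=.
- by move=> a b -> ->; rewrite addr0.
- by move=> a b ->; rewrite mulr0.
- exact: gr_one_neq0.
Defined.

Lemma fraction_field_exists : exists (F : comPzRingType) (emb : {rmorphism ZG -> F}),
  injective emb /\ forall b, b <> 0 -> exists i, i * emb b = 1.
Proof.
pose e (a : ZG) : local_ring zero_prime := to_local (Fraction a (@prime1 _ zero_prime)).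
have eB : zmod_morphism e.
  move=> a b; rewrite /e to_localN to_localD; apply/to_localP; exists 1.
  by split; [exact: prime1|rewrite /=; ring].
have eM : monoid_morphism e.
  split=> [//|a b]; rewrite /e to_localM; apply/to_localP; exists 1.
  by split; [exact: prime1|rewrite /=; ring].
pose m1 := GRing.isZmodMorphism.Build _ _ e eB.
pose m2 := GRing.isMonoidMorphism.Build _ _ e eM.
pose emb : {rmorphism ZG -> local_ring zero_prime} := HB.pack e m1 m2.
exists (local_ring zero_prime), emb; split=> [a b /to_localP /= [u [u0]]|b b0].
  rewrite !mulr1 => /eqP; rewrite -subr_eq0 -mulrBr => /eqP/dom[//|/eqP].
  by rewrite subr_eq0 => /eqP.
exists (@to_local _ zero_prime (@Fraction _ zero_prime 1 b b0)).
rewrite [emb b]/(e b) /e to_localM to_local1; apply/to_localP; exists 1.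
by split; [exact: prime1|rewrite /=; ring].
Qed.
End FractionField.

(** Pairing with a generic vector provides the separating functional that [gr_domain] asks for. *)
Lemma root_group_ring_domain (K : realType) (E : vectType K)
    (ip : {dot E for idfun}) (R : {fset E}) (g h : group_ring (root_lattice R)) :
  g * h = 0 -> g = 0 \/ h = 0.
Proof.
apply: (gr_domain (K := K)) => s s0.
have [|v hv] := @generic_vector K E ip (map (@lattice_val K E R) s).
  apply/mapP => -[x xs x0]; move: s0; suff -> : 0 = x by rewrite xs.
  exact: lattice_val_inj.
exists (fun w => ip (lattice_val w) v); split=> [x y|x xs].
  by rewrite lattice_valD ipDl.
by apply: hv; exact: map_f.
Qed.

Section ToricVariety.
Context (K : realType) (E : vectType K) (ip : {dot E for idfun}).
Context (R : {fset E}) (hR : is_root_system ip R).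
Local Notation M := (root_lattice R).
Local Notation ZM := (group_ring M).
Local Notation X := (toric_variety R).
Local Notation cone := (set (coweight_space R)).
Context (F : comPzRingType) (emb : {rmorphism ZM -> F}).
Context (emb_inj : injective emb).
Context (emb_inv : forall b, b <> 0 -> exists i, i * emb b = 1).

Local Notation face_l sigma tau := (face_map (@subIsetl (coweight_space R) sigma tau)).
Local Notation face_r sigma tau := (face_map (@subIsetr (coweight_space R) sigma tau)).

Definition ring_elt (sigma : cone) (g : ZM)
    (hg : supported_in (dual_points sigma) g) : cone_ring sigma :=
  @Subring _ _ (cone_ring_subring sigma) g (asboolT hg).

Lemma ring_eltP (sigma : cone) (a : cone_ring sigma) :
  supported_in (dual_points sigma) (subring_val a).
Proof. exact/asboolP/(subring_valP a). Qed.

Lemma ring_val_inj (sigma : cone) (a b : cone_ring sigma) :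
  subring_val a = subring_val b -> a = b.
Proof. exact: val_inj. Qed.

Definition ev (sigma : cone) (a : cone_ring sigma) : F := emb (subring_val a).

Lemma embM g h : emb (g * h) = emb g * emb h. Proof. exact: rmorphM. Qed.

Lemma evM (sigma : cone) (a b : cone_ring sigma) : ev (a * b) = ev a * ev b.
Proof. by rewrite /ev subring_valM rmorphM. Qed.
Lemma evD (sigma : cone) (a b : cone_ring sigma) : ev (a + b) = ev a + ev b.
Proof. by rewrite /ev subring_valD rmorphD. Qed.
Lemma ev1 (sigma : cone) : ev (1 : cone_ring sigma) = 1.
Proof. by rewrite /ev subring_val1 rmorph1. Qed.
Lemma ev0 (sigma : cone) : ev (0 : cone_ring sigma) = 0.
Proof. by rewrite /ev subring_val0 rmorph0. Qed.
Lemma ev_inj (sigma : cone) : injective (@ev sigma).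
Proof. by move=> a b /emb_inj/ring_val_inj. Qed.

Definition ring_char (sigma : cone) (u : M) (hu : dual_points sigma u) :
    cone_ring sigma := ring_elt (@monomial_supp _ _ 1 _ hu).

Lemma spec_at_face (sigma rho : cone) (rs : rho `<=` sigma)
    (V : opens (Spec (cone_ring sigma))) (s : 'O_(Spec (cone_ring sigma)) (V))
    v (Vv : open_set V (face_map rs v)) (Vv' : open_set (mor_pre (face_map rs) V) v) :
  spec_at (mor_sec (face_map rs) V s :
             'O_(Spec (cone_ring rho)) (mor_pre (face_map rs) V)) Vv' =
  local_map (spec_at s Vv).
Proof. exact: spec_at_map. Qed.

(** * Local rings of points inside the fraction field *)

Section Local.
Context (sigma : cone) (p : prime_ideal (cone_ring sigma)).
Implicit Types (a b : cone_ring sigma) (r s t : F).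

Definition loc : set F :=
  [set r | exists a b, ~ prime_set p b /\ r * ev b = ev a].

Definition lunit r := exists2 t, loc t & t * r = 1.

Lemma out_neq0 b : ~ prime_set p b -> subring_val b <> 0.
Proof.
move=> pb b0; apply: pb; rewrite (_ : b = 0); first exact: prime0.
by apply: ring_val_inj; rewrite subring_val0.
Qed.

Lemma emb_cancel b r s : ~ prime_set p b ->
  r * ev b = s * ev b -> r = s.
Proof.
move=> /out_neq0/emb_inv[i ib] e.
by rewrite -[r]mulr1 -[s]mulr1 -ib !(mulrC i) !mulrA e.
Qed.

Lemma loc_emb a : loc (ev a).
Proof.
exists a, 1; split; first exact: prime1.
by rewrite ev1 mulr1.
Qed.

Lemma loc_frac a b : ~ prime_set p b ->
  exists2 r, loc r & r * ev b = ev a.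
Proof.
move=> pb; have [i ib] := emb_inv (out_neq0 pb).
have e : ev a * i * ev b = ev a.
  by rewrite -mulrA ib mulr1.
by exists (ev a * i) => //; exists a, b.
Qed.

Lemma locM r s : loc r -> loc s -> loc (r * s).
Proof.
move=> [a [b [pb rE]]] [c [d [pd sE]]]; exists (a * c), (b * d).
split; first exact: prime_outM.
rewrite !evM -rE -sE; ring.
Qed.

Lemma loc1 : loc 1.
Proof. by rewrite -(ev1 sigma); exact: loc_emb. Qed.

Lemma loc_exp r n : loc r -> loc (r ^+ n).
Proof.
move=> lr; elim: n => [|n IH]; first by rewrite expr0; exact: loc1.
by rewrite exprS; exact: locM.
Qed.

Lemma lunit_embP a : lunit (ev a) <-> ~ prime_set p a.
Proof.
split=> [[r [c [b [pb rE]]] ra] pa|/(loc_frac 1)[r lr rE]]; last first.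
  by exists r => //; rewrite rE ev1.
apply: pb; have -> : b = c * a; last exact: primeMl.
apply: ev_inj; rewrite evM -rE.
by rewrite mulrAC ra mul1r.
Qed.

Lemma frac_lunit a b r : ~ prime_set p b ->
  r * ev b = ev a -> lunit r <-> ~ prime_set p a.
Proof.
move=> pb rE; split=> [[t lt tr]|pa].
  apply/lunit_embP; have /lunit_embP[s ls sb] := pb.
  exists (t * s); first exact: locM.
  by rewrite -rE mulrACA tr mul1r sb.
have [t lt tE] := loc_frac b pa; exists t => //.
apply: (emb_cancel pa); apply: (emb_cancel pb).
transitivity (t * ev a * (r * ev b)).
  by ring.
by rewrite tE rE mul1r mulrC.
Qed.

Lemma lunitM r s : loc r -> loc s -> lunit (r * s) <-> lunit r /\ lunit s.
Proof.
move=> lr ls; split=> [[t lt trs]|[[t lt tr] [t' lt' ts]]].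
  split; [exists (t * s)|exists (t * r)]; try exact: locM.
    by rewrite -trs; ring.
  by rewrite -trs; ring.
exists (t * t'); first exact: locM.
by rewrite mulrACA tr ts mulr1.
Qed.

Lemma lunitD r s : loc r -> loc s -> lunit (r + s) -> lunit r \/ lunit s.
Proof.
move=> [a [b [pb rE]]] [c [d [pd sE]]].
have rs : (r + s) * ev (b * d) = ev (a * d + c * b).
  rewrite evD !evM -rE -sE; ring.
rewrite (frac_lunit (prime_outM pb pd) rs) (frac_lunit pb rE) (frac_lunit pd sE).
move=> h; apply: contrapT => /not_orP[/contrapT pa /contrapT pc]; apply: h.
by apply: primeD; [rewrite mulrC|rewrite mulrC]; exact: primeMl.
Qed.

Lemma lunit0 : ~ lunit 0.
Proof.
by rewrite -(ev0 sigma) lunit_embP => /(_ (prime0 p)).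
Qed.

Lemma lunit1 : lunit 1. Proof. by exists 1; [exact: loc1|rewrite mulr1]. Qed.
End Local.

(** An element of the coordinate ring lies outside [p] exactly when its image is invertible in
    [loc p], so the local ring determines the prime. *)
Lemma loc_inj (sigma : cone) (p q : prime_ideal (cone_ring sigma)) :
  (forall r, loc p r <-> loc q r) -> p = q.
Proof.
move=> h; apply: prime_ideal_ext => a.
have := lunit_embP p a; have := lunit_embP q a.
have -> : lunit p (ev a) <-> lunit q (ev a).
  by split=> -[t /h lt ta]; exists t.
by move=> -> e; split=> pa; apply: contrapT => na; [apply: e.1|apply: e.2].
Qed.

(** Finitely many monomials need only the largest of their exponents. All larger [m] are allowed so
    that a numerator and a denominator can share one exponent. *)
Lemma clear_denominators (sigma rho : cone) (u : M) : dual_points sigma u ->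
  (forall w, dual_points rho w -> exists n, dual_points sigma (w + u *+ n)) ->
  forall g, supported_in (dual_points rho) g ->
  exists n, forall m, (n <= m)%N ->
    supported_in (dual_points sigma) (g * character (u *+ m)).
Proof.
move=> su h g; elim/supported_ind => {g} [|g g' [n gn] [n' gn']|c k rk].
- exists 0%N => m _; rewrite mul0r => k; by rewrite monalg.msupp0.
- exists (maxn n n') => m; rewrite geq_max => /andP[/gn ? /gn' ?].
  rewrite mulrDl => k /(fsubsetP (monalg.msuppD_le _ _)); rewrite inE => /orP[].
    exact: (_ : supported_in _ _).
  exact: (_ : supported_in _ _).
- have [n hn] := h _ rk; exists n => m nm; rewrite monomialM.
  apply: monomial_supp; rewrite -(subnK nm) addnC mulrnDr addrA.
  by apply: dual_pointsD => //; exact: dual_pointsMn.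
Qed.

(** The hypotheses say that the ring of [rho] is the ring of [sigma] with the character of [u]
    inverted, and such a localization leaves the local rings of its points unchanged. *)
Lemma loc_face (sigma rho : cone) (rs : rho `<=` sigma) (u : M) :
  dual_points sigma u -> dual_points rho (- u) ->
  (forall w, dual_points rho w -> exists n, dual_points sigma (w + u *+ n)) ->
  forall (v : prime_ideal (cone_ring rho)) r, loc (face_map rs v) r <-> loc v r.
Proof.
move=> su ru h v r.
pose w := subring_widen
  (cone_ring_subring sigma)
  (cone_ring_subring rho)
  (cone_ring_sub rs).
split=> -[a [b [pb rE]]]; first by exists (w a), (w b).
have [n an] := clear_denominators su h (@ring_eltP _ a).
have [n' bn] := clear_denominators su h (@ring_eltP _ b).
pose m := maxn n n'.
have am := an m (leq_maxl _ _); have bm := bn m (leq_maxr _ _).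
have ea : ev (ring_elt am) = ev a * emb (character (u *+ m)) by exact: embM.
have eb : ev (ring_elt bm) = ev b * emb (character (u *+ m)) by exact: embM.
exists (ring_elt am), (ring_elt bm); split; last by rewrite ea eb mulrA rE.
move=> /= vb; apply: pb.
(* The new denominator stays outside the prime, because [b] is recovered from it by a factor from
   the ring of [rho]. *)
have -> : b = ring_char (dual_pointsMn m ru) *
    w (ring_elt bm).
  apply: ring_val_inj; rewrite subring_valM /= mulrCA -characterD mulNrn addNr.
  by rewrite character0 mulr1.
exact: primeMl.
Qed.

(** The character of [- u] belongs to the ring of [tau], hence to [loc p], and together with the
    ring of [sigma] it generates the ring of the overlap. The elements of the latter that are not
    units in [loc p] form the prime [v]. *)
Lemma loc_face_lift (sigma tau : fan_cone R) (p : prime_ideal (cone_ring sigma)) :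
  (forall g, supported_in (dual_points tau) g -> loc p (emb g)) ->
  exists v : prime_ideal (cone_ring (sigma `&` tau)),
    face_l sigma tau v = p.
Proof.
move=> htau; have [u [su tu hu]] := cone_separation hR sigma tau.
have lg (g : cone_ring (sigma `&` tau)) : loc p (ev g).
  have [n /(_ n (leqnn n)) gn] := clear_denominators su hu (@ring_eltP _ g).
  have sE : subring_val g = (subring_val g * character (u *+ n)) * character (- u *+ n).
    by rewrite -mulrA -characterD mulNrn subrr character0 mulr1.
  rewrite /ev sE rmorphM; apply: locM; first exact: (loc_emb p (ring_elt gn)).
  by apply: htau; apply: monomial_supp; exact: dual_pointsMn.
pose U (g : cone_ring (sigma `&` tau)) := lunit p (ev g).
have U1 : U 1 by rewrite /U ev1; exact: lunit1.
have U0 : ~ U 0 by rewrite /U ev0; exact: lunit0.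
have UM a b : U (a * b) <-> U a /\ U b.
  by rewrite /U evM; exact: lunitM.
have UD a b : U (a + b) -> U a \/ U b.
  by rewrite /U evD; exact: lunitD.
exists (nonunit_prime U1 U0 UM UD); apply: prime_ideal_ext => a /=.
rewrite /U /= lunit_embP; split=> [|pa]; [exact: contrapT|exact].
Qed.

Definition tpt (sigma : fan_cone R) (p : prime_ideal (cone_ring sigma)) : X :=
  toric_chart sigma p.

Lemma tpt_surj (x : X) : exists (sigma : fan_cone R) p, x = tpt (sigma := sigma) p.
Proof.
exists (projT1 (repr x)), (projT2 (repr x)).
by rewrite -[LHS]reprK; case: (repr x).
Qed.

Lemma loc_face_l (sigma tau : fan_cone R)
    (v : prime_ideal (cone_ring (sigma `&` tau))) r :
  loc (face_l sigma tau v) r <-> loc v r.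
Proof.
have [u [su tu hu]] := cone_separation hR sigma tau.
apply: (loc_face _ su) => // w [_ /tu]; exact.
Qed.

Lemma loc_face_r (sigma tau : fan_cone R)
    (v : prime_ideal (cone_ring (sigma `&` tau))) r :
  loc (face_r sigma tau v) r <-> loc v r.
Proof.
have [u [su tu hu]] := cone_separation hR tau sigma.
apply: (loc_face _ su); first by move=> w [/tu]; exact.
by move=> w; rewrite setIC; exact: hu.
Qed.

(** Equality in the glued space means a chain of elementary identifications, and each of them passes
    through a point of an overlap whose local ring is that of both its images. *)
Lemma tpt_loc (sigma tau : fan_cone R) (p : prime_ideal (cone_ring sigma))
    (q : prime_ideal (cone_ring tau)) : tpt p = tpt q ->
  forall r, loc p r <-> loc q r.
Proof.
pose T := {s : fan_cone R & (Spec (cone_ring s) : topologicalType)}.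
pose locT (x : T) := @loc (projT1 x) (projT2 x).
have H (x y : T) : clos_refl_sym_trans T (@glue_step _ _ _
    (fun sigma tau : fan_cone R => face_l sigma tau)
    (fun sigma tau : fan_cone R => face_r sigma tau)) x y ->
    forall r, locT x r <-> locT y r.
  elim=> {x y} [x y [s [t [v [-> ->]]]] r|x r|x y _ IH r|x y z _ IH1 _ IH2 r].
  - by rewrite /locT /= loc_face_l loc_face_r.
  - by [].
  - by rewrite IH.
  - by rewrite IH1.
move=> /eqmodP/asboolP/H; exact.
Qed.

Definition loc_at (x : X) : set F :=
  [set r | exists (sigma : fan_cone R) p, x = tpt (sigma := sigma) p /\ loc p r].

Lemma loc_atP (sigma : fan_cone R) (p : prime_ideal (cone_ring sigma)) r :
  loc_at (tpt p) r <-> loc p r.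
Proof.
split=> [[tau [q [/tpt_loc e lr]]]|lr]; first exact/e.
by exists sigma, p.
Qed.

Lemma tpt_face (sigma tau : fan_cone R) (v : prime_ideal (cone_ring (sigma `&` tau))) :
  tpt (face_r sigma tau v : prime_ideal (cone_ring tau)) =
  tpt (face_l sigma tau v : prime_ideal (cone_ring sigma)).
Proof. exact: glue_pointE. Qed.

Lemma loc_at_chart (tau : fan_cone R) (x : X) :
  (forall g, supported_in (dual_points tau) g -> loc_at x (emb g)) ->
  exists q : prime_ideal (cone_ring tau), x = tpt q.
Proof.
have [sigma [p ->]] := tpt_surj x => h.
have [g /h/loc_atP //|v <-] := @loc_face_lift sigma tau p.
by exists (face_r sigma tau v); rewrite tpt_face.
Qed.

(** The coordinate ring of a chart around [x] lies in the common local ring, so [y] lies in the same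
    chart, where [loc_inj] applies. *)
Lemma loc_at_inj (x y : X) : (forall r, loc_at x r <-> loc_at y r) -> x = y.
Proof.
have [sigma [p ->]] := tpt_surj x => h.
have [g hg|q yE] := @loc_at_chart sigma y.
  by apply/h/loc_atP; exact: (loc_emb p (ring_elt hg)).
subst y; congr tpt; apply: loc_inj => r.
by rewrite -!loc_atP h.
Qed.

(** * Sections as elements of the fraction field *)

Section StalkVal.
Context (sigma : cone) (p : prime_ideal (cone_ring sigma)).
Implicit Types (z : local_ring p) (r : F).

(** The graph of the isomorphism from the localization, a type that depends on [p], to the subset
    [loc p] of the fixed [F], in which values at different points can be compared. *)
Definition stalk_val z r := exists a b (pb : ~ prime_set p b),
  z = to_local (Fraction a pb) /\ r * ev b = ev a.

Lemma stalk_val_ex z : exists r, stalk_val z r.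
Proof.
elim/to_local_ind: z => -[a b pb]; have [r _ rE] := loc_frac a pb.
by exists r, a, b, pb.
Qed.

Lemma stalk_val_fun z r r' : stalk_val z r -> stalk_val z r' -> r = r'.
Proof.
move=> [a [b [pb [-> rE]]]] [c [d [pd [/to_localP/= [u [pu e]] rE']]]].
apply: (emb_cancel pu); apply: (emb_cancel pb); apply: (emb_cancel pd).
have := congr1 (@ev sigma) e; rewrite !evM -rE -rE' => h.
transitivity (ev u * (r * ev b * ev d)); first by ring.
by rewrite h; ring.
Qed.

Lemma stalk_val_inj z z' r : stalk_val z r -> stalk_val z' r -> z = z'.
Proof.
move=> [a [b [pb [-> rE]]]] [c [d [pd [-> rE']]]].
apply/to_localP => /=; exists 1; split; first exact: prime1.
by apply: ev_inj; rewrite !evM -rE -rE'; ring.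
Qed.

Lemma stalk_val_loc z r : stalk_val z r -> loc p r.
Proof. by move=> [a [b [pb [_ rE]]]]; exists a, b. Qed.

Lemma loc_stalk_val r : loc p r -> exists z, stalk_val z r.
Proof.
by move=> [a [b [pb rE]]]; exists (to_local (Fraction a pb)), a, b, pb.
Qed.

Lemma stalk_valM z z' r r' :
  stalk_val z r -> stalk_val z' r' -> stalk_val (z * z') (r * r').
Proof.
move=> [a [b [pb [-> rE]]]] [c [d [pd [-> rE']]]].
exists (a * c), (b * d), (prime_outM pb pd); split; first exact: to_localM.
by rewrite !evM -rE -rE'; ring.
Qed.

Lemma stalk_valN z r : stalk_val z r -> stalk_val (- z) (- r).
Proof.
move=> [a [b [pb [-> rE]]]]; exists (- a), b, pb; split; first exact: to_localN.
apply: (addrI (ev a)); rewrite -evD subrr ev0 -rE; ring.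
Qed.

Lemma stalk_valD z z' r r' :
  stalk_val z r -> stalk_val z' r' -> stalk_val (z + z') (r + r').
Proof.
move=> [a [b [pb [-> rE]]]] [c [d [pd [-> rE']]]].
exists (a * d + c * b), (b * d), (prime_outM pb pd); split; first exact: to_localD.
by rewrite evD !evM -rE -rE'; ring.
Qed.

Lemma stalk_val1 : stalk_val 1 1.
Proof.
exists 1, 1, (@prime1 _ p); split; first exact: to_local1.
by rewrite mul1r.
Qed.
End StalkVal.

Lemma stalk_val_face (sigma rho : cone) (rs : rho `<=` sigma)
    (v : prime_ideal (cone_ring rho))
    (z : local_ring (face_map rs v : prime_ideal (cone_ring sigma))) r :
  stalk_val z r -> stalk_val (local_map z : local_ring v) r.
Proof.
move=> [a [b [pb [-> rE]]]].
by eexists _, _, _; split; first exact: local_mapE.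
Qed.

Section GenericPoint.
Context (sigma : cone).

Fact cone_ring_domain (a b : cone_ring sigma) :
  ev (a * b) = 0 -> ev a = 0 \/ ev b = 0.
Proof.
rewrite evM => ab; have [a0|a0] := pselect (subring_val a = 0).
  by left; rewrite /ev a0 rmorph0.
have [i ia] := emb_inv a0; right.
by rewrite -[ev b]mul1r -ia -mulrA ab mulr0.
Qed.

Definition generic_prime : prime_ideal (cone_ring sigma).
Proof.
refine (@PrimeIdeal _ [set a | ev a = 0] _ _ _ _ cone_ring_domain) => /=.
- exact: ev0.
- by move=> a b ea eb; rewrite evD ea eb addr0.
- by move=> a b eb; rewrite evM eb mulr0.
- rewrite -(ev0 sigma) => /ev_inj/(congr1 (subring_val (A := ZM) (hS := _))).
  by rewrite subring_val1 subring_val0; exact: gr_one_neq0.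
Defined.

Lemma generic_primeP a : prime_set generic_prime a <-> a = 0.
Proof. by split=> [|->]; [rewrite /= -(ev0 sigma) => /ev_inj|exact: prime0]. Qed.

Lemma generic_in_open (U : set (prime_ideal (cone_ring sigma))) p :
  open U -> U p -> U generic_prime.
Proof.
rewrite zariski_openE => -[I ->] [a Ia pa]; exists a => //.
by move/generic_primeP => a0; apply: pa; rewrite a0; exact: prime0.
Qed.

(** The generic point lies in every nonempty open set, so each local fraction representing [t] has
    the value that [t] takes there. *)
Lemma spec_val (U : opens (Spec (cone_ring sigma)))
    (t : 'O_(Spec (cone_ring sigma)) (U)) :
  exists r, forall p (Up : open_set U p),
    stalk_val (spec_at t Up) r.
Proof.
have [[p0 Up0]|U0] := pselect (exists p, open_set U p); last first.
  by exists 0 => p Up; case: U0; exists p.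
have Ug := generic_in_open (openP U) Up0.
have [r rE] := stalk_val_ex (spec_at t Ug).
exists r => p Up; have [V [a [b [Vp tE]]]] := spec_at_frac t Up.
have [pb ->] := tE p Up Vp.
have Vg := generic_in_open (openP V) Vp.
have [gb e] := tE generic_prime Ug Vg.
exists a, b, pb; split=> //.
have [r' lr' r'E] := loc_frac a gb.
have : stalk_val (spec_at t Ug) r'.
  by rewrite e; exists a, b, gb.
by move=> /(stalk_val_fun rE) ->.
Qed.
End GenericPoint.

(** One value for all charts at once. Over an empty [W] every [r] qualifies, which is why
    [is_val_fun] takes a point of [W]. *)
Definition is_val (W : opens X) (s : 'O_X (W)) (r : F) : Prop :=
  forall (sigma : fan_cone R) (p : prime_ideal (cone_ring sigma))
    (Wp : open_set W (tpt p)),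
    stalk_val (spec_at (mor_sec (toric_chart sigma) W s) Wp) r.

Lemma section_compat (W : opens X) (s : 'O_X (W)) (sigma tau : fan_cone R)
    (v : prime_ideal (cone_ring (sigma `&` tau)))
    (Wl : open_set W (tpt (face_l sigma tau v : prime_ideal (cone_ring sigma))))
    (Wr : open_set W (tpt (face_r sigma tau v : prime_ideal (cone_ring tau)))) :
  local_map (spec_at (mor_sec (toric_chart sigma) W s) Wl :
               local_ring (face_map _ v : prime_ideal _)) =
  local_map (spec_at (mor_sec (toric_chart tau) W s) Wr :
               local_ring (face_map _ v : prime_ideal _)) :> local_ring v.
Proof.
have /asboolP/(_ sigma tau) := subring_valP s.
move=> /(congr1 (fun t =>
  @spec_at _ (mor_pre (face_r sigma tau) (glue_pre W tau)) t v Wr)).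
have Wl' : open_set (mor_pre (face_l sigma tau) (glue_pre W sigma)) v := Wl.
rewrite (spec_at_res _ _ _ Wl').
rewrite (@spec_at_face _ _ _ (glue_pre W sigma) _ _ Wl).
by rewrite (@spec_at_face _ _ _ (glue_pre W tau) _ _ Wr).
Qed.

Lemma is_val_ex (W : opens X) (s : 'O_X (W)) : exists r, is_val s r.
Proof.
have [[x Wx]|W0] := pselect (exists x, open_set W x); last first.
  by exists 0 => sigma p Wp; case: W0; exists (tpt p).
have [sigma [p xE]] := tpt_surj x; subst x.
have [r rE] := spec_val (mor_sec (toric_chart sigma) W s).
exists r => tau q Wq; have [r' rE'] := spec_val (mor_sec (toric_chart tau) W s).
suff -> : r = r' by exact: rE'.
(* The generic points of two charts are both images of that of their overlap, so the values found in
   the two charts can be compared there. *)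
have gl : face_l sigma tau (generic_prime (sigma `&` tau)) =
    generic_prime sigma by exact: prime_ideal_ext.
have gr : face_r sigma tau (generic_prime (sigma `&` tau)) =
    generic_prime tau by exact: prime_ideal_ext.
have Wl : open_set W (tpt (face_l sigma tau (generic_prime (sigma `&` tau)) :
    prime_ideal (cone_ring sigma))).
  rewrite gl; apply: (@generic_in_open sigma (tpt (sigma := sigma) @^-1` W) p) => //.
  exact: (@mor_cont _ _ (toric_chart sigma) _ (openP W)).
have Wr : open_set W (tpt (face_r sigma tau (generic_prime (sigma `&` tau)) :
    prime_ideal (cone_ring tau))).
  by rewrite tpt_face.
have := section_compat s Wl Wr.
have /stalk_val_face hl := rE _ Wl; have /stalk_val_face hr := rE' _ Wr.
by move=> e; rewrite e in hl; exact: stalk_val_fun hl hr.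
Qed.

Lemma is_val_fun (W : opens X) (s : 'O_X (W)) r r' x :
  open_set W x -> is_val s r -> is_val s r' -> r = r'.
Proof.
have [sigma [p ->]] := tpt_surj x => Wp sr sr'.
exact: stalk_val_fun (sr _ _ Wp) (sr' _ _ Wp).
Qed.

Lemma is_val_inj (W : opens X) (s s' : 'O_X (W)) r :
  is_val s r -> is_val s' r -> s = s'.
Proof.
move=> sr sr'; apply: val_inj; apply: functional_extensionality_dep => sigma.
suff e : mor_sec (toric_chart sigma) W s = mor_sec (toric_chart sigma) W s' by exact: e.
by apply: spec_ext => p Wp; exact: stalk_val_inj (sr _ _ Wp) (sr' _ _ Wp).
Qed.

Lemma is_val_loc (W : opens X) (s : 'O_X (W)) r x :
  is_val s r -> open_set W x -> loc_at x r.
Proof.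
have [sigma [p ->]] := tpt_surj x => sr Wp; apply/loc_atP.
exact: stalk_val_loc (sr _ _ Wp).
Qed.

Lemma is_valM (W : opens X) (s s' : 'O_X (W)) r r' :
  is_val s r -> is_val s' r' -> is_val (s * s') (r * r').
Proof.
move=> sr sr' sigma p Wp; rewrite rmorphM spec_atM.
exact: stalk_valM (sr _ _ Wp) (sr' _ _ Wp).
Qed.

Lemma is_valB (W : opens X) (s s' : 'O_X (W)) r r' :
  is_val s r -> is_val s' r' -> is_val (s - s') (r - r').
Proof.
move=> sr sr' sigma p Wp; rewrite rmorphB spec_atB.
exact: stalk_valD (sr _ _ Wp) (stalk_valN (sr' _ _ Wp)).
Qed.

Lemma is_val1 (W : opens X) : is_val (1 : 'O_X (W)) 1.
Proof.
move=> sigma p Wp; rewrite rmorph1 spec_at1; exact: stalk_val1.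
Qed.

Lemma is_val_res (W W' : opens X) (sub : W' `<=` W) (s : 'O_X (W)) r :
  is_val s r -> is_val (rs_res sub s) r.
Proof.
move=> sr sigma p Wp.
have sub' : mor_pre (toric_chart sigma) W' `<=` mor_pre (toric_chart sigma) W.
  by move=> q; exact: sub.
rewrite (mor_sec_res _ sub') (spec_at_res _ _ _ (sub' _ Wp)); exact: sr.
Qed.

(** * Open sets of the toric variety, and the scheme property *)

Lemma open_toricP (W : set X) :
  (forall sigma : fan_cone R, open [set p : prime_ideal (cone_ring sigma) | W (tpt p)]) ->
  open W.
Proof. by move=> h; apply/sigT_openP => sigma; exact: h. Qed.

Lemma open_toric_pre (W : set X) (sigma : fan_cone R) : open W ->
  open [set p : prime_ideal (cone_ring sigma) | W (tpt p)].
Proof. by move=> oW; exact: (@mor_cont _ _ (toric_chart sigma) _ oW). Qed.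

Lemma open_loc (r : F) : open [set x : X | loc_at x r].
Proof.
apply: open_toricP => sigma; apply: zariski_nbhd => p /loc_atP[a [b [pb rE]]].
by exists b => // q qb; apply/loc_atP; exists a, b.
Qed.

Definition open_at (r : F) : opens X := Opens (@open_loc r).

Lemma loc_atM x r s : loc_at x r -> loc_at x s -> loc_at x (r * s).
Proof.
by have [sigma [p ->]] := tpt_surj x; rewrite !loc_atP; exact: locM.
Qed.

Lemma loc_atX x r n : loc_at x r -> loc_at x (r ^+ n).
Proof.
by have [sigma [p ->]] := tpt_surj x; rewrite !loc_atP; exact: loc_exp.
Qed.

Lemma loc_at_ring (sigma : fan_cone R) (p : prime_ideal (cone_ring sigma)) g :
  supported_in (dual_points sigma) g -> loc_at (tpt p) (emb g).
Proof. by move=> hg; apply/loc_atP; exact: (loc_emb p (ring_elt hg)). Qed.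

Lemma emb_charMn u n : emb (character (u *+ n)) = emb (character u) ^+ n.
Proof.
elim: n => [|n IH]; first exact: rmorph1.
by rewrite exprS -IH -embM -characterD mulrS.
Qed.

Lemma emb_charN u : emb (character (- u)) * emb (character u) = 1.
Proof. by rewrite -rmorphM -characterD addNr character0 rmorph1. Qed.

Lemma loc_at_cone (sigma tau : fan_cone R) u : dual_points sigma u ->
  dual_points tau (- u) ->
  (forall w, dual_points (sigma `&` tau) w -> exists n, dual_points sigma (w + u *+ n)) ->
  forall p : prime_ideal (cone_ring sigma), loc_at (tpt p) (emb (character (- u))) ->
  exists q : prime_ideal (cone_ring tau), tpt p = tpt q.
Proof.
move=> su tu hu p pu; apply: loc_at_chart => g hg.
have [|n /(_ n (leqnn n)) gn] := clear_denominators su _ hg.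
  by move=> w tw; apply: hu => v [_]; exact: tw.
have -> : emb g = emb (g * character (u *+ n)) * emb (character (- u)) ^+ n.
  by rewrite embM emb_charMn -mulrA -exprMn [X in X ^+ _]mulrC emb_charN expr1n mulr1.
by apply: loc_atM; [exact: loc_at_ring|exact: loc_atX].
Qed.

(** Inside the chart of [sigma], the chart of [tau] is the locus where the character of the
    separating point [u] is invertible. *)
Lemma open_chart (tau : fan_cone R) :
  open [set x : X | exists q : prime_ideal (cone_ring tau), x = tpt q].
Proof.
apply: open_toricP => sigma; apply: zariski_nbhd => p [q pq].
have [u [su tu hu]] := cone_separation hR sigma tau.
have cE : ev (ring_char su) = emb (character u) by [].
exists (ring_char su).
  apply/lunit_embP; rewrite cE; exists (emb (character (- u))).
    apply/loc_atP; rewrite pq; apply: loc_at_ring; exact: monomial_supp.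
  exact: emb_charN.
move=> p' /lunit_embP[t lt tc]; apply: (loc_at_cone su tu hu).
suff -> : emb (character (- u)) = t by apply/loc_atP.
exact: inverse_uniq (emb_charN u) tc.
Qed.

Definition lunit_at (x : X) r := exists2 t, loc_at x t & t * r = 1.

Lemma lunit_atP (sigma : fan_cone R) (p : prime_ideal (cone_ring sigma)) r :
  lunit_at (tpt p) r <-> lunit p r.
Proof. by split=> -[t /loc_atP lt tr]; exists t. Qed.

Lemma lunit_at_inv x r t : t * r = 1 -> lunit_at x r -> loc_at x t.
Proof.
by move=> tr [t' lt' t'r]; rewrite (inverse_uniq tr t'r).
Qed.

(** Near a point of [U] the image contains the part of the chart where the inverse of a suitable [b]
    is regular, and regularity of a fixed element of [F] is an open condition. *)
Lemma open_chart_image (tau : fan_cone R) (U : set (prime_ideal (cone_ring tau))) :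
  open U -> open ((@tpt tau) @` U).
Proof.
move=> oU; apply: open_local => _ [p Up <-].
have [b pb bU] := zariski_basis oU Up.
have [i lub ib] : lunit p (ev b) by apply/lunit_embP.
exists ([set x : X | exists q : prime_ideal (cone_ring tau), x = tpt q] `&`
        [set x | loc_at x i]); split.
- by apply: openI; [exact: open_chart|exact: open_loc].
- by split; [exists p|apply/loc_atP].
- move=> _ [[q ->] /loc_atP lq]; exists q => //; apply: bU.
  by apply/lunit_embP; exists i.
Qed.

(** The germs are determined by [r], and a fraction that represents [r] at one point represents it
    wherever the denominator is outside the prime, so the germs are locally fractions. *)
Lemma section_exists (W : opens X) r : (forall x, open_set W x -> loc_at x r) ->
  exists s : 'O_X (W), is_val s r.
Proof.
move=> hW.
have ex (sigma : fan_cone R) : exists s : 'O_(Spec (cone_ring sigma)) (glue_pre W sigma),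
    forall p (Wp : open_set (glue_pre W sigma) p), stalk_val (spec_at s Wp) r.
  have ex p (Wp : open_set (glue_pre W sigma) p) : exists z : local_ring p, stalk_val z r.
    have /loc_atP lr : loc_at (tpt (p : prime_ideal (cone_ring sigma))) r by exact: hW.
    exact: loc_stalk_val lr.
  have [p Wp|s sE] := @spec_section _ (glue_pre W sigma)
    (fun p Wp => sval (cid (ex p Wp))).
    have [a [b [pb [_ rE]]]] := svalP (cid (ex p Wp)).
    exists (basic_open b), a, b; split=> // q Wq qb; exists qb.
    apply: (stalk_val_inj (svalP (cid (ex q Wq)))); by exists a, b, qb.
  by exists s => p Wp; rewrite sE; exact: (svalP (cid (ex p Wp))).
pose s : dprod (fun sigma : fan_cone R =>
    'O_(Spec (cone_ring sigma)) (glue_pre W sigma)) := fun sigma => sval (cid (ex sigma)).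
have sP sigma p (Wp : open_set (glue_pre W sigma) p) : stalk_val (spec_at (s sigma) Wp) r.
  exact: (svalP (cid (ex sigma))).
have sc : subring_pred (compatible_subring W) s.
  apply/asboolP => sigma tau; apply: spec_ext => v Wv.
  rewrite (spec_at_res _ _ _ (glue_pre_sub Wv : open_set (mor_pre _ _) v)).
  rewrite (@spec_at_face _ _ _ (glue_pre W sigma) _ _ (glue_pre_sub Wv)).
  rewrite (@spec_at_face _ _ _ (glue_pre W tau) _ _ Wv).
  exact: (stalk_val_inj (stalk_val_face (sP sigma _ (glue_pre_sub Wv)))
                        (stalk_val_face (sP tau _ Wv))).
by exists (Subring sc) => sigma p Wp; exact: sP.
Qed.

Lemma generic_point_exists : (exists x : X, True) ->
  exists eta : X, forall (W : opens X) x, open_set W x -> open_set W eta.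
Proof.
move=> [x _]; have [sigma _] := tpt_surj x.
exists (tpt (generic_prime sigma)) => W y.
have [tau [q ->]] := tpt_surj y => Wq.
have gl : face_l sigma tau (generic_prime (sigma `&` tau)) =
    generic_prime sigma by exact: prime_ideal_ext.
have gr : face_r sigma tau (generic_prime (sigma `&` tau)) =
    generic_prime tau by exact: prime_ideal_ext.
rewrite -gl -tpt_face gr.
have oW := @open_toric_pre W tau (openP W).
exact: (generic_in_open oW Wq).
Qed.

Lemma section_eq (W : opens X) (s s' : 'O_X (W)) :
  (forall x r r', open_set W x -> is_val s r -> is_val s' r' -> r = r') -> s = s'.
Proof.
move=> h; have [r sr] := is_val_ex s; have [r' sr'] := is_val_ex s'.
have [[x Wx]|W0] := pselect (exists x, open_set W x).
  by have e := h x r r' Wx sr sr'; subst r'; exact: is_val_inj sr sr'.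
have s0 (t : 'O_X (W)) : is_val t 0 by move=> sigma p Wp; case: W0; exists (tpt p).
exact: is_val_inj (s0 s) (s0 s').
Qed.

(** Any two nonempty open sets share the generic point, so all [s i] over nonempty members of the
    cover have the same value. Gluing amounts to the existence of a section with that value. *)
Lemma toric_sheaf : is_sheaf X.
Proof.
move=> I U s hs.
have [r rE] := choice (fun i => is_val_ex (s i)).
have rr i j x y : open_set (U i) x -> open_set (U j) y -> r i = r j.
  move=> Ux Uy; have [|eta heta] := generic_point_exists; first by exists x.
  have e : open_set (opens_setI (U i) (U j)) eta.
    by split; [exact: heta Ux|exact: heta Uy].
  apply: (is_val_fun e (is_val_res (@opens_setIl _ _ _) (rE i))).
  rewrite hs; exact: is_val_res (rE j).
have [r0 r0E] : exists r0, forall i x, open_set (U i) x -> r i = r0.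
  have [[i [x Ux]]|none] := pselect (exists i x, open_set (U i) x).
    by exists (r i) => j y Uy; exact: rr Uy Ux.
  by exists 0 => i x Ux; case: none; exists i, x.
have [x [i _ Ux]|t tr] := @section_exists (opens_bigcup U) r0.
  by rewrite -(r0E i x Ux); exact: is_val_loc (rE i) Ux.
exists t; split=> [i|t' t'E].
  apply: section_eq => x q q' Ux qE q'E.
  rewrite (is_val_fun Ux q'E (rE i)) (r0E i x Ux).
  exact: (is_val_fun Ux qE (is_val_res _ tr)).
apply: section_eq => x q q' [i _ Ux] qE q'E.
have := is_val_res (@opens_bigcup_sup _ _ U i) q'E; rewrite t'E => h.
rewrite (is_val_fun Ux h (rE i)) (r0E i x Ux).
have Wx : open_set (opens_bigcup U) x by exists i.
exact: is_val_fun Wx qE tr.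
Qed.

Lemma chart_open_immersion (sigma : fan_cone R) : open_immersion (toric_chart sigma).
Proof.
split.
- by move=> p q pq; apply: loc_inj; exact: (tpt_loc pq).
- exact: open_chart_image.
- move=> V Vr.
  have inj : injective (mor_sec (toric_chart sigma) V).
    move=> s s' ss'; apply: section_eq => x r r' Vx sr sr'.
    have [p _ xp] := Vr x Vx; subst x.
    have h := sr sigma p Vx; have h' := sr' sigma p Vx.
    by rewrite ss' in h; exact: stalk_val_fun h h'.
  have surj t : exists s, mor_sec (toric_chart sigma) V s = t.
    have [r rE] := spec_val t.
    have [x Vx|s sr] := @section_exists V r.
      have [p _ xp] := Vr x Vx; subst x; apply/loc_atP.
      exact: stalk_val_loc (rE p Vx).
    exists s; apply: spec_ext => p Vp.
    exact: stalk_val_inj (sr sigma p Vp) (rE p Vp).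
  have [g gK] := choice surj.
  by exists g => // s; apply: inj.
Qed.

Lemma toric_scheme : is_scheme X.
Proof.
split; first exact: toric_sheaf.
move=> x; have [sigma [p ->]] := tpt_surj x.
exists (cone_ring sigma), (toric_chart sigma); split; first exact: chart_open_immersion.
by exists p.
Qed.

Lemma germ_unit_valP (W : opens X) (s : 'O_X (W)) r x : open_set W x -> is_val s r ->
  germ_unit s x <-> lunit_at x r.
Proof.
move=> Wx sr; split=> [[V [VW [t [Vx st]]]]|[r' lr' rr']].
  have [r' tr'] := is_val_ex t; exists r'; first exact: is_val_loc tr' Vx.
  have := is_valM (is_val_res VW sr) tr'; rewrite st => h.
  rewrite mulrC; apply: (is_val_fun Vx h); exact: is_val1.
pose V := opens_setI W (open_at r').
have [y [] //|t tr'] := @section_exists V r'.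
exists V, (@opens_setIl _ _ _), t; split; first by split.
apply: (is_val_inj (is_valM (is_val_res _ sr) tr')).
by rewrite mulrC rr'; exact: is_val1.
Qed.

Lemma group_ring_domain (g h : ZM) : g * h = 0 -> g = 0 \/ h = 0.
Proof.
move=> gh; have [->|g0] := pselect (g = 0); [by left|right].
have [i ig] := emb_inv g0; apply: emb_inj; rewrite rmorph0.
by rewrite -[LHS]mul1r -ig -mulrA -rmorphM gh rmorph0 mulr0.
Qed.

Lemma spec_at_torus (W : opens X) (s : 'O_X (W)) (sigma : fan_cone R)
    (q : prime_ideal ZM)
    (Wq : open_set (mor_pre (torus_map sigma) W) q)
    (Wp : open_set W (tpt (prime_preimage (subring_incl (cone_ring_subring sigma)) q))) :
  @spec_at _ (mor_pre (torus_map sigma) W) (mor_sec (torus_map sigma) W s) q Wq =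
  local_map (@spec_at _ (mor_pre (toric_chart sigma) W) (mor_sec (toric_chart sigma) W s)
    (prime_preimage (subring_incl (cone_ring_subring sigma)) q) Wp).
Proof. exact: spec_at_map. Qed.

(** Agreement on the torus is tested at its generic point, which maps to the generic point of the
    chart. Conversely, a fraction with the value of a character satisfies the cross-multiplied
    identity in the group ring already, because [emb] is injective. *)
Lemma equals_characterP (W : opens X) (s : 'O_X (W)) u :
  equals_character s u <-> is_val s (emb (character u)).
Proof.
split=> [h|h sigma].
  have [r sr] := is_val_ex s.
  have [[x Wx]|W0] := pselect (exists x, open_set W x); last first.
    by move=> sigma p Wp; case: W0; exists (tpt p).
  suff <- : r = emb (character u) by [].
  have [sigma [p0 xE]] := tpt_surj x; subst x.
  pose q := zero_prime group_ring_domain.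
  have qg : prime_preimage (subring_incl (cone_ring_subring sigma)) q = generic_prime sigma.
    apply: prime_ideal_ext => a; rewrite generic_primeP /=; split=> [a0|->].
      by apply: ring_val_inj; rewrite subring_val0.
    exact: subring_val0.
  have Wq : open_set W (tpt (prime_preimage (subring_incl (cone_ring_subring sigma)) q)).
    have oW := @open_toric_pre W sigma (openP W).
    by rewrite qg; exact: (generic_in_open oW Wx).
  have := congr1 (fun t => @spec_at _ (mor_pre (torus_map sigma) W) t q Wq) (h sigma).
  rewrite (spec_at_torus _ _ Wq).
  have [a [b [pb [-> rE]]]] := sr sigma _ Wq.
  rewrite local_mapE => /to_localP[c [/= c0]].
  rewrite mulr1 => /eqP; rewrite -subr_eq0 -mulrBr => /eqP/group_ring_domain[//|/eqP].
  rewrite subr_eq0 => /eqP e; apply: (emb_cancel pb).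
  rewrite rE -[ev b]/(emb (subring_val b)) -rmorphM -e.
  by [].
apply: spec_ext => q Wq; rewrite (spec_at_torus _ _ Wq).
have [a [b [pb [-> rE]]]] := h sigma _ Wq.
rewrite local_mapE; apply/to_localP; exists 1; split; first exact: prime1.
move: rE; rewrite -[ev b]/(emb (subring_val b)) -rmorphM => /emb_inj e.
exact: (congr1 ( *%R 1) (etrans (mulr1 _) (esym e))).
Qed.

Lemma regular_atP x u : regular_at x u <-> loc_at x (emb (character u)).
Proof.
split=> [[W [s [Wx /equals_characterP/is_val_loc]]]|h]; first exact.
have [//|s sr] := @section_exists (open_at (emb (character u))) (emb (character u)).
by exists (open_at (emb (character u))), s; split=> //; apply/equals_characterP.
Qed.

Lemma root_elt_opp (a b : R) : val b = - val a -> root_elt b = - root_elt a.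
Proof. by move=> e; apply: lattice_val_inj; rewrite lattice_valN. Qed.

Lemma root_elt_add (a b c : R) : val c = val a + val b ->
  root_elt c = root_elt a + root_elt b.
Proof. by move=> e; apply: lattice_val_inj; rewrite lattice_valD. Qed.

Lemma emb_charV (a b : R) : val b = - val a ->
  emb (character (root_elt b)) * emb (character (root_elt a)) = 1.
Proof. by move=> /root_elt_opp ->; exact: emb_charN. Qed.

Lemma emb_charD (a b c : R) : val c = val a + val b ->
  emb (character (root_elt c)) =
  emb (character (root_elt a)) * emb (character (root_elt b)).
Proof. by move=> /root_elt_add ->; rewrite characterD embM. Qed.

(** Each condition becomes a statement on characters in [F]: sections with equal values are equal,
    and a character is invertible at a point exactly when its inverse is regular there. The covering
    condition is [cone_dual_total]. *)
Lemma universal_data_exists : exists u : root_data R X, is_universal u.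
Proof.
pose U (a : R) := open_at (emb (character (root_elt a))).
have UP a x : open_set (U a) x <-> loc_at x (emb (character (root_elt a))) by [].
have ex a : exists s : 'O_X (U a), is_val s (emb (character (root_elt a))).
  by apply: section_exists.
pose f a := sval (cid (ex a)).
have fP a : is_val (f a) (emb (character (root_elt a))) := svalP (cid (ex a)).
have cov (a b : R) : val b = - val a -> open_set (U a) `|` open_set (U b) = [set: X].
  move=> ab; apply/seteqP; split=> // x _; have [sigma [p ->]] := tpt_surj x.
  have [h|h] := cone_dual_total hR sigma (valP a); [left|right].
    by rewrite /U /= root_eltE; apply: loc_at_ring; exact: monomial_supp.
  rewrite /U /= (root_elt_opp ab) root_eltE.
  by apply: loc_at_ring; exact: monomial_supp.
have nv (a b : R) : val b = - val a ->
    nonvanishing (f a) = open_set (U a) `&` open_set (U b).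
  move=> ab; have e := emb_charV ab.
  have gP x (Ux : open_set (U a) x) : germ_unit (f a) x <->
    lunit_at x (emb (character (root_elt a))) := germ_unit_valP Ux (fP a).
  apply/seteqP; split=> x [Ux].
    move=> /(gP x Ux) ux; split; first exact: Ux.
    by apply/UP; exact: lunit_at_inv e ux.
  move=> /UP Vx; split; first exact: Ux.
  by apply: (gP x Ux).2; exists (emb (character (root_elt b))).
have inv (a b : R) : val b = - val a ->
    rs_res (@opens_setIl _ (U a) (U b)) (f a) *
    rs_res (@opens_setIr _ (U a) (U b)) (f b) = 1.
  move=> ab; apply: is_val_inj (is_valM (is_val_res _ (fP a)) (is_val_res _ (fP b))) _.
  rewrite mulrC emb_charV //; exact: is_val1.
have sub (a b c : R) : val c = val a + val b -> opens_setI (U a) (U b) `<=` U c.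
  move=> abc x [/UP Ux /UP Vx]; apply/UP; rewrite (emb_charD abc); exact: loc_atM.
have add (a b c : R) (abc : val c = val a + val b) :
    rs_res (@opens_setIl _ (U a) (U b)) (f a) *
    rs_res (@opens_setIr _ (U a) (U b)) (f b) =
    rs_res (sub _ _ _ abc) (f c).
  apply: is_val_inj (is_valM (is_val_res _ (fP a)) (is_val_res _ (fP b))) _.
  by rewrite -(emb_charD abc); exact: is_val_res.
exists (RootData cov nv inv add) => a; split=> /=.
  by apply/seteqP; split=> x /=; rewrite regular_atP.
by apply/equals_characterP; exact: fP.
Qed.

Section UniversalData.
Context (u : root_data R X) (hu : is_universal u).

Lemma universal_openP a x :
  open_set (data_open u a) x <-> loc_at x (emb (character (root_elt a))).
Proof. by rewrite (hu a).1 /= regular_atP. Qed.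

Lemma universal_val a : is_val (data_fun u a) (emb (character (root_elt a))).
Proof. by apply/equals_characterP; exact: (hu a).2. Qed.
End UniversalData.

Lemma universal_data_unique (u u' : root_data R X) :
  is_universal u -> is_universal u' -> u = u'.
Proof.
move=> hu hu'; apply: root_data_ext => [a|a V VD VD'].
  by rewrite (hu a).1 (hu' a).1.
have h := is_val_res VD (@universal_val u hu a).
have h' := is_val_res VD' (@universal_val u' hu' a).
exact: is_val_inj h h'.
Qed.

(** * The point and the stalk map attached to values in a local ring *)

Section StalkData.
Context (L : comPzRingType) (P : E -> Prop) (e : E -> L).
Context (L0 : ~ unit_in (0 : L)).
Context (LD : forall a b : L, unit_in (a + b) -> unit_in a \/ unit_in b).
Context (Ptot : forall a, a \in R -> P a \/ P (- a)).
Context (Padd : forall a b, a \in R -> b \in R -> a + b \in R -> P a -> P b ->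
  P (a + b) /\ e (a + b) = e a * e b).
Context (Pinv : forall a, a \in R -> P a -> P (- a) -> e a * e (- a) = 1).
Context (Punit : forall a, a \in R -> P a -> unit_in (e a) -> P (- a)).

(** Here [c] is the product of the values along some expression of [w] as a sum of roots in [P]. It
    is a relation because [w] has many such expressions; [good_fun] shows that they all give the
    same [c]. *)
Inductive good : M -> L -> Prop :=
| good0 : good 0 1
| goodS a w c : a \in R -> P a -> good w c -> good (rootl R a + w) (e a * c).

Lemma good_root a : a \in R -> P a -> good (rootl R a) (e a).
Proof.
by move=> aR Pa; rewrite -[rootl R a]addr0 -[e a]mulr1; apply: goodS => //; exact: good0.
Qed.

Lemma goodD w c w' c' : good w c -> good w' c' -> good (w + w') (c * c').
Proof.
move=> g g'; elim: g => [|a {}w {}c aR Pa _ IH]; first by rewrite add0r mul1r.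
by rewrite -addrA -mulrA; exact: goodS.
Qed.

Section Base.
Context (S : {fset E}) (hS : is_simple_roots R S) (PS : forall s, s \in S -> P s).

Definition base_monomial (n : E -> nat) : L := \prod_(s <- S) e s ^+ n s.

Lemma base_monomialD n m :
  base_monomial (fun s => n s + m s)%N = base_monomial n * base_monomial m.
Proof.
by rewrite /base_monomial -big_split /=; apply: eq_bigr => s _; rewrite exprD.
Qed.

Lemma eq_base_monomial n m : (forall s, s \in S -> n s = m s) ->
  base_monomial n = base_monomial m.
Proof.
move=> nm; rewrite /base_monomial big_seq [RHS]big_seq.
by apply: eq_bigr => s /nm ->.
Qed.

(** Adding a simple root to a positive root is an instance of [Padd], so membership in [P] and the
    value both propagate from the simple roots by [pos_root_ind]. *)
Lemma pos_root_monomial a : a \in R -> nonneg_comb S a ->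
  P a /\ forall n : E -> nat, a = \sum_(s <- S) s *+ n s -> e a = base_monomial n.
Proof.
have delta s : s \in S -> s = \sum_(t <- S) t *+ (t == s) /\
    e s = base_monomial (fun t => t == s).
  move=> sS; rewrite /base_monomial (big_fsetD1 s) //=.
  rewrite [X in _ /\ _ = X](big_fsetD1 s) //=.
  rewrite !eqxx mulr1n expr1 !big1_fset ?addr0 ?mulr1 // => t;
    by rewrite !inE => /andP[/negPf-> _] _; rewrite ?mulr0n ?expr0.
move: a; apply: (pos_root_ind hR hS) => [s sS|b s bR [m bE] sS bsR [Pb eb]].
  split=> [|n sE]; first exact: PS.
  have [dE ->] := delta s sS; apply: eq_base_monomial.
  by apply: (base_coef_eq hS); rewrite -dE.
have [Pbs ->] := Padd bR (base_sub hS sS) bsR Pb (PS sS); split=> // n bsE.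
have [dE ->] := delta s sS; rewrite (eb m bE) -base_monomialD.
apply: eq_base_monomial; apply: (base_coef_eq hS); rewrite -bsE.
transitivity (\sum_(t <- S) t *+ m t + \sum_(t <- S) t *+ (t == s)).
  by rewrite -big_split /=; apply: eq_bigr => t _; rewrite mulrnDr.
by rewrite -bE -dE.
Qed.

(* A negative root in [P] has an invertible value, so every value becomes a
   monomial in the simple roots after multiplication by an invertible one; the
   exponents are then determined by freeness of the base. *)
Lemma good_monomial w c : good w c -> exists a b : E -> nat,
  [/\ lattice_val w = \sum_(s <- S) s *+ a s - \sum_(s <- S) s *+ b s,
      c * base_monomial b = base_monomial a & unit_in (base_monomial b)].
Proof.
have sumD (n m : E -> nat) :
    \sum_(s <- S) s *+ (n s + m s)%N = \sum_(s <- S) s *+ n s + \sum_(s <- S) s *+ m s.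
  by rewrite -big_split /=; apply: eq_bigr => s _; rewrite mulrnDr.
elim=> [|x {}w {}c xR Px _ [a [b [wE cE ub]]]].
  exists (fun=> 0)%N, (fun=> 0)%N; split; first by rewrite subrr.
  - by rewrite mul1r.
  - have -> : base_monomial (fun=> 0)%N = 1 by rewrite /base_monomial big1.
    exact: unit_in1.
have [_ _ /(_ x xR)[n nE]] := hS.
have [xpos|xneg] : nonneg_comb S x \/ nonneg_comb S (- x).
- by case: nE => nE; [left|right]; exists n; rewrite // nE opprK.
- have {n nE} [n nE] := xpos; have [_ /(_ n nE) ex] := pos_root_monomial xR xpos.
  exists (fun s => n s + a s)%N, b; split=> //.
    by rewrite lattice_valD rootlK // wE {1}nE sumD addrA.
  by rewrite base_monomialD -cE ex mulrA.
- have nxR := root_opp hR xR.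
  have {n nE} [n nE] := xneg; have [Pnx /(_ n nE) ex] := pos_root_monomial nxR xneg.
  have inv := Pinv xR Px Pnx.
  exists a, (fun s => n s + b s)%N; split.
  + by rewrite lattice_valD rootlK // wE sumD -nE opprD opprK addrCA.
  + by rewrite base_monomialD -ex mulrACA inv mul1r.
  + rewrite base_monomialD; apply/unit_inM; split=> //.
    by rewrite -ex; exists (e x); rewrite mulrC.
Qed.

Lemma good_fun_base w c c' : good w c -> good w c' -> c = c'.
Proof.
move=> /good_monomial[a [b [wE cE [i ib]]]] /good_monomial[a' [b' [wE' cE' [i' ib']]]].
have h : base_monomial a * base_monomial b' = base_monomial a' * base_monomial b.
  rewrite -!base_monomialD; apply: eq_base_monomial; apply: (base_coef_eq hS).
  have sumD (n m : E -> nat) :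
      \sum_(s <- S) s *+ (n s + m s)%N = \sum_(s <- S) s *+ n s + \sum_(s <- S) s *+ m s.
    by rewrite -big_split /=; apply: eq_bigr => s _; rewrite mulrnDr.
  rewrite !sumD; apply/eqP; rewrite -subr_eq addrAC -wE wE' subrK; exact/eqP.
exact: cancel_units ib ib' cE cE' h.
Qed.
End Base.

Lemma good_fun w c c' : good w c -> good w c' -> c = c'.
Proof.
by have [S [hS PS]] := parabolic_cone hR Ptot; exact: (good_fun_base hS PS).
Qed.

Definition good_lattice : set M := [set w | exists c, good w c].

Definition stalk_char (w : M) : L :=
  if pselect (good_lattice w) is left h then sval (cid h) else 0.

Lemma stalk_charE w c : good w c -> stalk_char w = c.
Proof.
move=> g; rewrite /stalk_char; case: pselect => [h|[]]; last by exists c.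
exact: good_fun (svalP (cid h)) g.
Qed.

Lemma stalk_charD v w : good_lattice v -> good_lattice w ->
  stalk_char (v + w) = stalk_char v * stalk_char w.
Proof.
by move=> [c g] [d h]; rewrite (stalk_charE g) (stalk_charE h); exact/stalk_charE/goodD.
Qed.

Definition psi (g : ZM) : L := gr_ext stalk_char g.

Lemma psiD g h : psi (g + h) = psi g + psi h. Proof. exact: gr_extD. Qed.
Lemma psi0 : psi 0 = 0. Proof. exact: gr_ext0. Qed.
Lemma psiN g : psi (- g) = - psi g.
Proof. by apply: (addrI (psi g)); rewrite -psiD !subrr psi0. Qed.
Lemma psiM g h : supported_in good_lattice g -> supported_in good_lattice h ->
  psi (g * h) = psi g * psi h.
Proof. by apply: gr_extM; exact: stalk_charD. Qed.
Lemma psi_monomial z w : psi (monomial z w) = z%:~R * stalk_char w.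
Proof. exact: gr_ext_monomial. Qed.
Lemma psi_char w c : good w c -> psi (character w) = c.
Proof. by move=> g; rewrite psi_monomial mul1r (stalk_charE g). Qed.
Lemma psi1 : psi 1 = 1. Proof. exact: psi_char good0. Qed.

(** The roots in the dual of a cone generate its monoid, so for an adapted cone [psi] is a
    homomorphism on the whole coordinate ring, and the desired point can be placed in that chart. *)
Definition adapted (sigma : fan_cone R) : Prop :=
  forall a, a \in R -> dual_points sigma (rootl R a) -> P a.

Lemma adapted_exists : exists sigma, adapted sigma.
Proof.
have [S [hS PS]] := parabolic_cone hR Ptot; exists (chamber_cone hS) => a aR ha.
by have [] := pos_root_monomial hS PS aR (chamber_dual_root aR ha).
Qed.

Lemma adapted_good sigma : adapted sigma -> dual_points sigma `<=` good_lattice.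
Proof.
move=> ad; apply: (cone_dual_ind hR) => [|v w [c g] [d h]|a aR ha].
- by exists 1; exact: good0.
- by exists (c * d); exact: goodD.
- by exists (e a); apply: good_root => //; exact: ad.
Qed.

Lemma adapted_supported sigma g : adapted sigma ->
  supported_in (dual_points sigma) g -> supported_in good_lattice g.
Proof. by move=> ad hg k /hg; exact: adapted_good. Qed.

Section StalkPrime.
Context (sigma : fan_cone R) (ad : adapted sigma).
Let U (a : cone_ring sigma) := unit_in (psi (subring_val a)).
Let supp (a : cone_ring sigma) : supported_in good_lattice (subring_val a) :=
  adapted_supported ad (@ring_eltP _ a).

Fact stalk_prime_unit1 : U 1.
Proof. by rewrite /U subring_val1 psi1; exact: unit_in1. Qed.
Fact stalk_prime_unit0 : ~ U 0.
Proof. by rewrite /U subring_val0 psi0. Qed.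
Fact stalk_prime_unitM a b : U (a * b) <-> U a /\ U b.
Proof. by rewrite /U subring_valM psiM ?unit_inM //; exact: supp. Qed.
Fact stalk_prime_unitD a b : U (a + b) -> U a \/ U b.
Proof. by rewrite /U subring_valD psiD; exact: LD. Qed.

Definition stalk_prime : prime_ideal (cone_ring sigma) :=
  nonunit_prime stalk_prime_unit1 stalk_prime_unit0 stalk_prime_unitM stalk_prime_unitD.

Lemma stalk_prime_out a : ~ prime_set stalk_prime a <-> unit_in (psi (subring_val a)).
Proof. by split=> [|ua]; [exact: contrapT|exact]. Qed.
End StalkPrime.

Lemma psi_char_unit w : good_lattice w -> good_lattice (- w) ->
  unit_in (psi (character w)).
Proof.
move=> [c g] [d h]; exists d; rewrite (psi_char g).
by rewrite -psi1 -character0 -(subrr w) (psi_char (goodD g h)).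
Qed.

(** Both [u] and [- u] lie in the monoid generated by [P], so [psi] sends the character of [u] to a
    unit. Multiplying numerator and denominator by a power of it moves a fraction from [sigma] to
    [tau]. *)
Lemma stalk_prime_loc_sub sigma tau (hs : adapted sigma) (ht : adapted tau) r :
  loc (stalk_prime hs) r -> loc (stalk_prime ht) r.
Proof.
move=> [a [b [/stalk_prime_out ub rE]]].
have [u [tu su hu]] := cone_separation hR tau sigma.
have hu' w : dual_points sigma w -> exists n, dual_points tau (w + u *+ n).
  by move=> sw; apply: hu => v [_]; exact: sw.
have [n an] := clear_denominators tu hu' (@ring_eltP _ a).
have [n' bn] := clear_denominators tu hu' (@ring_eltP _ b).
pose m := maxn n n'.
have am := an m (leq_maxl _ _); have bm := bn m (leq_maxr _ _).
have ea : ev (ring_elt am) = ev a * emb (character (u *+ m)) by exact: embM.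
have eb : ev (ring_elt bm) = ev b * emb (character (u *+ m)) by exact: embM.
exists (ring_elt am), (ring_elt bm); split; last by rewrite ea eb mulrA rE.
apply/stalk_prime_out.
have gu : good_lattice (u *+ m) by apply: (adapted_good ht); exact: dual_pointsMn.
have gu' : good_lattice (- (u *+ m)).
  by rewrite -mulNrn; apply: (adapted_good hs); exact: dual_pointsMn.
have -> : psi (subring_val (ring_elt bm)) =
    psi (subring_val b) * psi (character (u *+ m)).
  apply: psiM; first exact: (adapted_supported hs (@ring_eltP _ b)).
  exact: monomial_supp.
by apply/unit_inM; split=> //; exact: psi_char_unit.
Qed.

Lemma stalk_prime_indep sigma tau (hs : adapted sigma) (ht : adapted tau) :
  tpt (stalk_prime hs) = tpt (stalk_prime ht).
Proof.
by apply: loc_at_inj => r; rewrite !loc_atP; split; exact: stalk_prime_loc_sub.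
Qed.

Definition stalk_point : X := tpt (stalk_prime (svalP (cid adapted_exists))).

Lemma stalk_pointE sigma (hs : adapted sigma) : stalk_point = tpt (stalk_prime hs).
Proof. exact: stalk_prime_indep. Qed.

(** Numerator and denominator range over the span of the full monoid generated by [P], so the
    relation does not refer to a choice of adapted cone. *)
Definition stalk_map (r : F) (c : L) : Prop := exists a b : ZM,
  [/\ supported_in good_lattice a, supported_in good_lattice b, unit_in (psi b),
      r * emb b = emb a & c * psi b = psi a].

Lemma stalk_map_fun r c c' : stalk_map r c -> stalk_map r c' -> c = c'.
Proof.
move=> [a [b [ga gb [i ib] rE cE]]] [a' [b' [ga' gb' [i' ib'] rE' cE']]].
have h : psi a * psi b' = psi a' * psi b.
  have ab : a * b' = a' * b.
    apply: emb_inj; apply: (etrans (embM a b')); apply: (etrans _ (esym (embM a' b))).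
    by rewrite -rE -rE'; exact: mulrAC.
  by rewrite -(psiM ga gb') -(psiM ga' gb) ab.
exact: cancel_units ib ib' cE cE' h.
Qed.

Lemma supported_goodM a b : supported_in good_lattice a ->
  supported_in good_lattice b -> supported_in good_lattice (a * b).
Proof.
have [_ _ h] := @supported_in_subring M good_lattice (ex_intro _ 1 good0)
  (fun v w '(ex_intro c g) '(ex_intro d h) => ex_intro _ (c * d) (goodD g h)).
exact: h.
Qed.

Lemma supported_goodB a b : supported_in good_lattice a ->
  supported_in good_lattice b -> supported_in good_lattice (a - b).
Proof.
have [_ h _] := @supported_in_subring M good_lattice (ex_intro _ 1 good0)
  (fun v w '(ex_intro c g) '(ex_intro d h) => ex_intro _ (c * d) (goodD g h)).
exact: h.
Qed.

Lemma stalk_map_emb a : supported_in good_lattice a -> stalk_map (emb a) (psi a).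
Proof.
move=> ga; exists a, 1; rewrite psi1 rmorph1 !mulr1; split=> //.
  by apply: monomial_supp; exists 1; exact: good0.
exact: unit_in1.
Qed.

Lemma stalk_mapM r s c d : stalk_map r c -> stalk_map s d -> stalk_map (r * s) (c * d).
Proof.
move=> [a [b [ga gb ub rE cE]]] [a' [b' [ga' gb' ub' rE' cE']]].
have e1 := psiM ga ga'; have e2 := psiM gb gb'.
have f1 := embM a a'; have f2 := embM b b'.
have s1 := supported_goodM ga ga'; have s2 := supported_goodM gb gb'.
(* Otherwise unification unfolds the convolution product. *)
move: (a * a') (b * b') e1 e2 f1 f2 s1 s2 => x y e1 e2 f1 f2 s1 s2.
exists x, y; rewrite e1 e2 f1 f2; split=> //; [exact/unit_inM| |]; exact: cross_mul.
Qed.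

Lemma stalk_mapB r s c d : stalk_map r c -> stalk_map s d -> stalk_map (r - s) (c - d).
Proof.
move=> [a [b [ga gb ub rE cE]]] [a' [b' [ga' gb' ub' rE' cE']]].
have e1 := psiM ga gb'; have e2 := psiM ga' gb; have e3 := psiM gb gb'.
have f1 := embM a b'; have f2 := embM a' b; have f3 := embM b b'.
have s1 := supported_goodM ga gb'; have s2 := supported_goodM ga' gb.
have s3 := supported_goodM gb gb'.
move: (a * b') (a' * b) (b * b') e1 e2 e3 f1 f2 f3 s1 s2 s3.
move=> x y z e1 e2 e3 f1 f2 f3 s1 s2 s3.
have e4 : psi (x - y) = psi x - psi y by rewrite psiD psiN.
exists (x - y), z; split.
- exact: supported_goodB.
- exact: s3.
- by rewrite e3; exact/unit_inM.
- rewrite (rmorphB emb x y) f1 f2 f3; exact: cross_sub.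
- rewrite e4 e1 e2 e3; exact: cross_sub.
Qed.

Lemma stalk_map1 : stalk_map 1 1.
Proof.
rewrite -psi1 -[X in stalk_map X](rmorph1 emb); apply: stalk_map_emb.
by apply: monomial_supp; exists 1; exact: good0.
Qed.

Lemma stalk_map_root a : a \in R -> P a ->
  stalk_map (emb (character (rootl R a))) (e a).
Proof.
move=> aR Pa; have g := good_root aR Pa; rewrite -(psi_char g); apply: stalk_map_emb.
by apply: monomial_supp; exists (e a).
Qed.

Lemma stalk_map_loc sigma (hs : adapted sigma) r : loc (stalk_prime hs) r ->
  exists a b : cone_ring sigma,
    [/\ unit_in (psi (subring_val b)), r * ev b = ev a & forall c,
        stalk_map r c <-> c * psi (subring_val b) = psi (subring_val a)].
Proof.
move=> [a [b [/stalk_prime_out ub rE]]]; exists a, b; split=> // c.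
have ga := adapted_supported hs (@ring_eltP _ a).
have gb := adapted_supported hs (@ring_eltP _ b).
have rb d : d * psi (subring_val b) = psi (subring_val a) -> stalk_map r d.
  by move=> dE; exists (subring_val a), (subring_val b).
split=> [rc|]; last exact: rb.
have [i ib] := ub.
have h : psi (subring_val a) * i * psi (subring_val b) = psi (subring_val a).
  by rewrite -mulrA [i * _]mulrC ib mulr1.
by rewrite (stalk_map_fun rc (rb _ h)).
Qed.

Lemma stalk_map_local r c : loc_at stalk_point r -> stalk_map r c -> unit_in c ->
  lunit_at stalk_point r.
Proof.
move=> /loc_atP/stalk_map_loc[a [b [ub rE h]]] /h cE uc; apply/lunit_atP.
have pb := (stalk_prime_out (svalP (cid adapted_exists)) b).2 ub.
apply/(frac_lunit pb rE)/stalk_prime_out; rewrite -cE; exact/unit_inM.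
Qed.

(** If [- a] lies in the dual of the chosen cone, then [- a] is in [P], and regularity of the
    character of [a] makes [e (- a)] a unit; [Punit] then gives [P a]. This is where the
    nonvanishing condition on R-data enters. *)
Lemma stalk_point_root a : a \in R ->
  loc_at stalk_point (emb (character (rootl R a))) <-> P a.
Proof.
move=> aR; have naR := root_opp hR aR; rewrite /stalk_point.
move: (svalP (cid adapted_exists)); set sigma := sval _ => hs.
have [sa|sa] := cone_dual_total hR sigma aR.
  split=> _; first exact: hs aR sa.
  by apply: loc_at_ring; exact: monomial_supp.
have Pna : P (- a) by apply: hs => //; rewrite (rootN_l hR).
have gna := good_root naR Pna.
have cE : psi (subring_val (ring_char sa)) = e (- a).
  by rewrite -(psi_char gna) (rootN_l hR).
have inv : emb (character (rootl R a)) * ev (ring_char sa) = 1.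
  by rewrite mulrC; exact: emb_charN.
split=> [/loc_atP la|Pa].
  rewrite -[a]opprK; apply: Punit => //; rewrite -cE; apply/stalk_prime_out/lunit_embP.
  by exists (emb (character (rootl R a))).
apply/loc_atP; have : lunit (stalk_prime hs) (ev (ring_char sa)).
  apply/lunit_embP/stalk_prime_out; rewrite cE; exists (e a).
  by rewrite mulrC; exact: Pinv.
by move=> [t lt tE]; rewrite (inverse_uniq inv tE).
Qed.

Section Uniqueness.
(* [th r c] stands for: a section with value [r] near [x] pulls back to one with
   germ [c]. *)
Context (x : X) (th : F -> L -> Prop).
Context (th_ex : forall r, loc_at x r -> exists c, th r c).
Context (th_fun : forall r c c', th r c -> th r c' -> c = c').
Context (thM : forall r s c d, th r c -> th s d -> th (r * s) (c * d)).
Context (thB : forall r s c d, th r c -> th s d -> th (r - s) (c - d)).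
Context (th1 : th 1 1).
Context (th_local : forall r c, loc_at x r -> th r c -> unit_in c -> lunit_at x r).
Context (x_root : forall a, a \in R -> loc_at x (emb (character (rootl R a))) -> P a).
Context (th_root : forall a, a \in R -> P a -> th (emb (character (rootl R a))) (e a)).

Lemma th_good w c : good w c -> th (emb (character w)) c.
Proof.
elim=> [|a {}w {}c aR Pa _ IH]; first by rewrite character0 rmorph1.
by rewrite characterD embM; apply: thM => //; exact: th_root.
Qed.

Lemma th_psi g : supported_in good_lattice g -> th (emb g) (psi g).
Proof.
have th0 : th 0 0 by rewrite -(subrr 1) -[X in th _ X](subrr 1); exact: thB.
have thN r c : th r c -> th (- r) (- c).
  by move=> h; rewrite -sub0r -[- c]sub0r; exact: thB.
have thD r s c d : th r c -> th s d -> th (r + s) (c + d).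
  by move=> h /thN h'; rewrite -[s]opprK -[d]opprK; exact: thB.
elim/supported_ind => [|a b ha hb|z w [c gw]].
- by rewrite rmorph0 psi0.
- by rewrite rmorphD psiD; exact: thD.
have thz : th z%:~R z%:~R.
  have nat n : th n%:R n%:R by elim: n => // n IH; rewrite !mulrS; exact: thD.
  by case: z => n; rewrite ?NegzE ?rmorphN; [exact: nat|apply: thN; exact: nat].
rewrite psi_monomial (stalk_charE gw).
have -> : emb (monomial z w) = z%:~R * emb (character w).
  by rewrite monomial_int; apply: (etrans (embM _ _)); rewrite rmorph_int.
by apply: thM => //; exact: th_good.
Qed.

(** A chart containing [x] is adapted by [x_root], and [th] agrees with [psi] on its ring.
    Invertibility at [x] and in [L] correspond, one way by multiplicativity and the other by
    [th_local], which determines the prime of [x]. *)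
Lemma stalk_point_unique : x = stalk_point /\
  forall r c, loc_at x r -> th r c -> stalk_map r c.
Proof.
have [sigma [p xE]] := tpt_surj x.
have ad : adapted sigma.
  move=> a aR ha; apply: x_root => //; rewrite xE.
  by apply: loc_at_ring; exact: monomial_supp.
have th_ev (a : cone_ring sigma) : th (ev a) (psi (subring_val a)).
  exact: th_psi (adapted_supported ad (@ring_eltP _ a)).
have unitP (a : cone_ring sigma) : ~ prime_set p a <-> unit_in (psi (subring_val a)).
  rewrite -(lunit_embP p a) -lunit_atP -xE; split=> [[t lt ta]|ua].
    have [d td] := th_ex lt; exists d.
    by apply: th_fun th1; rewrite -ta mulrC; exact: thM.
  apply: th_local (th_ev a) ua; rewrite xE; apply/loc_atP; exact: loc_emb.
have pE : p = stalk_prime ad.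
  apply: prime_ideal_ext => a; have h := unitP a; have h' := stalk_prime_out ad a.
  by split=> pa; apply: contrapT => na; [move: (h.2 (h'.1 na))|move: (h'.2 (h.1 na))].
split=> [|r c]; first by rewrite xE pE (stalk_pointE ad).
rewrite xE => /loc_atP[a [b [pb rE]]] rc.
exists (subring_val a), (subring_val b); split=> //.
- exact: (adapted_supported ad (@ring_eltP _ a)).
- exact: (adapted_supported ad (@ring_eltP _ b)).
- exact/unitP.
- by apply: th_fun (th_ev a); rewrite -rE; exact: thM.
Qed.
End Uniqueness.
End StalkData.

(** * The classifying morphism of given R-data *)

Section Classifying.
Context (Y : ringed_space) (hY : is_scheme Y) (D : root_data R Y).
Local Notation st := (scheme_stalk hY).

(** R-data are indexed by the finite type of elements of [R], while the stalkwise construction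
    speaks of vectors of [E]. Vectors outside [R] get the defaults [False] here and 0 in
    [value_at]. *)
Definition roots_at (y : Y) (x : E) : Prop :=
  if (insub x : option R) is Some a then open_set (data_open D a) y else False.

Definition value_at (y : Y) (x : E) : stalk_ring (st y) :=
  if (insub x : option R) is Some a then
    if pselect (open_set (data_open D a) y) is left h
    then germ (st y) h (data_fun D a) else 0
  else 0.

Lemma roots_atE y (a : R) : roots_at y (val a) = open_set (data_open D a) y.
Proof. by rewrite /roots_at valK. Qed.

Lemma value_atE y (a : R) (h : open_set (data_open D a) y) :
  value_at y (val a) = germ (st y) h (data_fun D a).
Proof.
by rewrite /value_at valK; case: pselect => // h'; rewrite (Prop_irrelevance h' h).
Qed.

Lemma roots_at_total y x : x \in R -> roots_at y x \/ roots_at y (- x).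
Proof.
move=> xR; pose a : R := [` xR]%fset; pose b : R := [` root_opp hR xR]%fset.
rewrite -[x]/(val a) -[- _]/(val b) !roots_atE.
have : [set: Y] y by [].
by rewrite -(data_cover D (erefl : val b = - val a)).
Qed.

Lemma value_at_add y x x' : x \in R -> x' \in R -> x + x' \in R ->
  roots_at y x -> roots_at y x' ->
  roots_at y (x + x') /\ value_at y (x + x') = value_at y x * value_at y x'.
Proof.
move=> xR xR' xxR; pose a : R := [` xR]%fset; pose b : R := [` xR']%fset.
pose c : R := [` xxR]%fset.
rewrite -[x + x']/(val c) -[x]/(val a) -[x']/(val b) !roots_atE => ya yb.
have abc : val c = val a + val b by [].
have yc : open_set (data_open D c) y := data_add_sub abc (conj ya yb); split=> //.
rewrite (value_atE ya) (value_atE yb) (value_atE yc).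
have yab : open_set (opens_setI (data_open D a) (data_open D b)) y by split.
have := congr1 (germ (st y) yab) (data_add D abc).
by rewrite rmorphM (germ_res _ _ _ ya) (germ_res _ _ _ yb) (germ_res _ _ _ yc).
Qed.

Lemma value_at_inv y x : x \in R -> roots_at y x -> roots_at y (- x) ->
  value_at y x * value_at y (- x) = 1.
Proof.
move=> xR; pose a : R := [` xR]%fset; pose b : R := [` root_opp hR xR]%fset.
rewrite -[x]/(val a) -[- _]/(val b) !roots_atE => ya yb.
rewrite (value_atE ya) (value_atE yb).
have yab : open_set (opens_setI (data_open D a) (data_open D b)) y by split.
have := congr1 (germ (st y) yab) (data_inverse D (erefl : val b = - val a)).
by rewrite rmorphM rmorph1 (germ_res _ _ _ ya) (germ_res _ _ _ yb).
Qed.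

Lemma value_at_unit y x : x \in R -> roots_at y x -> unit_in (value_at y x) ->
  roots_at y (- x).
Proof.
move=> xR; pose a : R := [` xR]%fset; pose b : R := [` root_opp hR xR]%fset.
rewrite -[x]/(val a) -[- _]/(val b) !roots_atE => ya.
rewrite (value_atE ya) => /germ_unitP uy.
have : nonvanishing (data_fun D a) y by split.
by rewrite (data_nonvanishing D (erefl : val b = - val a)) => -[].
Qed.

Local Notation L0 y := (@stalk_unit0 _ _ (st y)).
Local Notation LD y := (@stalk_unitD _ _ (st y)).
Local Notation tot y := (@roots_at_total y).
Local Notation add y := (@value_at_add y).
Local Notation inv y := (@value_at_inv y).
Local Notation Q y := (good_lattice (roots_at y) (value_at y)).
Local Notation psi_ y := (psi (roots_at y) (value_at y)).
Local Notation smap y := (stalk_map (roots_at y) (value_at y)).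
Local Notation point y := (stalk_point (L0 y) (LD y) (tot y) (add y) (inv y)).

(** [R] is finite, so the open sets containing [y] have an open intersection. At nearby points roots
    may be gained but none is lost. *)
Lemma roots_at_near y : exists V : opens Y, open_set V y /\
  forall y', open_set V y' -> forall x, x \in R -> roots_at y x -> roots_at y' x.
Proof.
suff [V [Vy h]] : exists V : opens Y, open_set V y /\
    forall y', open_set V y' -> forall a, a \in enum (predT : pred R) ->
    open_set (data_open D a) y -> open_set (data_open D a) y'.
  exists V; split=> // y' Vy' x xR; pose a : R := [` xR]%fset.
  by rewrite -[x]/(val a) !roots_atE; apply: h; rewrite // mem_enum.
elim: (enum _) => [|a l [V [Vy h]]].
  by exists (Opens openT).
have [ya|ya] := pselect (open_set (data_open D a) y).
  exists (opens_setI V (data_open D a)); split=> // y' [Vy' ya'] b.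
  by rewrite inE => /orP[/eqP->|bl] //; exact: h.
exists V; split=> // y' Vy' b; rewrite inE => /orP[/eqP->|bl] //.
exact: h.
Qed.

Lemma good_near y w c : good (roots_at y) (value_at y) w c ->
  exists (V : opens Y) (s : 'O_Y (V)), open_set V y /\
  forall y' (Vy : open_set V y'), good (roots_at y') (value_at y') w (germ (st y') Vy s).
Proof.
elim=> [|x {}w {}c xR xy _ [V [s [Vy h]]]].
  by exists (Opens openT), 1; split=> // y' Vy; rewrite rmorph1; exact: good0.
pose a : R := [` xR]%fset.
have ya : open_set (data_open D a) y by rewrite -roots_atE.
pose V' := opens_setI (data_open D a) V.
exists V', (rs_res (@opens_setIl _ (data_open D a) V) (data_fun D a) *
            rs_res (@opens_setIr _ (data_open D a) V) s); split=> // y' Vy'.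
rewrite rmorphM (germ_res _ _ _ Vy'.1) (germ_res _ _ _ Vy'.2) -(value_atE Vy'.1).
apply: (goodS xR _ (h y' Vy'.2)).
by rewrite -[x]/(val a) roots_atE; exact: Vy'.1.
Qed.

(** Each [good] expression is a product of the given functions, so the values of [psi] on [g] near
    [y] are germs of one section. This makes the pointwise prescriptions local on [Y]. *)
Lemma psi_near y g : supported_in (Q y) g -> exists (V : opens Y) (s : 'O_Y (V)),
  open_set V y /\ forall y' (Vy : open_set V y'), supported_in (Q y') g /\
    germ (st y') Vy s = psi_ y' g.
Proof.
elim/supported_ind => {g} [|g g' [V [s [Vy h]]] [V' [s' [Vy' h']]]|z w [c gw]].
- exists (Opens openT), 0; split=> // y' Vy'; split.
    by move=> k; rewrite monalg.msupp0.
  by rewrite rmorph0 psi0.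
- exists (opens_setI V V').
  exists (rs_res (@opens_setIl _ V V') s + rs_res (@opens_setIr _ V V') s').
  split=> // y' Vy''; have [hg he] := h y' Vy''.1; have [hg' he'] := h' y' Vy''.2.
  split.
    by move=> k /(fsubsetP (monalg.msuppD_le _ _)); rewrite inE => /orP[/hg|/hg'].
  by rewrite psiD -he -he' rmorphD (germ_res _ _ _ Vy''.1) (germ_res _ _ _ Vy''.2).
- have [V [s [Vy h]]] := good_near gw.
  exists V, (z%:~R * s); split=> // y' Vy'; split.
    by apply: monomial_supp; exists (germ (st y') Vy' s).
  rewrite psi_monomial (stalk_charE (tot y') (add y') (inv y') (h y' Vy')).
  by rewrite rmorphM rmorph_int.
Qed.

Lemma unit_near y (V : opens Y) (Vy : open_set V y) (s : 'O_Y (V)) :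
  unit_in (germ (st y) Vy s) -> exists (W : opens Y) (WV : W `<=` V) (t : 'O_Y (W)),
  open_set W y /\ rs_res WV s * t = 1.
Proof. by move=> /germ_unitP. Qed.

Lemma adapted_near y sigma : adapted (roots_at y) sigma ->
  exists V : opens Y, open_set V y /\
    forall y', open_set V y' -> adapted (roots_at y') sigma.
Proof.
move=> ad; have [V [Vy h]] := roots_at_near y; exists V; split=> // y' Vy' a aR ha.
exact: h (ad a aR ha).
Qed.

(** A cone adapted at [y] stays adapted nearby, and in its chart the condition that [b] lies outside
    the prime becomes invertibility of a section with germs [psi b]. *)
Lemma point_cont (W : set X) : open W -> open ((fun y => point y) @^-1` W).
Proof.
move=> oW; apply: open_local => y Wy.
have [sigma ad] := adapted_exists (tot y) (add y).
move: Wy; rewrite /= (stalk_pointE (L0 y) (LD y) (tot y) (add y) (inv y) ad) => Wy.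
have [b pb bW] := zariski_basis (open_toric_pre sigma oW) Wy.
have /stalk_prime_out ub := pb.
have sb := adapted_supported (value_at y) ad (@ring_eltP _ b).
have [V [s [Vy hs]]] := psi_near sb.
have [V' [Vy' hV']] := adapted_near ad.
rewrite -(hs y Vy).2 in ub; have [V'' [V''V [t [V''y st1]]]] := unit_near ub.
exists (opens_setI V' V''); split; [exact: openP|by []|].
move=> y' [Vy1 Vy2]; have ad' := hV' y' Vy1.
rewrite /= (stalk_pointE (L0 y') (LD y') (tot y') (add y') (inv y') ad').
apply: bW; apply/stalk_prime_out; rewrite -(hs y' (V''V _ Vy2)).2.
exists (germ (st y') Vy2 t).
by rewrite -(rmorph1 (germ (st y') Vy2)) -st1 rmorphM (germ_res _ _ _ (V''V _ Vy2)).
Qed.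

Definition point_pre (W : opens X) : opens Y := opens_preimage point_cont W.

(** The germ that the pullback of [s] must have at [y]. Membership of the point in [W] makes [W]
    nonempty, so that the value of [s] is unique. *)
Definition classified (W : opens X) (s : 'O_X (W)) y (c : stalk_ring (st y)) : Prop :=
  open_set W (point y) /\ exists2 r, is_val s r & smap y r c.

Lemma classified_fun (W : opens X) (s : 'O_X (W)) y c c' :
  @classified W s y c -> @classified W s y c' -> c = c'.
Proof.
move=> [Wy [r sr rc]] [_ [r' sr' rc']].
rewrite (is_val_fun Wy sr' sr) in rc'.
exact: (stalk_map_fun (tot y) (add y) (inv y) rc rc').
Qed.

(** The fraction that represents the value of [s] at [y] also serves nearby: its numerator and
    denominator are realized by sections, and the second of these is invertible near [y]. *)
Lemma classified_section (W : opens X) (s : 'O_X (W)) :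
  exists t : 'O_Y (point_pre W),
    forall y (Wy : open_set (point_pre W) y), classified s (germ (st y) Wy t).
Proof.
apply: section_of_germs => [y|y Wy]; first exact: classified_fun.
have [r sr] := is_val_ex s.
have lr : loc_at (point y) r by exact: is_val_loc sr Wy.
have [sigma ad] := adapted_exists (tot y) (add y).
rewrite (stalk_pointE (L0 y) (LD y) (tot y) (add y) (inv y) ad) in lr.
move/loc_atP: lr => /stalk_map_loc[a [b [ub rE _]]].
have sa := adapted_supported (value_at y) ad (@ring_eltP _ a).
have sb := adapted_supported (value_at y) ad (@ring_eltP _ b).
have [V1 [t1 [Vy1 h1]]] := psi_near sa; have [V2 [t2 [Vy2 h2]]] := psi_near sb.
rewrite -(h2 y Vy2).2 in ub; have [V3 [V32 [t3 [Vy3 t23]]]] := unit_near ub.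
exists (opens_setI V1 V3).
exists (rs_res (@opens_setIl _ V1 V3) t1 * rs_res (@opens_setIr _ V1 V3) t3).
split=> // y' [Vy1' Vy3'] Wy'; split=> //; exists r => //.
have [ga ea] := h1 y' Vy1'; have [gb eb] := h2 y' (V32 _ Vy3').
have inv3 : germ (st y') Vy3' t3 * psi_ y' (subring_val b) = 1.
  rewrite -(rmorph1 (germ (st y') Vy3')) -t23 rmorphM (germ_res _ _ _ (V32 _ Vy3')) eb.
  by rewrite mulrC.
exists (subring_val a), (subring_val b); split=> //.
  by exists (germ (st y') Vy3' t3); rewrite mulrC.
rewrite rmorphM (germ_res _ _ _ Vy1') (germ_res _ _ _ Vy3') ea -mulrA.
by rewrite inv3 mulr1.
Qed.

Lemma classifying_mor_exists : exists h : scheme_mor Y X,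
  (forall y, h y = point y) /\
  forall (W : opens X) (s : 'O_X (W)) y (Wy : open_set (mor_pre h W) y),
    classified s (germ (st y) Wy (mor_sec h W s)).
Proof.
pose f (W : opens X) (s : 'O_X (W)) : 'O_Y (point_pre W) :=
  sval (cid (classified_section s)).
have fP W s y (Wy : open_set (point_pre W) y) :
    classified s (germ (st y) Wy (f W s)).
  exact: (svalP (cid (classified_section s))).
(* Uniqueness of a section with the prescribed germs reduces the homomorphism laws and compatibility
   with restriction to the pointwise facts on [stalk_map]. *)
have fU W s t :
    (forall y (Wy : open_set (point_pre W) y), classified s (germ (st y) Wy t)) ->
    f W s = t.
  move=> h; apply: (section_germ_eq (hY := hY)) => y Wy.
  exact: classified_fun (fP W s y Wy) (h y Wy).
have fB W : zmod_morphism (f W).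
  move=> s s'; apply: fU => y Wy; rewrite rmorphB.
  have [_ [r sr rc]] := fP W s y Wy; have [_ [r' sr' rc']] := fP W s' y Wy.
  split=> //; exists (r - r'); first exact: is_valB.
  exact: (stalk_mapB (tot y) (add y) (inv y) rc rc').
have fM W : monoid_morphism (f W).
  split=> [|s s']; apply: fU => y Wy.
    rewrite rmorph1; split=> //; exists 1; first exact: is_val1.
    exact: (stalk_map1 (tot y) (add y) (inv y)).
  rewrite rmorphM.
  have [_ [r sr rc]] := fP W s y Wy; have [_ [r' sr' rc']] := fP W s' y Wy.
  split=> //; exists (r * r'); first exact: is_valM.
  exact: (stalk_mapM (tot y) (add y) (inv y) rc rc').
pose g (W : opens X) : {rmorphism 'O_X (W) -> 'O_Y (point_pre W)} :=
  HB.pack (f W) (GRing.isZmodMorphism.Build _ _ (f W) (fB W))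
    (GRing.isMonoidMorphism.Build _ _ (f W) (fM W)).
have gres (V W : opens X) (WV : W `<=` V) (WV' : point_pre W `<=` point_pre V)
    (s : 'O_X (V)) : g W (rs_res WV s) = rs_res WV' (g V s).
  apply: fU => y Wy; rewrite (germ_res _ _ _ (WV' _ Wy)).
  have [_ [r sr rc]] := fP V s y (WV' _ Wy).
  by split=> //; exists r => //; exact: is_val_res.
pose h : rs_mor Y X := @RsMor Y X (fun y => point y) point_cont g gres.
have hloc : is_local h.
  move=> V s y Vy; have Vy' : open_set (point_pre V) y by [].
  move=> /(@germ_unitP _ _ (st y) _ Vy'); have [_ [r sr rc]] := fP V s y Vy'.
  move=> uc; apply: (germ_unit_valP Vy sr).2.
  by apply: stalk_map_local rc uc; exact: is_val_loc sr Vy.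
by exists (SchemeMor hloc).
Qed.

Section Universal.
Context (u : root_data R X) (hu : is_universal u).

Lemma classifying_mor_pullback : exists h : scheme_mor Y X, pullback h u = D.
Proof.
have [h [hE hs]] := classifying_mor_exists; exists h.
have openE a y : open_set (mor_pre h (data_open u a)) y <-> open_set (data_open D a) y.
  rewrite -[open_set (mor_pre _ _) y]/(open_set (data_open u a) (h y)) hE.
  rewrite (universal_openP hu) root_eltE -roots_atE.
  exact: (stalk_point_root (L0 y) (LD y) (tot y) (add y) (inv y)
    (@value_at_unit y) (valP a)).
apply: root_data_ext => [a|a V VD VD'].
  by apply/seteqP; split=> y /openE.
apply: (section_germ_eq (hY := hY)) => y Vy.
rewrite (germ_res _ _ _ (VD _ Vy)) (germ_res _ _ _ (VD' _ Vy)) -(value_atE (VD' _ Vy)).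
have [Wy [r sr rc]] := hs _ (data_fun u a) y (VD _ Vy).
have vE : is_val (data_fun u a) (emb (character (root_elt a))) by exact: universal_val.
have rE := is_val_fun Wy sr vE.
rewrite rE root_eltE in rc.
have Pa : roots_at y (val a) by rewrite roots_atE; exact: VD' Vy.
have ra := stalk_map_root (tot y) (add y) (inv y) (valP a) Pa.
exact: (stalk_map_fun (tot y) (add y) (inv y) rc ra).
Qed.

(** Relating the value of a section near [h y] to the germ of its pullback gives a relation [th] as
    in [stalk_point_unique], which leaves no freedom for the point or the germs. *)
Lemma pullback_classified (h : scheme_mor Y X) : pullback h u = D ->
  (forall y, h y = point y) /\
  forall (W : opens X) (s : 'O_X (W)) y (Wy : open_set (mor_pre h W) y),
    classified s (germ (st y) Wy (mor_sec h W s)).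
Proof.
move=> hD.
have openE a y : open_set (data_open u a) (h y) <-> open_set (data_open D a) y.
  by rewrite -hD.
have funE a y (Wy : open_set (mor_pre h (data_open u a)) y)
    (Dy : open_set (data_open D a) y) :
    germ (st y) Wy (mor_sec h (data_open u a) (data_fun u a)) =
    germ (st y) Dy (data_fun D a).
  by move: Dy; rewrite -hD => Dy; rewrite (Prop_irrelevance Dy Wy).
pose th y (r : F) (c : stalk_ring (st y)) := exists (W : opens X) (s : 'O_X (W))
  (Wy : open_set (mor_pre h W) y), is_val s r /\ germ (st y) Wy (mor_sec h W s) = c.
have thE (W V : opens X) (VW : V `<=` W) (s : 'O_X (W)) y
    (Wy : open_set (mor_pre h W) y) (Vy : open_set (mor_pre h V) y) :
    germ (st y) Vy (mor_sec h V (rs_res VW s)) = germ (st y) Wy (mor_sec h W s).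
  have VW' : mor_pre h V `<=` mor_pre h W by move=> z; exact: VW.
  by rewrite (mor_sec_res VW VW') (germ_res _ _ _ Wy).
have key y : h y = point y /\ forall r c, loc_at (h y) r -> th y r c -> smap y r c.
  apply: (stalk_point_unique (L0 y) (LD y) (tot y) (add y) (inv y)).
  - move=> r lr; have [//|s sr] := @section_exists (open_at r) r.
    have Wy : open_set (mor_pre h (open_at r)) y := lr.
    by exists (germ (st y) Wy (mor_sec h _ s)), (open_at r), s, Wy.
  - move=> r c c' [W [s [Wy [sr <-]]]] [W' [s' [Wy' [sr' <-]]]].
    pose V := opens_setI W W'; have Vy : open_set (mor_pre h V) y by split.
    rewrite -(thE W V (@opens_setIl _ W W') s y Wy Vy).
    rewrite -(thE W' V (@opens_setIr _ W W') s' y Wy' Vy).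
    congr (germ _ _ (mor_sec h V _)).
    exact: (is_val_inj (is_val_res _ sr) (is_val_res _ sr')).
  - move=> r r' c c' [W [s [Wy [sr <-]]]] [W' [s' [Wy' [sr' <-]]]].
    pose V := opens_setI W W'; have Vy : open_set (mor_pre h V) y by split.
    exists V, (rs_res (@opens_setIl _ W W') s * rs_res (@opens_setIr _ W W') s'), Vy.
    split; first exact: is_valM (is_val_res _ sr) (is_val_res _ sr').
    by rewrite !rmorphM (thE _ _ _ _ _ Wy) (thE _ _ _ _ _ Wy').
  - move=> r r' c c' [W [s [Wy [sr <-]]]] [W' [s' [Wy' [sr' <-]]]].
    pose V := opens_setI W W'; have Vy : open_set (mor_pre h V) y by split.
    exists V, (rs_res (@opens_setIl _ W W') s - rs_res (@opens_setIr _ W W') s'), Vy.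
    split; first exact: is_valB (is_val_res _ sr) (is_val_res _ sr').
    by rewrite !rmorphB (thE _ _ _ _ _ Wy) (thE _ _ _ _ _ Wy').
  - have Ty : open_set (mor_pre h (Opens openT)) y by [].
    by exists (Opens openT), 1, Ty; rewrite !rmorph1; split=> //; exact: is_val1.
  - move=> r c _ [W [s [Wy [sr <-]]]] /germ_unitP us.
    exact: (germ_unit_valP Wy sr).1 (@scheme_mor_local _ _ h W s y Wy us).
  - move=> x xR; pose a : R := [` xR]%fset.
    have -> : rootl R x = root_elt a by rewrite root_eltE.
    by move=> /(universal_openP hu)/openE; rewrite -[x]/(val a) roots_atE.
  - move=> x xR; pose a : R := [` xR]%fset.
    have -> : rootl R x = root_elt a by rewrite root_eltE.
    rewrite -[x]/(val a) roots_atE => Dy.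
    have Wy : open_set (mor_pre h (data_open u a)) y by apply/openE.
    exists (data_open u a), (data_fun u a), Wy; split; first exact: universal_val.
    by rewrite (value_atE Dy); exact: funE.
split=> [y|W s y Wy]; first exact: (key y).1.
have [r sr] := is_val_ex s; split.
  by have := Wy; rewrite /= -[open_set _ _]/(open_set W (h y)) (key y).1.
exists r => //; apply: (key y).2; first exact: is_val_loc sr Wy.
by exists W, s, Wy.
Qed.
End Universal.
End Classifying.

(** * Bijectivity and naturality of the pullback *)

Section Representability.
Context (u : root_data R X) (hu : is_universal u).

Lemma pullback_inj (Y : ringed_space) (h h' : scheme_mor Y X) : is_scheme Y ->
  pullback h u = pullback h' u -> h = h'.
Proof.
move=> hY e.
have [hp hs] := pullback_classified hY hu e.
have [hp' hs'] := pullback_classified hY hu (erefl (pullback h' u)).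
apply: scheme_mor_ext => [y|W s V Vh Vh']; first by rewrite hp hp'.
apply: (section_germ_eq (hY := hY)) => y Vy.
rewrite (germ_res _ _ _ (Vh _ Vy)) (germ_res _ _ _ (Vh' _ Vy)).
exact: classified_fun (hs W s y _) (hs' W s y _).
Qed.

Lemma universal_represents : represents_root_data u.
Proof.
split=> [Y' Y g h _ _|Y hY]; first exact: pullback_comp.
have [k kK] := choice (fun D => classifying_mor_pullback hY D hu).
by exists k => // h; apply: pullback_inj.
Qed.
End Representability.

End ToricVariety.

Theorem theorem1p20 (K : realType) (E : vectType K) (ip : {dot E for idfun})
    (R : {fset E}) (hR : is_root_system ip R) :
  [/\ is_scheme (toric_variety R),
      exists! u : root_data R (toric_variety R), is_universal u &
      forall u : root_data R (toric_variety R),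
        is_universal u -> represents_root_data u].
Proof.
have [F [emb [emb_inj emb_inv]]] :=
  fraction_field_exists (@root_group_ring_domain K E ip R).
split; first exact: (toric_scheme hR emb_inj emb_inv).
- have [u hu] := universal_data_exists hR emb_inj emb_inv.
  by exists u; split=> // u' hu'; exact: (universal_data_unique emb_inj emb_inv hu hu').
- by move=> u hu; exact: (universal_represents hR emb_inj emb_inv hu).
Qed.
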